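(* Let $\mathbf{QS}_{ess}$ be the family of all real quadratic systems $(S)$ with $\gcd(P,Q)=1$ and $Z\nmid C$. For $(S)\in\mathbf{QS}_{ess}$ the possible values of $\Delta_S$ are $0,1,2,3,4$. For each value of $\Delta_S$ the possible values of $M_C$, and for each pair $(\Delta_S,M_C)$ the possible forms of the divisor $D_S$, are those listed below; and a system in $\mathbf{QS}_{ess}$ has the listed $(\Delta_S,M_C,D_S)$ if and only if it satisfies the conditions listed on the same line. (Here $p,q,r$ denote distinct points of the line $Z=0$ of $\mathbb P^2(\mathbb C)$, real unless marked with an upper index $c$; $q^c,r^c$ are non-real.) **$\Delta_S=0$.** $(\Sigma_1)$ $M_C=1$, $D_S=\binom01p+\binom01q+\binom01r$: $\mu_0\ne0$, $(\mathcal I_1)$. $(\Sigma_2)$ $M_C=1$, $\binom01p+\binom01q^c+\binom01r^c$: $\mu_0\ne0$, $(\mathcal I_2)$. $(\Sigma_3)$ $M_C=2$, $\binom01p+\binom02q$: $\mu_0\ne0$, $(\mathcal I_3)$. $(\Sigma_4)$ $M_C=3$, $\binom03p$: $\mu_0\ne0$, $(\mathcal I_4)$. **$\Delta_S=1$** (all with $\mu_0=0$, $\mu_1\ne0$). $(\Sigma_5)$ $M_C=1$, $\binom11p+\binom01q+\binom01r$: $(\mathcal I_1)$. $(\Sigma_6)$ $M_C=1$, $\binom11p+\binom01q^c+\binom01r^c$: $(\mathcal I_2)$. $(\Sigma_7)$ $M_C=2$, $\binom11p+\binom02q$: $\kappa\ne0$, $(\mathcal I_3)$. $(\Sigma_8)$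 $M_C=2$, $\binom01p+\binom12q$: $\kappa=0$, $(\mathcal I_3)$. $(\Sigma_9)$ $M_C=3$, $\binom13p$: $(\mathcal I_4)$. **$\Delta_S=2$** (all with $\mu_0=\mu_1=0$, $\mu_2\ne0$). $(\Sigma_{10})$ $M_C=1$, $\binom21p+\binom01q+\binom01r$: $\kappa\ne0$, $(\mathcal I_1)$. $(\Sigma_{11})$ $M_C=1$, $\binom11p+\binom11q+\binom01r$: $\kappa=0$, $(\mathcal I_1)$. $(\Sigma_{12})$ $M_C=1$, $\binom21p+\binom01q^c+\binom01r^c$: $\kappa\ne0$, $(\mathcal I_2)$. $(\Sigma_{13})$ $M_C=1$, $\binom01p+\binom11q^c+\binom11r^c$: $\kappa=0$, $(\mathcal I_2)$. $(\Sigma_{14})$ $M_C=2$, $\binom21p+\binom02q$: $\kappa\ne0$, $(\mathcal I_3)$. $(\Sigma_{15})$ $M_C=2$, $\binom11p+\binom12q$: $\kappa=0$, $L=0$, $(\mathcal I_3)$. $(\Sigma_{16})$ $M_C=2$, $\binom01p+\binom22q$: $\kappa=0$, $L\ne0$, $(\mathcal I_3)$. $(\Sigma_{17})$ $M_C=3$, $\binom23p$: $(\mathcal I_4)$. **$\Delta_S=3$** (all with $\mu_0=\mu_1=\mu_2=0$, $\mu_3\ne0$). $(\Sigma_{18})$ $M_C=1$, $\binom31p+\binom01q+\binom01r$: $\kappa\ne0$, $(\mathcal I_1)$. $(\Sigma_{19})$ $M_C=1$, $\binom21p+\binom11q+\binom01r$: $\kappa=0$, $(\mathcal I_1)$. $(\Sigma_{20})$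 $M_C=1$, $\binom31p+\binom01q^c+\binom01r^c$: $(\mathcal I_2)$. $(\Sigma_{21})$ $M_C=2$, $\binom31p+\binom02q$: $\kappa\ne0$, $(\mathcal I_3)$. $(\Sigma_{22})$ $M_C=2$, $\binom21p+\binom12q$: $\kappa=L=0$, $\kappa_1\ne0$, $(\mathcal I_3)$. $(\Sigma_{23})$ $M_C=2$, $\binom11p+\binom22q$: $\kappa=L=0$, $\kappa_1=0$, $(\mathcal I_3)$. $(\Sigma_{24})$ $M_C=2$, $\binom01p+\binom32q$: $\kappa=0$, $L\ne0$, $(\mathcal I_3)$. $(\Sigma_{25})$ $M_C=3$, $\binom33p$: $(\mathcal I_4)$. **$\Delta_S=4$** (all with $\mu_0=\mu_1=\mu_2=\mu_3=0$, $\mu_4\ne0$). $(\Sigma_{26})$ $M_C=1$, $\binom41p+\binom01q+\binom01r$: $\kappa\ne0$, $(\mathcal I_1)$. $(\Sigma_{27})$ $M_C=1$, $\binom31p+\binom11q+\binom01r$: $\kappa=0$, $K_1\ne0$, $(\mathcal I_1)$. $(\Sigma_{28})$ $M_C=1$, $\binom21p+\binom21q+\binom01r$: $\kappa=0$, $K_1=0$, $(\mathcal I_1)$. $(\Sigma_{29})$ $M_C=1$, $\binom41p+\binom01q^c+\binom01r^c$: $\kappa\ne0$, $(\mathcal I_2)$. $(\Sigma_{30})$ $M_C=1$, $\binom01p+\binom21q^c+\binom21r^c$: $\kappa=0$, $(\mathcal I_2)$. $(\Sigma_{31})$ $M_C=2$, $\binom41p+\binom02q$: $\kappa\ne0$,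 $(\mathcal I_3)$. $(\Sigma_{32})$ $M_C=2$, $\binom31p+\binom12q$: $\kappa=L=0$, $\kappa_1\ne0$, $(\mathcal I_3)$. $(\Sigma_{33})$ $M_C=2$, $\binom21p+\binom22q$: $\kappa=L=\kappa_1=0$, $K_1=0$, $(\mathcal I_3)$. $(\Sigma_{34})$ $M_C=2$, $\binom11p+\binom32q$: $\kappa=L=\kappa_1=0$, $K_1\ne0$, $(\mathcal I_3)$. $(\Sigma_{35})$ $M_C=2$, $\binom01p+\binom42q$: $\kappa=0$, $L\ne0$, $(\mathcal I_3)$. $(\Sigma_{36})$ $M_C=3$, $\binom43p$: $(\mathcal I_4)$. The conditions $(\mathcal I_j)$ are: $(\mathcal I_1)$: $\eta>0$; $(\mathcal I_2)$: $\eta<0$; $(\mathcal I_3)$: $\eta=0$ and $M\ne0$; $(\mathcal I_4)$: $M=0$.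
   Context: A real quadratic system $(S)$ is $\dot x=p(x,y)=p_0+p_1+p_2$, $\dot y=q(x,y)=q_0+q_1+q_2$ with $p,q\in\mathbb R[x,y]$, $\max(\deg p,\deg q)=2$, and $p_i,q_i$ the homogeneous parts of degree $i$. Its coefficients are $a=(a_{00},\dots,b_{02})\in\mathbb R^{12}$, where $p=a_{00}+a_{10}x+a_{01}y+a_{20}x^2+2a_{11}xy+a_{02}y^2$, $q=b_{00}+b_{10}x+b_{01}y+b_{20}x^2+2b_{11}xy+b_{02}y^2$. Put $P(X,Y,Z)=Z^2p(X/Z,Y/Z)$, $Q(X,Y,Z)=Z^2q(X/Z,Y/Z)$, $C=YP-XQ$. Divisors. $I_w(F,G)$ is the intersection multiplicity at $w\in\mathbb P^2(\mathbb C)$ of the projective curves $F=0$, $G=0$. For $\gcd(P,Q)=1$, $Z\nmid C$, with sums over the points $w$ of the complex line $Z=0$: $D_S(P,Q;Z)=\sum_w I_w(P,Q)\,w$, $D_S(C,Z)=\sum_w I_w(C,Z)\,w$, $D_S=\sum_w\binom{I_w(P,Q)}{I_w(C,Z)}w$. $\Delta_S=\sum_w I_w(P,Q)$ is the degree of $D_S(P,Q;Z)$, and $M_C=\max_w I_w(C,Z)$. Polynomials. For binary forms, $\mathrm{Jacob}(f,g)=f_xg_y-f_yg_x$, $\mathrm{Hess}(f)=f_{xx}f_{yy}-f_{xy}^2$, $\mathrm{Discrim}$ is the usual discriminant ($B^2-4AC$ for $Ax^2+Bxy+Cy^2$), and $(f,g)^{(2)}=f_{xx}g_{yy}-2f_{xy}g_{xy}+f_{yy}g_{xx}$.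 Define $C_i=yp_i-xq_i$ $(i=0,1,2)$; $M=2\,\mathrm{Hess}(C_2)$; $\eta=\mathrm{Discrim}(C_2)$; $K=\mathrm{Jacob}(p_2,q_2)$; $\mu_0=\mathrm{Discrim}(K)/16=\mathrm{Res}_x(p_2,q_2)/y^4$; $H=-\mathrm{Discrim}(\alpha p_2+\beta q_2)|_{\alpha=y,\beta=-x}$ (discriminant as a quadratic form in $x,y$ with $\alpha,\beta$ constants, then substitute); $L=4K+8H-M$; $K_1=p_1q_2-p_2q_1$; $\kappa=(M,K)^{(2)}$; $\kappa_1=(M,C_1)^{(2)}$. Let $\mathcal L=x\mathbf L_2-y\mathbf L_1$ with $\mathbf L_1=2a_{00}\partial_{a_{10}}+a_{10}\partial_{a_{20}}+\tfrac12a_{01}\partial_{a_{11}}+2b_{00}\partial_{b_{10}}+b_{10}\partial_{b_{20}}+\tfrac12b_{01}\partial_{b_{11}}$, $\mathbf L_2=2a_{00}\partial_{a_{01}}+a_{01}\partial_{a_{02}}+\tfrac12a_{10}\partial_{a_{11}}+2b_{00}\partial_{b_{01}}+b_{01}\partial_{b_{02}}+\tfrac12b_{10}\partial_{b_{11}}$, and $\mu_i(a,x,y)=\frac1{i!}\mathcal L^i(\mu_0)$, $i=1,\dots,4$. For a given system, ''$U=0$'' means that $U(a,x,y)$, evaluated at the coefficients of the system, vanishes identically in $x,y$; ''$U\neq0$'' is the negation. *)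

(* Defs.v *)
From HB Require Import structures.
From mathcomp Require Import all_boot all_order all_algebra.
From mathcomp Require Import fraction mpoly complex.
From mathcomp Require Import boolp classical_sets fsbigop reals.

Set Implicit Arguments.
Unset Strict Implicit.
Unset Printing Implicit Defensive.

Import Order.TTheory GRing.Theory Num.Theory.

Local Open Scope classical_set_scope.
Local Open Scope ring_scope.

(* Positions of the twelve coefficients; they index both the coefficients of a
   system and the variables of the polynomial ring {mpoly R[12]} = R[a]. *)
Definition a00 := @Ordinal 12 0 isT.
Definition a10 := @Ordinal 12 1 isT.
Definition a01 := @Ordinal 12 2 isT.
Definition a20 := @Ordinal 12 3 isT.
Definition a11 := @Ordinal 12 4 isT.
Definition a02 := @Ordinal 12 5 isT.
Definition b00 := @Ordinal 12 6 isT.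
Definition b10 := @Ordinal 12 7 isT.
Definition b01 := @Ordinal 12 8 isT.
Definition b20 := @Ordinal 12 9 isT.
Definition b11 := @Ordinal 12 10 isT.
Definition b02 := @Ordinal 12 11 isT.

Definition ix := @Ordinal 2 0 isT.
Definition iy := @Ordinal 2 1 isT.

Definition iX := @Ordinal 3 0 isT.
Definition iY := @Ordinal 3 1 isT.
Definition iZ := @Ordinal 3 2 isT.

(* The coefficient ring is arbitrary, so that the same formulas apply to a real
   system and to the generic system over {mpoly R[12]}. *)
Definition qsys (A : Type) := 'I_12 -> A.

Section Forms.
Variable A : comNzRingType.
Implicit Types f g : {mpoly A[2]}.

Definition vx : {mpoly A[2]} := 'X_ix.
Definition vy : {mpoly A[2]} := 'X_iy.

Definition cf f (i j : nat) : A := f@_(U_(ix) *+ i + U_(iy) *+ j)%MM.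

Definition Jacob f g : {mpoly A[2]} :=
  f^`M(ix) * g^`M(iy) - f^`M(iy) * g^`M(ix).

Definition Hess f : {mpoly A[2]} :=
  f^`M(ix)^`M(ix) * f^`M(iy)^`M(iy) - f^`M(ix)^`M(iy) ^+ 2.

Definition transvectant2 f g : {mpoly A[2]} :=
  f^`M(ix)^`M(ix) * g^`M(iy)^`M(iy)
  - (f^`M(ix)^`M(iy) * g^`M(ix)^`M(iy)) *+ 2
  + f^`M(iy)^`M(iy) * g^`M(ix)^`M(ix).

Definition discrim2 f : A := cf f 1 1 ^+ 2 - (cf f 2 0 * cf f 0 2) *+ 4.

Definition discrim3 f : A :=
  let a := cf f 3 0 in let b := cf f 2 1 in
  let c := cf f 1 2 in let d := cf f 0 3 in
  b ^+ 2 * c ^+ 2 - (a * c ^+ 3) *+ 4 - (b ^+ 3 * d) *+ 4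
  + (a * b * c * d) *+ 18 - (a ^+ 2 * d ^+ 2) *+ 27.

End Forms.

Section Invariants.
Variables (A : comNzRingType) (S : qsys A).
Local Notation vx := (vx A).
Local Notation vy := (vy A).

Definition p0 : {mpoly A[2]} := (S a00)%:MP.
Definition p1 : {mpoly A[2]} := S a10 *: vx + S a01 *: vy.
Definition p2 : {mpoly A[2]} :=
  S a20 *: vx ^+ 2 + (S a11 *+ 2) *: (vx * vy) + S a02 *: vy ^+ 2.
Definition q0 : {mpoly A[2]} := (S b00)%:MP.
Definition q1 : {mpoly A[2]} := S b10 *: vx + S b01 *: vy.
Definition q2 : {mpoly A[2]} :=
  S b20 *: vx ^+ 2 + (S b11 *+ 2) *: (vx * vy) + S b02 *: vy ^+ 2.

Definition C1 : {mpoly A[2]} := vy * p1 - vx * q1.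
Definition C2 : {mpoly A[2]} := vy * p2 - vx * q2.

Definition Mform : {mpoly A[2]} := Hess C2 *+ 2.
Definition eta : A := discrim3 C2.
Definition Kform : {mpoly A[2]} := Jacob p2 q2.

(* alpha = y and beta = -x are constants of the ring over which the discriminant
   is taken: p2 and q2 are read in (A[x,y])[x,y]. *)
Definition Hform : {mpoly A[2]} :=
  - discrim2 (vy *: map_mpoly (@mpolyC 2 A) p2
              + (- vx) *: map_mpoly (@mpolyC 2 A) q2).

Definition Lform : {mpoly A[2]} := Kform *+ 4 + Hform *+ 8 - Mform.
Definition K1form : {mpoly A[2]} := p1 * q2 - p2 * q1.
Definition kappa : {mpoly A[2]} := transvectant2 Mform Kform.
Definition kappa1 : {mpoly A[2]} := transvectant2 Mform C1.

(* Z^2 f(X/Z, Y/Z) for f = f0 + f1 + f2 with f_i homogeneous of degree i *)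
Definition homogenize2 (f0 f1 f2 : {mpoly A[2]}) : {mpoly A[3]} :=
  let XY := [tuple 'X_iX; 'X_iY] in
  (f0 \mPo XY) * 'X_iZ ^+ 2 + (f1 \mPo XY) * 'X_iZ + (f2 \mPo XY).

Definition bigP : {mpoly A[3]} := homogenize2 p0 p1 p2.
Definition bigQ : {mpoly A[3]} := homogenize2 q0 q1 q2.
Definition bigC : {mpoly A[3]} := 'X_iY * bigP - 'X_iX * bigQ.

End Invariants.

Section Mu.
Variable R : realType.
Local Notation Ra := {mpoly R[12]}.
Implicit Types (F : Ra) (U : {mpoly Ra[2]}).

Definition generic : qsys Ra := fun i => 'X_i.

Definition mu0_gen : Ra := (16%:R^-1 : R) *: discrim2 (Kform generic).

Definition L1 F : Ra :=
  'X_a00 * F^`M(a10) *+ 2 + 'X_a10 * F^`M(a20)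
  + (2%:R^-1 : R) *: ('X_a01 * F^`M(a11))
  + 'X_b00 * F^`M(b10) *+ 2 + 'X_b10 * F^`M(b20)
  + (2%:R^-1 : R) *: ('X_b01 * F^`M(b11)).

Definition L2 F : Ra :=
  'X_a00 * F^`M(a01) *+ 2 + 'X_a01 * F^`M(a02)
  + (2%:R^-1 : R) *: ('X_a10 * F^`M(a11))
  + 'X_b00 * F^`M(b01) *+ 2 + 'X_b01 * F^`M(b02)
  + (2%:R^-1 : R) *: ('X_b10 * F^`M(b11)).

(* L1 and L2 act on R[a][x,y] coefficientwise *)
Definition calL U : {mpoly Ra[2]} :=
  vx Ra * map_mpoly L2 U - vy Ra * map_mpoly L1 U.

Definition mu_gen (i : nat) : {mpoly Ra[2]} :=
  ((i`!)%:R^-1 : R)%:MP_[12] *: iter i calL mu0_gen%:MP.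

Definition mu (S : qsys R) (i : nat) : {mpoly R[2]} :=
  map_mpoly (meval S) (mu_gen i).

End Mu.

Section Plane.
Variable R : realType.
Local Notation CC := R[i].

(* P^2(C): the lines through the origin of C^3 *)
Definition P2 := {w : {vspace 'rV[CC]_3} | \dim w == 1%N}.

(* homogeneous coordinates of w (one choice among the nonzero multiples) *)
Definition hcoord (w : P2) : 'I_3 -> CC := fun i => vpick (val w) 0 i.

Definition at_infinity (w : P2) : bool := hcoord w iZ == 0.

Definition real_point (w : P2) : Prop :=
  exists v : 'rV[R]_3, val w = <[map_mx (real_complex R) v]>%VS.

Local Notation poly3 := {mpoly CC[3]}.
Local Notation "x %:F" := (@FracField.tofrac _ x).

(* the local ring of P^2(C) at w, inside C(X,Y,Z) *)
Definition local_ring (w : P2) : set {fraction poly3} :=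
  [set f | exists (n : nat) (h s : poly3),
    [/\ h \is n.-homog, s \is n.-homog, s.@[hcoord w] != 0
      & f = h%:F / s%:F]].

(* its ideal generated by the local equations of F = 0 and G = 0 *)
Definition local_ideal (F G : poly3) (w : P2) : set {fraction poly3} :=
  [set f | exists (n : nat) (A B s : poly3),
    [/\ A * F + B * G \is n.-homog, s \is n.-homog, s.@[hcoord w] != 0
      & f = (A * F + B * G)%:F / s%:F]].

Definition scal (c : CC) (f : {fraction poly3}) : {fraction poly3} :=
  (c%:MP_[3])%:F * f.

(* the complex vector space O / J has dimension d: the classes of e_0, ...,
   e_(d-1) form a basis *)
Definition quotient_dim (O J : set {fraction poly3}) (d : nat) : Prop :=
  exists e : 'I_d -> {fraction poly3},
    [/\ forall i, O (e i),
        forall f, O f ->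
          exists c : 'I_d -> CC, J (f - \sum_i scal (c i) (e i))
      & forall c : 'I_d -> CC,
          J (\sum_i scal (c i) (e i)) -> forall i, c i = 0].

(* The value is 0 where F = 0 and G = 0 share a component through w; this does
   not occur for the curves below when gcd(P,Q) = 1 and Z does not divide C. *)
Definition intersection_mult (F G : poly3) (w : P2) : nat :=
  xget 0%N [set d | quotient_dim (local_ring w) (local_ideal F G w) d].

Definition complexify (F : {mpoly R[3]}) : poly3 :=
  map_mpoly (real_complex R) F.

Variable S : qsys R.

Definition IPQ (w : P2) : nat :=
  intersection_mult (complexify (bigP S)) (complexify (bigQ S)) w.

Definition ICZ (w : P2) : nat :=
  intersection_mult (complexify (bigC S)) 'X_iZ w.

(* a divisor is given by the coefficient of each point *)
Definition divisor_S (w : P2) : nat * nat :=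
  if at_infinity w then (IPQ w, ICZ w) else 0.

Definition Delta_S : nat := \sum_(w \in [set w | at_infinity w]) IPQ w.

Definition M_C : nat := \big[maxn/0%N]_(w \in [set w | at_infinity w]) ICZ w.

Definition quadratic : Prop :=
  maxn (msize (p0 S + p1 S + p2 S)) (msize (q0 S + q1 S + q2 S)) = 3%N.

Definition coprime_PQ : Prop :=
  forall D A B : {mpoly R[3]},
    bigP S = D * A -> bigQ S = D * B -> D \is a GRing.unit.

Definition Z_divides_C : Prop :=
  exists A : {mpoly R[3]}, bigC S = 'X_iZ * A.

Definition QSess : Prop := [/\ quadratic, coprime_PQ & ~ Z_divides_C].

(* A summand (a over b) w of a divisor, recording whether w is a real point. *)
Record dterm := DTerm { dcoef : nat * nat; dreal : bool }.

Definition has_form (form : seq dterm) : Prop :=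
  exists pt : 'I_(size form) -> P2,
    [/\ injective pt,
        forall i, at_infinity (pt i),
        forall i, real_point (pt i) <-> dreal (tnth (in_tuple form) i)
      & forall w, divisor_S w =
          \sum_(i < size form)
            (if w == pt i then dcoef (tnth (in_tuple form) i) else 0)].

(* mu_0 = ... = mu_(k-1) = 0 and mu_k <> 0 *)
Definition mu_first (k : nat) : Prop :=
  (forall i, (i < k)%N -> mu S i = 0) /\ mu S k != 0.

Definition I1 : Prop := 0 < eta S.
Definition I2 : Prop := eta S < 0.
Definition I3 : Prop := eta S = 0 /\ Mform S != 0.
Definition I4 : Prop := Mform S = 0.

End Plane.

Section Table.
Variable R : realType.

Record row := Row {
  row_Delta : nat;
  row_MC : nat;
  row_form : seq dterm;
  row_cond : qsys R -> Prop }.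

Definition has_row (S : qsys R) (l : row) : Prop :=
  [/\ Delta_S S = row_Delta l, M_C S = row_MC l & has_form S (row_form l)].

Local Notation re a b := (DTerm (a%N, b%N) true).
Local Notation co a b := (DTerm (a%N, b%N) false).

Definition rows0 : seq row := [::
  Row 0 1 [:: re 0 1; re 0 1; re 0 1] (fun S => mu_first S 0 /\ I1 S);
  Row 0 1 [:: re 0 1; co 0 1; co 0 1] (fun S => mu_first S 0 /\ I2 S);
  Row 0 2 [:: re 0 1; re 0 2]         (fun S => mu_first S 0 /\ I3 S);
  Row 0 3 [:: re 0 3]                 (fun S => mu_first S 0 /\ I4 S)].

Definition rows1 : seq row := [::
  Row 1 1 [:: re 1 1; re 0 1; re 0 1] (fun S => mu_first S 1 /\ I1 S);
  Row 1 1 [:: re 1 1; co 0 1; co 0 1] (fun S => mu_first S 1 /\ I2 S);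
  Row 1 2 [:: re 1 1; re 0 2]
    (fun S => [/\ mu_first S 1, kappa S != 0 & I3 S]);
  Row 1 2 [:: re 0 1; re 1 2]
    (fun S => [/\ mu_first S 1, kappa S = 0 & I3 S]);
  Row 1 3 [:: re 1 3]                 (fun S => mu_first S 1 /\ I4 S)].

Definition rows2 : seq row := [::
  Row 2 1 [:: re 2 1; re 0 1; re 0 1]
    (fun S => [/\ mu_first S 2, kappa S != 0 & I1 S]);
  Row 2 1 [:: re 1 1; re 1 1; re 0 1]
    (fun S => [/\ mu_first S 2, kappa S = 0 & I1 S]);
  Row 2 1 [:: re 2 1; co 0 1; co 0 1]
    (fun S => [/\ mu_first S 2, kappa S != 0 & I2 S]);
  Row 2 1 [:: re 0 1; co 1 1; co 1 1]
    (fun S => [/\ mu_first S 2, kappa S = 0 & I2 S]);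
  Row 2 2 [:: re 2 1; re 0 2]
    (fun S => [/\ mu_first S 2, kappa S != 0 & I3 S]);
  Row 2 2 [:: re 1 1; re 1 2]
    (fun S => [/\ mu_first S 2, kappa S = 0, Lform S = 0 & I3 S]);
  Row 2 2 [:: re 0 1; re 2 2]
    (fun S => [/\ mu_first S 2, kappa S = 0, Lform S != 0 & I3 S]);
  Row 2 3 [:: re 2 3]                 (fun S => mu_first S 2 /\ I4 S)].

Definition rows3 : seq row := [::
  Row 3 1 [:: re 3 1; re 0 1; re 0 1]
    (fun S => [/\ mu_first S 3, kappa S != 0 & I1 S]);
  Row 3 1 [:: re 2 1; re 1 1; re 0 1]
    (fun S => [/\ mu_first S 3, kappa S = 0 & I1 S]);
  Row 3 1 [:: re 3 1; co 0 1; co 0 1] (fun S => mu_first S 3 /\ I2 S);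
  Row 3 2 [:: re 3 1; re 0 2]
    (fun S => [/\ mu_first S 3, kappa S != 0 & I3 S]);
  Row 3 2 [:: re 2 1; re 1 2]
    (fun S => [/\ mu_first S 3, kappa S = 0, Lform S = 0,
                  kappa1 S != 0 & I3 S]);
  Row 3 2 [:: re 1 1; re 2 2]
    (fun S => [/\ mu_first S 3, kappa S = 0, Lform S = 0,
                  kappa1 S = 0 & I3 S]);
  Row 3 2 [:: re 0 1; re 3 2]
    (fun S => [/\ mu_first S 3, kappa S = 0, Lform S != 0 & I3 S]);
  Row 3 3 [:: re 3 3]                 (fun S => mu_first S 3 /\ I4 S)].

Definition rows4 : seq row := [::
  Row 4 1 [:: re 4 1; re 0 1; re 0 1]
    (fun S => [/\ mu_first S 4, kappa S != 0 & I1 S]);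
  Row 4 1 [:: re 3 1; re 1 1; re 0 1]
    (fun S => [/\ mu_first S 4, kappa S = 0, K1form S != 0 & I1 S]);
  Row 4 1 [:: re 2 1; re 2 1; re 0 1]
    (fun S => [/\ mu_first S 4, kappa S = 0, K1form S = 0 & I1 S]);
  Row 4 1 [:: re 4 1; co 0 1; co 0 1]
    (fun S => [/\ mu_first S 4, kappa S != 0 & I2 S]);
  Row 4 1 [:: re 0 1; co 2 1; co 2 1]
    (fun S => [/\ mu_first S 4, kappa S = 0 & I2 S]);
  Row 4 2 [:: re 4 1; re 0 2]
    (fun S => [/\ mu_first S 4, kappa S != 0 & I3 S]);
  Row 4 2 [:: re 3 1; re 1 2]
    (fun S => [/\ mu_first S 4, kappa S = 0, Lform S = 0,
                  kappa1 S != 0 & I3 S]);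
  Row 4 2 [:: re 2 1; re 2 2]
    (fun S => [/\ mu_first S 4 /\ kappa S = 0, Lform S = 0,
                  kappa1 S = 0, K1form S = 0 & I3 S]);
  Row 4 2 [:: re 1 1; re 3 2]
    (fun S => [/\ mu_first S 4 /\ kappa S = 0, Lform S = 0,
                  kappa1 S = 0, K1form S != 0 & I3 S]);
  Row 4 2 [:: re 0 1; re 4 2]
    (fun S => [/\ mu_first S 4, kappa S = 0, Lform S != 0 & I3 S]);
  Row 4 3 [:: re 4 3]                 (fun S => mu_first S 4 /\ I4 S)].

Definition Sigma : 36.-tuple row :=
  [tuple of rows0 ++ rows1 ++ rows2 ++ rows3 ++ rows4].

End Table.

(* Main.v *)
(* On the line Z = t (xY - yX) through (x : y : 0), P and Q restrict to binary
   quadratic forms whose resultant rho is a polynomial in t. The derivation calL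
   is the infinitesimal action of the translations, along which rho flows, so
   mu_i(x, y) is the coefficient of t^i in rho. Replacing P and Q by another basis
   of their pencil multiplies rho by a nonzero constant and keeps the intersection
   numbers.

   If p_2 and q_2 have no common root, nothing happens at infinity. If they have
   exactly one, the quadratic part of some member F of the pencil is a square; then
   either F is smooth at that root and the curves are transversal, or F is a pair
   of lines through it. If p_2 and q_2 are proportional, some member is Z times a
   line. The intersection of a conic with a line is read off the restriction of
   the conic, and the same restrictions are the factors of rho: this identifies the
   order of rho with Delta_S. The common points are then compared with the roots
   of C_2 by means of kappa, L, kappa_1 and K_1. Each system thus satisfies the
   conditions of a row whose divisor it has; since neither the conditions nor the
   divisors of two rows are compatible, the equivalences follow. *)
From HB Require Import structures.
Require Import Defs.
From mathcomp Require Import all_boot all_order all_algebra.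
From mathcomp Require Import fraction mpoly complex.
From mathcomp Require Import boolp classical_sets fsbigop reals.
From mathcomp Require Import zify ring lra.

Set Implicit Arguments.
Unset Strict Implicit.
Unset Printing Implicit Defensive.

Import Order.TTheory GRing.Theory Num.Theory.

Local Open Scope classical_set_scope.
Local Open Scope ring_scope.

(** * Multiplicities as dimensions of local quotients *)

(** [intersection_mult] chooses a dimension, so its value is known only once a basis has been
    exhibited and the dimension shown unique. No basis is written down for two conics directly:
    multiplication by a linear factor of one curve is injective modulo the other, which makes
    multiplicities additive, and the transversal case is settled by finding that the local ideal is
    maximal. Additivity requires that the line not lie in the other curve. This shapes the use of
    gcd(P, Q) = 1, which is assumed over the reals while the lines of a degenerate member may be
    complex: a line of F contained in G must be shown real before it contradicts coprimality.

    With l a linear form vanishing at a real root r of C_2 and h the cofactor, the second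
    transvectant with l^2 is 4 times the value at r. Hence kappa and kappa_1 become values at r, and
    their vanishing says whether a common point is a multiple root of C_2. The resultant also works
    backwards: a nonzero mu_i excludes a common factor, which certifies the sample systems of the
    last part. *)

Section QuotientDimension.
Variable R : realType.
Local Notation CC := R[i].
Local Notation poly3 := {mpoly CC[3]}.
Local Notation "x %:F" := (@FracField.tofrac _ x).
Local Notation cst c := ((c%:MP_[3] : poly3)%:F).

Implicit Types (O J : set {fraction poly3}) (F G t f : {fraction poly3}).

(** The dimension arguments use the local ring only through these closure properties; opposites come
    from multiplying by the constant -1. *)
Definition constant_subalgebra O : Prop :=
  [/\ forall c : CC, O (cst c), forall f g, O f -> O g -> O (f + g)
    & forall f g, O f -> O g -> O (f * g)].

Definition ideal2 O F G : set {fraction poly3} :=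
  [set f | exists a b, [/\ O a, O b & f = a * F + b * G]].

Variable O : set {fraction poly3}.
Hypothesis Osub : constant_subalgebra O.

Let OC c : O (cst c). Proof. by case: Osub. Qed.
Let OD f g : O f -> O g -> O (f + g). Proof. by case: Osub => _ + _; apply. Qed.
Let OM f g : O f -> O g -> O (f * g). Proof. by case: Osub => _ _; apply. Qed.
Let ON f : O f -> O (- f).
Proof. by move=> Of; rewrite -mulN1r -tofrac1 -tofracN -mpolyCN; apply: OM. Qed.
Let Osum (d : nat) (e : 'I_d -> {fraction poly3}) :
  (forall i, O (e i)) -> O (\sum_i e i).
Proof.
move=> Oe; apply: (big_ind O) => //.
by have := OC 0; rewrite mpolyC0 tofrac0.
Qed.

Lemma ideal2_add F G f g :
  ideal2 O F G f -> ideal2 O F G g -> ideal2 O F G (f + g).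
Proof.
move=> [a [b [Oa Ob ->]]] [a' [b' [Oa' Ob' ->]]].
by exists (a + a'), (b + b'); split; [exact: OD | exact: OD | ring].
Qed.

Lemma ideal2_mul F G a f : O a -> ideal2 O F G f -> ideal2 O F G (a * f).
Proof.
move=> Oa [a' [b' [Oa' Ob' ->]]].
by exists (a * a'), (a * b'); split; [exact: OM | exact: OM | ring].
Qed.

Lemma ideal2_sum F G (d : nat) (c : 'I_d -> CC) (e : 'I_d -> {fraction poly3}) :
  (forall i, ideal2 O F G (e i)) -> ideal2 O F G (\sum_i scal (c i) (e i)).
Proof.
move=> Je; apply: (big_ind (ideal2 O F G)); first by
  exists 0, 0; rewrite !mul0r addr0; have := OC 0; rewrite mpolyC0 tofrac0.
- exact: ideal2_add.
- by move=> i _; apply: ideal2_mul.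
Qed.

(** Expanding each basis in the other gives matrices whose product fixes the classes of [e'].
    Freeness of [e'] turns this into a matrix identity, and an identity of size d' that factors
    through size d has rank at most d. *)
Lemma quotient_dim_le F G d d' : quotient_dim O (ideal2 O F G) d ->
  quotient_dim O (ideal2 O F G) d' -> (d' <= d)%N.
Proof.
move=> [e [Oe gen free]] [e' [Oe' gen' free']].
have [C HC] := choice (fun j => gen _ (Oe' j)).
have [D HD] := choice (fun i => gen' _ (Oe i)).
pose MC := \matrix_(j < d', i < d) C j i.
pose MD := \matrix_(i < d, j < d') D i j.
suff CD1 : MC *m MD = 1%:M.
  by rewrite -[X in (X <= _)%N](mxrank1 CC d') -CD1 mulmx_max_rank.
apply/matrixP => j k; apply/eqP; rewrite -subr_eq0; apply/eqP.
apply: (free' (fun k => (MC *m MD) j k - 1%:M j k)) => {k}.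
(* The relation is minus the sum of e'_j reduced by its expansion in [e] and of the e_i reduced by
   their expansions in [e'], all of which lie in the ideal. *)
have -> : \sum_k scal ((MC *m MD) j k - 1%:M j k) (e' k) =
    - (1 : {fraction poly3}) * ((e' j - \sum_i scal (C j i) (e i))
    + \sum_i scal (C j i) (e i - \sum_k scal (D i k) (e' k))).
  have -> : \sum_i scal (C j i) (e i - \sum_k scal (D i k) (e' k)) =
      \sum_i scal (C j i) (e i)
      - \sum_i scal (C j i) (\sum_k scal (D i k) (e' k)).
    by rewrite -sumrB; apply: eq_bigr => i _; rewrite /scal mulrBr.
  rewrite addrA subrK mulN1r opprB.
  have -> : \sum_k scal ((MC *m MD) j k - 1%:M j k) (e' k) =
      \sum_k scal ((MC *m MD) j k) (e' k) - \sum_k scal ((j == k)%:R) (e' k).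
    rewrite -sumrB; apply: eq_bigr => k _.
    by rewrite /scal mpolyCB tofracB mulrBl [1%:M j k]mxE.
  congr (_ - _); last first.
    rewrite (bigD1 j) //= eqxx big1 ?addr0 /scal ?mpolyC1 ?tofrac1 ?mul1r //.
    by move=> k /negbTE; rewrite eq_sym => ->; rewrite mpolyC0 tofrac0 mul0r.
  under [RHS]eq_bigr do rewrite [scal _ _]mulr_sumr.
  rewrite exchange_big /=; apply: eq_bigr => k _; rewrite /scal mxE.
  rewrite !raddf_sum /= mulr_suml; apply: eq_bigr => i _.
  by rewrite !mxE mpolyCM tofracM mulrA.
apply: ideal2_mul; first by rewrite -tofrac1; apply/ON/(OC 1).
by apply: ideal2_add; [exact: HC | apply: ideal2_sum => i; exact: HD].
Qed.

Lemma quotient_dim_uniq F G d d' : quotient_dim O (ideal2 O F G) d ->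
  quotient_dim O (ideal2 O F G) d' -> d = d'.
Proof.
by move=> Hd Hd'; apply/eqP; rewrite eqn_leq !(@quotient_dim_le F G).
Qed.

Lemma quotient_dim_unit F G : ideal2 O F G 1 -> quotient_dim O (ideal2 O F G) 0.
Proof.
move=> J1; exists (fun=> 1); split => [[]//|f Of|c _ []//].
by exists (fun=> 0); rewrite big_ord0 subr0 -[f]mulr1; apply: ideal2_mul.
Qed.

Lemma quotient_dim_maximal F G : ~ ideal2 O F G 1 ->
  (forall f, O f -> exists c, ideal2 O F G (f - cst c)) ->
  quotient_dim O (ideal2 O F G) 1.
Proof.
move=> NJ1 gen; exists (fun=> 1); split => [_|f Of|c].
- by rewrite -tofrac1; apply: (OC 1).
- by have [c Jc] := gen f Of; exists (fun=> c); rewrite big_ord1 /scal mulr1.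
rewrite big_ord1 /scal mulr1 => Jc i; rewrite ord1.
apply/eqP; apply/negPn/negP => c0; apply: NJ1.
rewrite -(_ : cst (c ord0)^-1 * cst (c ord0) = 1); first exact: ideal2_mul.
by rewrite -tofracM -mpolyCM mulVf // mpolyC1 tofrac1.
Qed.

(* The exact sequence 0 -> O/(F,G) -> O/(tF,G) -> O/(t,G) -> 0, whose first map
   is multiplication by t, injective because t is regular modulo G. *)
Lemma quotient_dim_mul t F G d1 d2 : O t -> O F -> O G ->
  (forall h b, O h -> O b -> t * h = G * b -> exists2 b', O b' & h = G * b') ->
  quotient_dim O (ideal2 O t G) d1 -> quotient_dim O (ideal2 O F G) d2 ->
  quotient_dim O (ideal2 O (t * F) G) (d1 + d2).
Proof.
move=> Ot OF OG reg [e1 [Oe1 gen1 free1]] [e2 [Oe2 gen2 free2]].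
pose e (i : 'I_(d1 + d2)) : {fraction poly3} :=
  match fintype.split i with inl i => e1 i | inr j => t * e2 j end.
have sumE (c : 'I_(d1 + d2) -> CC) : \sum_i scal (c i) (e i) =
    \sum_i scal (c (lshift d2 i)) (e1 i)
    + t * \sum_j scal (c (rshift d1 j)) (e2 j).
  rewrite big_split_ord /= mulr_sumr /e; congr (_ + _); apply: eq_bigr => i _.
    by rewrite (unsplitK (inl i)).
  by rewrite (unsplitK (inr i)) /scal mulrCA.
exists e; split => [i|f Of|c].
- by rewrite /e; case: fintype.split => // j; apply: OM.
- have [c1 [a [b [Oa Ob Hf]]]] := gen1 f Of.
  have [c2 [a' [b' [Oa' Ob' Ha]]]] := gen2 a Oa.
  exists (fun i => match fintype.split i with inl i => c1 i | inr j => c2 j end).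
  exists a', (b + t * b'); split => //; first by apply: OD => //; apply: OM.
  rewrite sumE.
  under eq_bigr => i _ do rewrite (unsplitK (inl i)).
  under [X in t * X]eq_bigr => i _ do rewrite (unsplitK (inr i)).
  move: Hf Ha => /(canRL (subrK _)) -> /(canRL (subrK _)) ->; ring.
rewrite sumE => -[a [b [Oa Ob Hf]]].
set s1 := \sum_i _ in Hf; set s2 := \sum_j _ in Hf.
have Os2 : O s2 by apply: Osum => j; apply: OM.
have z1 : forall i, c (lshift d2 i) = 0.
  apply: (free1 (fun i => c (lshift d2 i))).
  exists (a * F - s2), b; split => //.
    by apply: OD; [apply: OM | apply: ON].
  by rewrite -/s1 -[s1](addrK (t * s2)) Hf; ring.
have s10 : s1 = 0.
  by rewrite /s1 big1 // => i _; rewrite z1 /scal mpolyC0 tofrac0 mul0r.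
(* Once the first block of coefficients is zero, the relation reads t (s2 - a F) = G b, and
   regularity of t puts s2 in (F, G). *)
have [||b' Ob' Hb'] := reg (s2 - a * F) b _ Ob.
- by apply: OD => //; apply: ON; apply: OM.
- by move: Hf; rewrite s10 add0r mulrBr => ->; ring.
have z2 : forall j, c (rshift d1 j) = 0.
  apply: (free2 (fun j => c (rshift d1 j))).
  by exists a, b'; split => //; rewrite -/s2 -[s2](subrK (a * F)) Hb'; ring.
by move=> i; rewrite -(splitK i); case: fintype.split => j /=.
Qed.

End QuotientDimension.

(** * Homogeneous components, linear forms and fractions *)

Section Homogeneous.
Variables (A : comNzRingType) (n : nat).
Implicit Types p q : {mpoly A[n]}.

(** Taking components of a fixed degree replaces the arbitrary cofactors of an identity between
    forms by homogeneous ones. *)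
Lemma pihomogM_homog k d p q : q \is d.-homog ->
  pihomog mdeg k (p * q) =
  if (d <= k)%N then pihomog mdeg (k - d) p * q else 0.
Proof.
(* The [k.+1] in the bound guarantees that the index [k - d] occurs in the partition of p. *)
move=> hq; pose N := maxn (mmeasure mdeg p) k.+1.
have hterm i : pihomog mdeg k (pihomog mdeg i p * q) =
    if (i + d == k)%N then pihomog mdeg i p * q else 0.
  have hM := dhomogM (pihomogP mdeg i p) hq.
  case: ifP => [/eqP <-|/negbT ne]; first exact: pihomog_dE.
  exact: pihomog_ne0 hM.
rewrite {1}(pihomog_partitionE (leq_maxl _ k.+1 : (_ <= N)%N)).
rewrite mulr_suml raddf_sum /=; under eq_bigr do rewrite hterm.
rewrite -big_mkcond /=; case: leqP => dk.
  have lt : (k - d < N)%N by rewrite leq_max ltnS leq_subr orbT.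
  rewrite (big_pred1 (Ordinal lt)) // => i.
  apply/eqP/eqP => [ik|->]; last by rewrite /= subnK.
  by apply: val_inj; rewrite /= -ik addnK.
apply: big_pred0 => i; apply/negbTE/eqP => ik.
by move: dk; rewrite -ik ltnNge leq_addl.
Qed.

End Homogeneous.

Section LinearForms.
Variables (K : fieldType) (n : nat).
Implicit Types p q : {mpoly K[n]}.

(** Substituting X_i - t / r_i for X_i realises the quotient by t inside the polynomial ring itself:
    [phi] kills t and is the identity modulo t. As the target is a domain, this will show that t is
    prime. *)
Lemma linear_form_subst (r : 'I_n -> K) (i : 'I_n) : r i != 0 ->
  let t := \sum_j r j *: 'X_j in
  exists phi : {rmorphism {mpoly K[n]} -> {mpoly K[n]}},
    phi t = 0 /\ forall p, exists q, p - phi p = t * q.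
Proof.
move=> c0 t; set c := r i in c0; pose s := [tuple 'X_j - (if j == i then c^-1 *: t else 0) | j < n].
exists (comp_mpoly s); split.
  have sX j : 'X_j \mPo s = 'X_j - (if j == i then c^-1 *: t else 0).
    by rewrite comp_mpolyXU -tnth_nth tnth_mktuple.
  rewrite {1}/t raddf_sum /=.
  transitivity (\sum_j (r j *: 'X_j - if j == i then t else 0)).
    apply: eq_bigr => j _.
    rewrite linearZ /= sX scalerBr; case: eqP => [->|_]; last by rewrite scaler0.
    by rewrite scalerA divff // scale1r.
  by rewrite sumrB -/t -big_mkcond /= big_pred1_eq subrr.
elim/mpolyind => [|c' m p _ _ [q Hq]].
  by exists 0; rewrite raddf0 subr0 mulr0.
suff [q' Hq'] : exists q', 'X_[m] - ('X_[m] \mPo s) = t * q'.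
  exists (c' *: q' + q).
  rewrite raddfD /= comp_mpolyZ mulrDr -scalerAr -Hq -Hq' scalerBr; ring.
rewrite comp_mpolyX mpolyXE_id.
apply: (big_ind2 (fun a b : {mpoly K[n]} => exists q', a - b = t * q')).
- by exists 0; rewrite subrr mulr0.
- move=> a1 b1 a2 b2 [q1 H1] [q2 H2]; exists (q1 * a2 + b1 * q2).
  by rewrite mulrDr mulrA -H1 mulrCA -H2; ring.
move=> j _; rewrite tnth_mktuple; elim: (m j) => [|k [q' IH]].
  by exists 0; rewrite subrr mulr0.
set b := 'X_j - (if _ then _ else _) in IH *; have [q1 H1] : exists q1, 'X_j - b = t * q1.
  rewrite /b subKr; case: (j == i); last by exists 0; rewrite mulr0.
  by exists (c^-1)%:MP; rewrite mulrC mul_mpolyC.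
exists (q1 * 'X_j ^+ k + b * q').
by rewrite !exprS mulrDr mulrA -H1 mulrCA -IH; ring.
Qed.

End LinearForms.

Section Fractions.
Variable D : idomainType.
Implicit Types h s k u x t F G : D.
Local Notation "x %:F" := (@FracField.tofrac _ x).

Lemma frac_add h s k u : s != 0 -> u != 0 ->
  h%:F / s%:F + k%:F / u%:F = (h * u + k * s)%:F / (s * u)%:F.
Proof. by move=> s0 u0; rewrite tofracD !tofracM addf_div ?tofrac_eq0. Qed.

Lemma frac_mul h s k u : h%:F / s%:F * (k%:F / u%:F) = (h * k)%:F / (s * u)%:F.
Proof. by rewrite !tofracM mulf_div. Qed.

(** Here and in several identities below, the computation is done for variables of an arbitrary
    field ([gen]) and then read in the fraction field of D. *)
Lemma frac_combination h s k u x F G d e : s != 0 -> u != 0 -> x != 0 ->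
  h%:F / s%:F * (F%:F / x%:F ^+ d) + k%:F / u%:F * (G%:F / x%:F ^+ e) =
  (h * u * x ^+ e * F + k * s * x ^+ d * G)%:F / (s * u * x ^+ d * x ^+ e)%:F.
Proof.
have gen (K : fieldType) (h' s' k' u' x' F' G' : K) : s' != 0 -> u' != 0 ->
    x' != 0 -> h' / s' * (F' / x' ^+ d) + k' / u' * (G' / x' ^+ e) =
    (h' * u' * x' ^+ e * F' + k' * s' * x' ^+ d * G') /
    (s' * u' * x' ^+ d * x' ^+ e).
  by move=> s0 u0 x0; field; rewrite ?s0 ?u0 ?x0 ?expf_neq0.
rewrite -(tofrac_eq0 s) -(tofrac_eq0 u) -(tofrac_eq0 x) => s0 u0 x0.
by rewrite tofracD !tofracM !tofracXn; apply: gen.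
Qed.

Lemma frac_split h s x H c : s != 0 -> x != 0 ->
  (h * H)%:F / s%:F = (h * x ^+ c)%:F / s%:F * (H%:F / x%:F ^+ c).
Proof.
have gen (K : fieldType) (h' s' x' H' : K) : s' != 0 -> x' != 0 ->
    h' * H' / s' = h' * x' ^+ c / s' * (H' / x' ^+ c).
  by move=> s0 x0; field; rewrite ?s0 ?x0 ?expf_neq0.
rewrite -(tofrac_eq0 s) -(tofrac_eq0 x) => s0 x0.
by rewrite !tofracM !tofracXn; apply: gen.
Qed.

Lemma frac_cross t h s b u x e G : s != 0 -> u != 0 -> x != 0 ->
  t%:F / x%:F ^+ 1 * (h%:F / s%:F) = G%:F / x%:F ^+ e * (b%:F / u%:F) ->
  t * (h * u * x ^+ e) = G * (b * (s * x)).
Proof.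
have gen (K : fieldType) (t' h' s' b' u' x' G' : K) : s' != 0 -> u' != 0 ->
    x' != 0 -> t' / x' ^+ 1 * (h' / s') = G' / x' ^+ e * (b' / u') ->
    t' * (h' * u' * x' ^+ e) = G' * (b' * (s' * x')).
  move=> s0 u0 x0 E.
  have -> : t' * (h' * u' * x' ^+ e) =
      t' / x' ^+ 1 * (h' / s') * (x' * s' * u' * x' ^+ e) by field; rewrite ?s0 ?x0 ?expf_neq0.
  by rewrite E; field; rewrite ?u0 ?x0 ?expf_neq0.
rewrite -(tofrac_eq0 s) -(tofrac_eq0 u) -(tofrac_eq0 x) => s0 u0 x0 E.
by apply/eqP; rewrite -tofrac_eq !tofracM !tofracXn; apply/eqP; apply: gen E.
Qed.

Lemma frac_factor k s t x : s != 0 -> x != 0 -> t != 0 ->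
  k%:F / s%:F = (t%:F / x%:F ^+ 1) * ((k * x)%:F / (s * t)%:F).
Proof.
have gen (K : fieldType) (k' s' t' x' : K) : s' != 0 -> x' != 0 -> t' != 0 ->
    k' / s' = (t' / x' ^+ 1) * (k' * x' / (s' * t')).
  by move=> s0 x0 t0; field; rewrite ?s0 ?x0 ?t0 ?expf_neq0.
rewrite -(tofrac_eq0 s) -(tofrac_eq0 x) -(tofrac_eq0 t) => s0 x0 t0.
by rewrite !tofracM; apply: gen.
Qed.

Lemma frac_factor1 q s t x : s != 0 -> x != 0 ->
  (t * q)%:F / s%:F = (t%:F / x%:F ^+ 1) * ((q * x)%:F / s%:F).
Proof.
have gen (K : fieldType) (q' s' t' x' : K) : s' != 0 -> x' != 0 ->
    t' * q' / s' = (t' / x' ^+ 1) * (q' * x' / s').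
  by move=> s0 x0; field; rewrite ?s0 ?x0 ?expf_neq0.
rewrite -(tofrac_eq0 s) -(tofrac_eq0 x) => s0 x0.
by rewrite !tofracM; apply: gen.
Qed.

Lemma frac_cancel u h c s : u != 0 -> s != 0 ->
  (u * (h - c * s))%:F / (u * s)%:F = h%:F / s%:F - c%:F.
Proof.
have gen (K : fieldType) (u' h' c' s' : K) : u' != 0 -> s' != 0 ->
    u' * (h' - c' * s') / (u' * s') = h' / s' - c'.
  by move=> u0 s0; field; rewrite ?s0 ?u0 ?expf_neq0.
rewrite -(tofrac_eq0 s) -(tofrac_eq0 u) => u0 s0.
by rewrite !tofracM tofracB tofracM; apply: gen.
Qed.

Lemma frac_mulD t F x d :
  (t * F)%:F / x%:F ^+ (1 + d) = t%:F / x%:F ^+ 1 * (F%:F / x%:F ^+ d).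
Proof. by rewrite tofracM exprD mulf_div. Qed.

Lemma frac_add_same h k s : (h + k)%:F / s%:F = h%:F / s%:F + k%:F / s%:F.
Proof. by rewrite tofracD mulrDl. Qed.

End Fractions.

(** * Local rings and intersection numbers *)

Section LocalIntersection.
Variable R : realType.
Local Notation CC := R[i].
Local Notation poly3 := {mpoly CC[3]}.
Local Notation "x %:F" := (@FracField.tofrac _ x).
Implicit Types (w : P2 R) (F G p : poly3).

(** Kept as a relation: that the quotient has a finite dimension at all is part of what each
    computation proves. *)
Definition local_mult w F G (d : nat) : Prop :=
  quotient_dim (local_ring w) (local_ideal F G w) d.

Lemma hcoord_neq0 w : exists i, hcoord w i != 0.
Proof.
apply/existsP; apply: contraT => /existsPn h0.
have : vpick (val w) == 0.
  by apply/eqP/rowP => i; rewrite mxE; apply/eqP/negPn/h0.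
by rewrite vpick0 -dimv_eq0 (eqP (valP w)).
Qed.

Lemma mevalM_neq0 w p q :
  p.@[hcoord w] != 0 -> q.@[hcoord w] != 0 -> (p * q).@[hcoord w] != 0.
Proof. by rewrite mevalM mulf_eq0 negb_or => -> ->. Qed.

Lemma mevalXn_neq0 w p k :
  p.@[hcoord w] != 0 -> (p ^+ k).@[hcoord w] != 0.
Proof. by rewrite rmorphXn => p0; rewrite expf_neq0. Qed.

Lemma meval_neq0 w p : p.@[hcoord w] != 0 -> p != 0.
Proof. by apply: contraNneq => ->; rewrite meval0. Qed.

Lemma local_ring_subalgebra w : constant_subalgebra (local_ring w).
Proof.
split=> [c|f g [n [h [s [hh hs s0 ->]]]] [m [k [u [hk hu u0 ->]]]]
          |f g [n [h [s [hh hs s0 ->]]]] [m [k [u [hk hu u0 ->]]]]].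
- exists 0%N, c%:MP, 1; rewrite dhomog1 meval1 oner_neq0; split => //.
    by rewrite -[c%:MP]mulr1 mul_mpolyC; apply/dhomogZ/dhomog1.
  by rewrite tofrac1 divr1.
- exists (n + m)%N, (h * u + k * s), (s * u); split.
  + by apply: dhomogD; [|rewrite addnC]; apply: dhomogM.
  + exact: dhomogM.
  + exact: mevalM_neq0.
  + exact: frac_add (meval_neq0 s0) (meval_neq0 u0).
- exists (n + m)%N, (h * k), (s * u); split.
  + exact: dhomogM.
  + exact: dhomogM.
  + exact: mevalM_neq0.
  + exact: frac_mul.
Qed.

(** The affine equation of a form F of degree d in the chart where X_i does not vanish. *)
Definition local_eq (i : 'I_3) F (d : nat) : {fraction poly3} :=
  F%:F / ('X_i : poly3)%:F ^+ d.

Lemma mpolyX_homog (K : fieldType) n (i : 'I_n) : ('X_i : {mpoly K[n]}) \is 1.-homog.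
Proof. by rewrite dhomogX /= mdeg1. Qed.

Lemma Xi_neq0 w (i : 'I_3) : hcoord w i != 0 -> ('X_i : poly3).@[hcoord w] != 0.
Proof. by rewrite mevalXU. Qed.

Lemma Xi_homog k (i : 'I_3) : ('X_i ^+ k : poly3) \is k.-homog.
Proof. by have := dhomogMn k (mpolyX_homog CC i); rewrite mul1n. Qed.

Lemma local_eq_in w i F d : hcoord w i != 0 -> F \is d.-homog ->
  local_ring w (local_eq i F d).
Proof.
move=> i0 hF; exists d, F, ('X_i ^+ d); split => //.
- exact: Xi_homog.
- exact/mevalXn_neq0/Xi_neq0.
- by rewrite tofracXn.
Qed.

Lemma local_ideal_ideal2 w i F G d e : hcoord w i != 0 ->
  F \is d.-homog -> G \is e.-homog ->
  local_ideal F G w = ideal2 (local_ring w) (local_eq i F d) (local_eq i G e).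
Proof.
move=> i0 hF hG; have X0 := meval_neq0 (Xi_neq0 i0).
apply/seteqP; split=> f; last first.
  move=> [_ [_ [[n [h [s [hh hs s0 ->]]]] [m [k [u [hk hu u0 ->]]]] ->]]].
  exists (n + m + d + e)%N, (h * u * 'X_i ^+ e), (k * s * 'X_i ^+ d),
    (s * u * 'X_i ^+ d * 'X_i ^+ e); split.
  - apply: dhomogD.
      have -> : (n + m + d + e = n + m + e + d)%N by rewrite addnAC.
      by rewrite !dhomogM ?Xi_homog.
    have -> : (n + m + d + e = m + n + d + e)%N by rewrite (addnC n).
    by rewrite !dhomogM ?Xi_homog.
  - by rewrite !dhomogM ?Xi_homog.
  - by rewrite !mevalM_neq0 ?mevalXn_neq0 ?Xi_neq0.
  - exact: frac_combination (meval_neq0 s0) (meval_neq0 u0) X0.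
move=> [n [A [B [s [hAB hs s0 ->]]]]].
(* In [local_ideal] only the combination A F + B G is homogeneous. The component of degree n of each
   product has a homogeneous cofactor, which gives an element of the local ring. *)
have split_homog p H c : H \is c.-homog ->
    exists2 a, local_ring w a & (pihomog mdeg n (p * H))%:F / s%:F = a * local_eq i H c.
  move=> hH; rewrite (pihomogM_homog n p hH); case: ifP => cn; last first.
    exists 0; last by rewrite tofrac0 !mul0r.
    by have [+ _ _] := local_ring_subalgebra w => /(_ 0); rewrite mpolyC0 tofrac0.
  exists ((pihomog mdeg (n - c) p * 'X_i ^+ c)%:F / s%:F); last first.
    exact: frac_split (meval_neq0 s0) X0.
  exists n, (pihomog mdeg (n - c) p * 'X_i ^+ c), s; split => //.
  by rewrite -(subnK cn) dhomogM ?Xi_homog // subnK // pihomogP.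
have [a Oa Ha] := split_homog A F d hF; have [b Ob Hb] := split_homog B G e hG.
exists a, b; split => //.
by rewrite -Ha -Hb -frac_add_same -pihomogD (pihomog_dE hAB).
Qed.

Lemma local_mult_uniq w F G d e m n : F \is d.-homog -> G \is e.-homog ->
  local_mult w F G m -> local_mult w F G n -> m = n.
Proof.
move=> hF hG; have [i i0] := hcoord_neq0 w.
rewrite /local_mult (local_ideal_ideal2 i0 hF hG).
exact/quotient_dim_uniq/local_ring_subalgebra.
Qed.

Lemma intersection_multP w F G d e n : F \is d.-homog -> G \is e.-homog ->
  local_mult w F G n -> intersection_mult F G w = n.
Proof.
move=> hF hG Hn; rewrite /intersection_mult; case: xgetP => [m _ Hm|/(_ n)//].
exact: (local_mult_uniq hF hG Hm Hn).
Qed.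

Lemma local_mult_gens w F G F' G' d :
  (forall p, (exists A B, p = A * F + B * G) <-> (exists A B, p = A * F' + B * G')) ->
  local_mult w F G d -> local_mult w F' G' d.
Proof.
move=> FG; rewrite /local_mult; suff -> : local_ideal F G w = local_ideal F' G' w by [].
apply/seteqP; split=> f [n [A [B [s [hAB hs s0 ->]]]]].
  have [/(_ (ex_intro _ A (ex_intro _ B erefl)))[A' [B' E]] _] := FG (A * F + B * G).
  by exists n, A', B', s; rewrite -E.
have [_ /(_ (ex_intro _ A (ex_intro _ B erefl)))[A' [B' E]]] := FG (A * F' + B * G').
by exists n, A', B', s; rewrite -E.
Qed.

Lemma local_multC w F G d : local_mult w F G d -> local_mult w G F d.
Proof.
by apply: local_mult_gens => p; split=> -[A [B ->]]; exists B, A; rewrite addrC.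
Qed.

Lemma local_mult_eqr w F G G' B c d : c != 0 -> G' = c%:MP * G + B * F ->
  local_mult w F G d -> local_mult w F G' d.
Proof.
move=> c0 ->; apply: local_mult_gens => p; split=> -[C [D ->]].
  exists (C - D * (c^-1)%:MP * B), (D * (c^-1)%:MP).
  have cc : (c^-1)%:MP_[3] * c%:MP = 1 by rewrite -mpolyCM mulVf ?mpolyC1.
  by rewrite -{1}[D]mulr1 -cc; ring.
by exists (C + D * B), (D * c%:MP); ring.
Qed.

Lemma local_mult_pencil w F G (a b c d : CC) m : a * d - b * c != 0 ->
  local_mult w (a%:MP * F + b%:MP * G) (c%:MP * F + d%:MP * G) m ->
  local_mult w F G m.
Proof.
move=> D0; apply: local_mult_gens => p; split=> -[C [E ->]].
  by exists (C * a%:MP + E * c%:MP), (C * b%:MP + E * d%:MP); ring.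
pose D := ((a * d - b * c)^-1)%:MP_[3].
exists ((C * d%:MP - E * c%:MP) * D), ((E * a%:MP - C * b%:MP) * D).
have D1 : D * (a%:MP * d%:MP - b%:MP * c%:MP) = 1.
  by rewrite -!mpolyCM -mpolyCB -mpolyCM mulVf ?mpolyC1.
by rewrite -{1}[C]mulr1 -{1}[E]mulr1 -D1; ring.
Qed.

Lemma local_mult_unit w F G d e : F \is d.-homog -> G \is e.-homog ->
  F.@[hcoord w] != 0 -> local_mult w F G 0.
Proof.
move=> hF hG F0; have [i i0] := hcoord_neq0 w.
rewrite /local_mult (local_ideal_ideal2 i0 hF hG).
apply: quotient_dim_unit; first exact: local_ring_subalgebra.
rewrite -(local_ideal_ideal2 i0 hF hG).
by exists d, 1, 0, F; rewrite mul1r mul0r addr0 divff ?tofrac_eq0 ?(meval_neq0 F0).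
Qed.

End LocalIntersection.

Definition linform (K : nzRingType) (a b c : K) : {mpoly K[3]} :=
  a%:MP * 'X_iX + b%:MP * 'X_iY + c%:MP * 'X_iZ.

Lemma mpolyC_homog (K : nzRingType) n (c : K) : (c%:MP : {mpoly K[n]}) \is 0.-homog.
Proof. by rewrite -[c%:MP]mulr1 mul_mpolyC; apply/dhomogZ/dhomog1. Qed.

Lemma linform_homog (K : fieldType) (a b c : K) : linform a b c \is 1.-homog.
Proof.
rewrite /linform !mul_mpolyC; apply: dhomogD; last exact/dhomogZ/mpolyX_homog.
by apply: dhomogD; apply/dhomogZ/mpolyX_homog.
Qed.

Lemma meval_linform (K : comNzRingType) (v : 'I_3 -> K) (a b c : K) :
  (linform a b c).@[v] = a * v iX + b * v iY + c * v iZ.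
Proof. by rewrite !rmorphD !rmorphM /= !mevalC !mevalXU. Qed.

Lemma linform_prime (K : fieldType) (a b c : K) (A B q : {mpoly K[3]}) :
  [|| a != 0, b != 0 | c != 0] -> linform a b c * q = A * B ->
  (exists q', A = linform a b c * q') \/ (exists q', B = linform a b c * q').
Proof.
move=> abc0 qAB; pose r (i : 'I_3) := nth 0 [:: a; b; c] i.
have [i ri0] : exists i, r i != 0.
  by case/or3P: abc0 => h; [exists iX | exists iY | exists iZ].
have tE : linform a b c = \sum_j r j *: 'X_j.
  rewrite !big_ord_recl big_ord0 addr0 /linform !mul_mpolyC addrA /r /=.
  by do 3?[congr (_ + _)]; congr (_ *: _); congr 'X_(_); apply: val_inj.
have [phi [phit Hphi]] := linear_form_subst ri0; rewrite -tE in phit Hphi.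
have : phi A * phi B == 0 by rewrite -rmorphM -qAB rmorphM phit mul0r.
rewrite mulf_eq0 => /orP[] /eqP p0; [left|right].
  by have [q' Hq'] := Hphi A; exists q'; rewrite -Hq' p0 subr0.
by have [q' Hq'] := Hphi B; exists q'; rewrite -Hq' p0 subr0.
Qed.

Section LocalAdditivity.
Variable R : realType.
Local Notation CC := R[i].
Local Notation poly3 := {mpoly CC[3]}.
Local Notation "x %:F" := (@FracField.tofrac _ x).
Implicit Types (w : P2 R) (F G p q : poly3).

(** If the line misses w, its equation is a unit of the local ring. Otherwise clear denominators:
    the linear form is prime, it does not divide G, and it cannot divide a form that is nonzero at
    w, so it divides the numerator of k. *)
Lemma local_regular w i (a b c : CC) G e : hcoord w i != 0 ->
  G \is e.-homog -> [|| a != 0, b != 0 | c != 0] ->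
  (forall q, G <> linform a b c * q) ->
  forall h k, local_ring w h -> local_ring w k ->
    local_eq i (linform a b c) 1 * h = local_eq i G e * k ->
  exists2 k', local_ring w k' & h = local_eq i G e * k'.
Proof.
set t := linform a b c => i0 hG abc0 ndvd h k.
have X0 := meval_neq0 (Xi_neq0 i0).
have ht : t \is 1.-homog := linform_homog a b c.
have t0 : t != 0.
  apply: contraTneq abc0 => t0.
  have ev v := meval_linform v a b c; rewrite -/t t0 in ev.
  have := ev (fun j => (j == iX)%:R); have := ev (fun j => (j == iY)%:R).
  have := ev (fun j => (j == iZ)%:R); rewrite !meval0 /= !mulr0 !add0r !addr0 !mulr1.
  by move=> <- <- <-; rewrite eqxx.
move=> [n [h1 [s1 [hh1 hs1 s10 ->]]]] [m [k1 [s2 [hk1 hs2 s20 ->]]]].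
have S10 := meval_neq0 s10; have S20 := meval_neq0 s20 => E.
suff [k' Ok' Hk'] : exists2 k', local_ring w k' & k1%:F / s2%:F = local_eq i t 1 * k'.
  exists k' => //; apply: (@mulfI _ (local_eq i t 1)).
    by rewrite mulf_neq0 ?invr_eq0 ?expf_neq0 ?tofrac_eq0.
  by rewrite E Hk' mulrCA.
case tw : (t.@[hcoord w] == 0); last first.
  have {}tw := negbT tw.
  exists ((k1 * 'X_i)%:F / (s2 * t)%:F).
    exists (m + 1)%N, (k1 * 'X_i), (s2 * t); split => //.
    - by rewrite dhomogM // mpolyX_homog.
    - by rewrite dhomogM.
    - exact: mevalM_neq0.
  exact: frac_factor.
have {}E := frac_cross S10 S20 X0 E.
have ndvdw p : p.@[hcoord w] != 0 -> ~ exists q', p = t * q'.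
  by move=> p0 [q' pq]; move: p0; rewrite pq mevalM (eqP tw) mul0r eqxx.
have [q Hq] : exists q, k1 = t * q.
  have [[q' /ndvd//]|[q' /esym E']] := linform_prime abc0 E.
  have [//|/ndvdw []] := linform_prime abc0 E'.
  by rewrite mevalM_neq0 ?Xi_neq0.
(* The cofactor q need not be homogeneous, but its component of degree m - 1 is; for m = 0 the
   numerator is zero. *)
have {}Hq : k1 = if (1 <= m)%N then t * pihomog mdeg (m - 1) q else 0.
  rewrite -{1}(pihomog_dE hk1) {1}Hq mulrC (pihomogM_homog m q ht).
  by case: ifP => // _; rewrite mulrC.
case: ltnP Hq => [m0|_] ->; last first.
  exists 0; last by rewrite tofrac0 mul0r mulr0.
  by have [+ _ _] := local_ring_subalgebra w => /(_ 0); rewrite mpolyC0 tofrac0.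
exists ((pihomog mdeg (m - 1) q * 'X_i)%:F / s2%:F).
  exists m, (pihomog mdeg (m - 1) q * 'X_i), s2; split => //.
  by rewrite -{2}(subnK m0) dhomogM ?mpolyX_homog // pihomogP.
exact: frac_factor1.
Qed.

(** Since the line does not divide G, it is regular modulo G and [quotient_dim_mul] applies.
    Degenerate conics are treated by peeling off their lines in this way. *)
Lemma local_mult_mul w (a b c : CC) F G d e m n :
  F \is d.-homog -> G \is e.-homog -> [|| a != 0, b != 0 | c != 0] ->
  (forall q, G <> linform a b c * q) ->
  local_mult w (linform a b c) G m -> local_mult w F G n ->
  local_mult w (linform a b c * F) G (m + n).
Proof.
move=> hF hG abc0 ndvd; have [i i0] := hcoord_neq0 w.
have ht := linform_homog a b c.
rewrite /local_mult (local_ideal_ideal2 i0 ht hG) (local_ideal_ideal2 i0 hF hG).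
rewrite (local_ideal_ideal2 i0 (dhomogM ht hF) hG).
have -> : local_eq i (linform a b c * F) (1 + d) =
    local_eq i (linform a b c) 1 * local_eq i F d.
  exact: frac_mulD.
apply: quotient_dim_mul (local_regular i0 hG abc0 ndvd).
- exact: local_ring_subalgebra.
- exact: local_eq_in.
- exact: local_eq_in.
- exact: local_eq_in.
Qed.

(* The ideal of w is generated by the linear forms vanishing at w. *)
Lemma point_ideal w i p n : hcoord w iZ = 0 -> hcoord w i != 0 -> p \is n.-homog ->
  exists A B, p = (p.@[hcoord w] / hcoord w i ^+ n)%:MP * 'X_i ^+ n
    + A * linform (hcoord w iY) (- hcoord w iX) 0 + B * 'X_iZ.
Proof.
move=> wZ i0 hp; set l := linform _ _ _.
pose cong p q := exists A B, p = q + A * l + B * 'X_iZ.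
have congM p1 q1 p2 q2 : cong p1 q1 -> cong p2 q2 -> cong (p1 * p2) (q1 * q2).
  move=> [A1 [B1 E1]] [A2 [B2 ->]].
  exists (A1 * (q2 + A2 * l + B2 * 'X_iZ) + q1 * A2).
  exists (B1 * (q2 + A2 * l + B2 * 'X_iZ) + q1 * B2).
  by rewrite E1; ring.
(* Modulo l and Z every variable is a multiple of X_i, with the ratio of coordinates at w as factor;
   since Z vanishes at w, the index i is [iX] or [iY]. *)
have cong_var j : cong 'X_j ((hcoord w j / hcoord w i)%:MP * 'X_i).
  have iE : i = iX \/ i = iY.
    case: i i0 => -[|[|[|//]]] Hi; [left|right|]; try exact: val_inj.
    by rewrite (_ : Ordinal Hi = iZ) ?wZ ?eqxx //; apply: val_inj.
  have jE : [\/ j = iX, j = iY | j = iZ].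
    by case: j => -[|[|[|//]]] Hj; [constructor 1 | constructor 2 | constructor 3]; apply: val_inj.
  have inv : (hcoord w i)^-1%:MP_[3] * (hcoord w i)%:MP = 1.
    by rewrite -mpolyCM mulVf ?mpolyC1.
  case: jE => ->; last first.
  - by exists 0, 1; rewrite wZ mul0r mpolyC0; ring.
  - case: iE i0 inv => -> i0 inv; last first.
      by exists 0, 0; rewrite divff // mpolyC1; ring.
    exists (- (hcoord w iX)^-1%:MP), 0.
    by rewrite -[LHS]mul1r -inv mpolyCM /l /linform mpolyCN mpolyC0; ring.
  - case: iE i0 inv => -> i0 inv; first by exists 0, 0; rewrite divff // mpolyC1; ring.
    exists ((hcoord w iY)^-1%:MP), 0.
    by rewrite -[LHS]mul1r -inv mpolyCM /l /linform mpolyCN mpolyC0; ring.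
have cong1 : cong 1 1 by exists 0, 0; ring.
have cong_mono m : cong 'X_[m]
    ((('X_[m] : poly3).@[hcoord w] / hcoord w i ^+ mdeg m)%:MP * 'X_i ^+ mdeg m).
  have -> : ((('X_[m] : poly3).@[hcoord w] / hcoord w i ^+ mdeg m)%:MP * 'X_i ^+ mdeg m)
      = \prod_j ((hcoord w j / hcoord w i)%:MP * ('X_i : poly3)) ^+ m j.
    rewrite mevalX mdegE -!prodrXr -prodf_div rmorph_prod -big_split /=.
    by apply: eq_bigr => j _; rewrite exprMn -rmorphXn /= expr_div_n.
  rewrite mpolyXE_id; apply: big_ind2 => // j _.
  by elim: (m j) => [//|k IH]; rewrite !exprS; apply: congM.
have -> : (p.@[hcoord w] / hcoord w i ^+ n)%:MP * 'X_i ^+ n = \sum_(m <- msupp p)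
    (p@_m * (('X_[m] : poly3).@[hcoord w] / hcoord w i ^+ n))%:MP * ('X_i : poly3) ^+ n.
  rewrite -mulr_suml -rmorph_sum /=; congr (_%:MP * _).
  rewrite {1}[p]mpolyE raddf_sum /= mulr_suml; apply: eq_bigr => m _.
  by rewrite mevalZ mulrA.
suff : cong p (\sum_(m <- msupp p)
    (p@_m * (('X_[m] : poly3).@[hcoord w] / hcoord w i ^+ n))%:MP * ('X_i : poly3) ^+ n).
  by [].
rewrite [X in cong X _]mpolyE big_seq [X in cong _ X]big_seq.
apply: (big_ind2 cong); first by exists 0, 0; ring.
  move=> p1 q1 p2 q2 [A1 [B1 ->]] [A2 [B2 ->]].
  by exists (A1 + A2), (B1 + B2); ring.
move=> m mp; have /dhomogP/(_ m mp) <- := hp; have [A [B E]] := cong_mono m.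
exists (p@_m *: A), (p@_m *: B).
by rewrite {1}E [(p@_m * _)%:MP]mpolyCM -!mul_mpolyC; ring.
Qed.

(** The numerator of h/s - c, with c the value of h/s at w, lies in the ideal generated by l and Z.
    Multiplied by u, a unit at w, it falls into (F, G), so every class is represented by a
    constant. *)
Lemma local_mult_transversal w F G u d e m :
  F \is d.-homog -> G \is e.-homog -> u \is m.-homog -> u.@[hcoord w] != 0 ->
  hcoord w iZ = 0 -> F.@[hcoord w] = 0 -> G.@[hcoord w] = 0 ->
  (exists A B, u * linform (hcoord w iY) (- hcoord w iX) 0 = A * F + B * G) ->
  (exists A B, u * 'X_iZ = A * F + B * G) ->
  local_mult w F G 1.
Proof.
move=> hF hG hu u0 wZ F0 G0 [A [B ul]] [A' [B' uZ]].
have [i i0] := hcoord_neq0 w.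
rewrite /local_mult (local_ideal_ideal2 i0 hF hG).
apply: quotient_dim_maximal; first exact: local_ring_subalgebra.
  rewrite -(local_ideal_ideal2 i0 hF hG) => -[n [C [D [s [_ _ s0 E]]]]].
  have S0 := meval_neq0 s0; move/(congr1 (fun x => x * s%:F)): E.
  rewrite mul1r divfK ?tofrac_eq0 // => /eqP; rewrite tofrac_eq => /eqP sE.
  by move: s0; rewrite sE rmorphD !rmorphM /= F0 G0 !mulr0 addr0 eqxx.
move=> _ [n [h [s [hh hs s0 ->]]]].
pose c := h.@[hcoord w] / s.@[hcoord w]; exists c.
rewrite -(local_ideal_ideal2 i0 hF hG).
have hk : h - c%:MP * s \is n.-homog.
  by rewrite mul_mpolyC; apply: dhomogD; rewrite ?dhomogN //; apply: dhomogZ.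
have [C [D E]] := point_ideal wZ i0 hk.
rewrite mevalB mevalM mevalC /c divfK // subrr mul0r mpolyC0 mul0r add0r in E.
exists (m + n)%N, (C * A + D * A'), (C * B + D * B'), (u * s).
have E' : (C * A + D * A') * F + (C * B + D * B') * G = u * (h - c%:MP * s).
  transitivity (C * (A * F + B * G) + D * (A' * F + B' * G)); first by ring.
  by rewrite -ul -uZ E; ring.
rewrite E'; split; rewrite ?dhomogM ?mevalM_neq0 //.
exact/esym/(frac_cancel _ _ (meval_neq0 u0) (meval_neq0 s0)).
Qed.

End LocalAdditivity.

(** * Points at infinity and lines *)

Section PointsAtInfinity.
Variable R : realType.
Local Notation CC := R[i].
Implicit Types (w : P2 R) (r s : CC * CC).

Definition vec_inf r : 'rV[CC]_3 := \row_(i < 3) nth 0 [:: r.1; r.2; 0] i.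

Lemma dim_line (v : 'rV[CC]_3) : v != 0 -> \dim <[v]> == 1%N.
Proof. by move=> v0; rewrite dim_vline v0. Qed.

Lemma vec_inf_eq0 r : (vec_inf r == 0) = (r == 0).
Proof.
apply/eqP/eqP => [|->]; last first.
  by apply/rowP => i; rewrite !mxE; case: i => -[|[|[|]]].
move=> /rowP r0; have := r0 iX; have := r0 iY; rewrite !mxE /=.
by case: r {r0} => a b /= -> ->.
Qed.

Lemma vec10_neq0 : vec_inf (1, 0) != 0.
Proof. by rewrite vec_inf_eq0 xpair_eqE oner_eq0. Qed.

(** The zero pair spans no point; there [insubd] falls back on (1 : 0 : 0). *)
Definition pt r : P2 R :=
  insubd (Sub <[vec_inf (1%R, 0%R)]>%VS (dim_line vec10_neq0) : P2 R) <[vec_inf r]>%VS.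

Lemma val_pt r : r != 0 -> val (pt r) = <[vec_inf r]>%VS.
Proof. by move=> r0; rewrite val_insubd dim_line // vec_inf_eq0. Qed.

Lemma hcoord_line w : val w = <[vpick (val w)]>%VS.
Proof.
apply/esym/eqP; rewrite eqEdim -memvE memv_pick /= (eqP (valP w)) dim_vline.
by rewrite vpick0 -dimv_eq0 (eqP (valP w)).
Qed.

(** The coordinates come from [vpick] and are known only up to a nonzero scalar c, which the later
    evaluations carry along. *)
Lemma hcoord_pt r : r != 0 ->
  exists c, [/\ c != 0, hcoord (pt r) iX = c * r.1,
    hcoord (pt r) iY = c * r.2 & hcoord (pt r) iZ = 0].
Proof.
move=> r0; have := memv_pick (val (pt r)); rewrite {2}val_pt // => /vlineP[c E].
exists c; split; rewrite ?/hcoord ?E ?mxE ?mulr0 //=.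
apply: contraTneq (valP (pt r)) => c0.
have : vpick (val (pt r)) == 0 by rewrite E c0 scale0r.
by rewrite vpick0 -dimv_eq0 => /eqP ->.
Qed.

Lemma at_infinityP w : at_infinity w -> hcoord w iZ = 0.
Proof. by move/eqP. Qed.

Lemma at_infinity_pt r : r != 0 -> at_infinity (pt r).
Proof. by move=> r0; have [c [_ _ _ cZ]] := hcoord_pt r0; apply/eqP. Qed.

Lemma row3P (u v : 'rV[CC]_3) : u 0 iX = v 0 iX -> u 0 iY = v 0 iY ->
  u 0 iZ = v 0 iZ -> u = v.
Proof.
move=> hX hY hZ; apply/rowP => -[[|[|[|//]]] Hi].
- by move: hX; congr (u _ _ = v _ _); apply: val_inj.
- by move: hY; congr (u _ _ = v _ _); apply: val_inj.
- by move: hZ; congr (u _ _ = v _ _); apply: val_inj.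
Qed.

Lemma eq_pt w r : at_infinity w -> r != 0 ->
  (w == pt r) = (r.2 * hcoord w iX - r.1 * hcoord w iY == 0).
Proof.
move=> winf r0; apply/eqP/eqP => [->|h].
  by have [c [_ -> -> _]] := hcoord_pt r0; ring.
apply: val_inj; rewrite val_pt // hcoord_line; apply/eqP.
have pk0 : vpick (val w) != 0 by rewrite vpick0 -dimv_eq0 (eqP (valP w)).
rewrite eqEdim !dim_vline vec_inf_eq0 r0 pk0 andbT -memvE.
have hZ := at_infinityP winf; case: r r0 h => a b /= r0 h; apply/vlineP.
have [a0|a0] := eqVneq a 0.
  have b0 : b != 0 by apply: contraNneq r0 => b0; rewrite a0 b0.
  exists (hcoord w iY / b); apply: row3P; rewrite !mxE /= ?mulr0 ?divfK //.
  move: h; rewrite a0 mul0r mulr0 subr0 => /eqP; rewrite mulf_eq0 (negbTE b0) /=.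
  by move/eqP.
exists (hcoord w iX / a); apply: row3P; rewrite !mxE /= ?mulr0 ?divfK //.
change (hcoord w iY = hcoord w iX / a * b).
by move/subr0_eq: h => h; rewrite mulrAC (mulrC _ b) h mulrAC divff ?mul1r.
Qed.

Lemma eq_pt_pt r s : r != 0 -> s != 0 -> (pt r == pt s) = (r.1 * s.2 == r.2 * s.1).
Proof.
move=> r0 s0; rewrite eq_pt ?at_infinity_pt //.
have [c [c0 -> -> _]] := hcoord_pt r0.
by rewrite -[RHS](inj_eq (mulfI c0)) -[RHS]subr_eq0; congr (_ == _); ring.
Qed.

Lemma real_pt (a b : R) : (a%:C, b%:C)%C != 0 :> CC * CC -> real_point (pt (a%:C, b%:C)%C).
Proof.
move=> r0; exists (\row_i nth 0 [:: a; b; 0] i); rewrite val_pt //.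
by congr <[_]>%VS; apply: row3P; rewrite !mxE.
Qed.

(** The second coordinate 1 forces the scalar that relates (z, 1, 0) to a real vector to be real,
    and then z is real as well. *)
Lemma nonreal_pt (z : CC) : complex.Im z != 0 -> ~ real_point (pt (z, 1)).
Proof.
move=> Imz [v Hv]; have r0 : (z, 1) != 0 :> CC * CC by rewrite xpair_eqE oner_eq0 andbF.
rewrite val_pt // in Hv.
have /vlineP[c E] : vec_inf (z, 1) \in <[map_mx (real_complex R) v]>%VS.
  by rewrite -Hv memv_line.
have := congr1 (fun u : 'rV_3 => u 0 iX) E; have := congr1 (fun u : 'rV_3 => u 0 iY) E.
rewrite !mxE /= => E1 E2; move: Imz; rewrite E2.
have v0 : v 0 iY != 0.
  apply/eqP => v0; move: E1; rewrite v0 /= mulr0 => /eqP.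
  by rewrite oner_eq0.
have -> : c = ((v 0 iY)^-1)%:C%C.
  rewrite fmorphV /=; apply/esym/(mulIf (_ : (v 0 iY)%:C%C != 0)).
    by rewrite fmorph_eq0.
  by rewrite mulVf ?fmorph_eq0.
by rewrite -rmorphM /= eqxx.
Qed.

End PointsAtInfinity.

Section LineMultiplicities.
Variable R : realType.
Local Notation CC := R[i].
Local Notation poly3 := {mpoly CC[3]}.
Implicit Types (w : P2 R) (F G : poly3) (r : CC * CC).

Definition rootform r : poly3 := linform r.2 (- r.1) 0.

Lemma XiZE : 'X_iZ = linform 0 0 1 :> poly3.
Proof. by rewrite /linform mpolyC0 mpolyC1; ring. Qed.

Lemma meval3_linform (x y z a b c : CC) :
  (linform a b c).@[fun i : 'I_3 => nth 0 [:: x; y; z] i] = a * x + b * y + c * z.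
Proof. exact: meval_linform. Qed.

Lemma XiZ_ndvd (a b c : CC) : (a != 0) || (b != 0) ->
  forall q, linform a b c <> linform 0 0 1 * q.
Proof.
move=> ab q E; have ev x y := congr1 (meval (fun i : 'I_3 => nth 0 [:: x; y; 0] i)) E.
move: (ev 1 0) (ev 0 1); rewrite !mevalM !meval3_linform !(mulr0, mul0r, mulr1, addr0, add0r).
by move=> a0 b0; move: ab; rewrite a0 b0 eqxx.
Qed.

Lemma linform_ndvd_Z (a b c : CC) : (a != 0) || (b != 0) ->
  forall q, 'X_iZ <> linform a b c * q.
Proof.
move=> ab q E; pose f x y := congr1 (meval (fun i : 'I_3 => nth 0 [:: x; y; 1] i)) E.
have [a0|a0] := eqVneq a 0.
  have b0 : b != 0 by move: ab; rewrite a0 eqxx.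
  have := f 0 (- c / b); rewrite mevalXU mevalM meval3_linform mulr0 add0r mulr1.
  by rewrite mulrCA divff // mulr1 addNr mul0r => /eqP; rewrite oner_eq0.
have := f (- c / a) 0; rewrite mevalXU mevalM meval3_linform mulr0 addr0 mulr1.
by rewrite mulrCA divff // mulr1 addNr mul0r => /eqP; rewrite oner_eq0.
Qed.

Lemma local_mult_line_inf w (a b c : CC) : at_infinity w -> (a != 0) || (b != 0) ->
  local_mult w (linform a b c) 'X_iZ (w == pt (- b, a)).
Proof.
move=> winf ab; have wZ := at_infinityP winf.
have r0 : (- b, a) != 0 :> CC * CC by rewrite xpair_eqE oppr_eq0 negb_and orbC.
have ev : (linform a b c).@[hcoord w] = a * hcoord w iX + b * hcoord w iY.
  by rewrite meval_linform wZ mulr0 addr0.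
have hl := linform_homog a b c; have hZ : ('X_iZ : poly3) \is 1.-homog by rewrite XiZE linform_homog.
case: (boolP (w == pt (- b, a))) => [weq|]; last first.
  rewrite eq_pt //= => ne; apply: local_mult_unit hl hZ _.
  by rewrite ev; apply: contraNneq ne => E; rewrite mulNr opprK E.
have [d [d0 hX hY _]] := hcoord_pt r0; rewrite -(eqP weq) /= in hX hY.
have h1 : (1 : poly3) \is 0.-homog by exact: dhomog1.
apply: (local_mult_transversal hl hZ h1) => //.
- by rewrite meval1 oner_neq0.
- by rewrite ev hX hY; ring.
- by rewrite mevalXU.
(* At w the coordinates are d (-b, a, 0), so the linear form of w is d times the line minus d c
   Z. *)
- exists d%:MP, (- (d * c))%:MP; rewrite hX hY /linform !(mpolyCN, mpolyCM, mpolyC0); ring.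
- by exists 0, 1; ring.
Qed.

Definition rootprod (rs : seq (CC * CC)) : poly3 := \prod_(r <- rs) rootform r.

Lemma rootprod_homog rs : rootprod rs \is (size rs).-homog.
Proof.
elim: rs => [|r rs IH]; rewrite /rootprod ?big_nil ?big_cons ?dhomog1 //.
exact: dhomogM (linform_homog _ _ _) IH.
Qed.

Lemma root_neq0 r : r != 0 -> (r.2 != 0) || (- r.1 != 0).
Proof. by case: r => a b; rewrite xpair_eqE negb_and oppr_eq0 orbC. Qed.

Lemma local_mult_rootprod w rs : at_infinity w -> all (fun r => r != 0) rs ->
  local_mult w (rootprod rs) 'X_iZ (count (fun r => w == pt r) rs).
Proof.
have hZ : ('X_iZ : poly3) \is 1.-homog by rewrite XiZE linform_homog.
move=> winf; elim: rs => [_|r rs IH /= /andP[r0 rs0]].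
  have h1 : (1 : poly3) \is 0.-homog by exact: dhomog1.
  rewrite /rootprod big_nil; apply: (local_mult_unit h1 hZ).
  by rewrite meval1 oner_neq0.
have r0' := root_neq0 r0.
rewrite /rootprod big_cons; apply: local_mult_mul (IH rs0).
- exact: rootprod_homog.
- exact: hZ.
- by rewrite orbA r0'.
- exact: linform_ndvd_Z.
- by have := @local_mult_line_inf w r.2 (- r.1) 0 winf r0'; rewrite opprK -surjective_pairing.
Qed.

(** Modulo Z only the restriction of the curve to Z = 0 matters. This serves both for C and for a
    conic of the pencil. *)
Lemma local_mult_inf w rs (c : CC) B : at_infinity w -> all (fun r => r != 0) rs ->
  c != 0 ->
  local_mult w (c%:MP * rootprod rs + 'X_iZ * B) 'X_iZ (count (fun r => w == pt r) rs).
Proof.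
move=> winf rs0 c0; apply/local_multC.
apply: (local_mult_eqr c0 (_ : _ = c%:MP * rootprod rs + B * 'X_iZ)).
  by rewrite [B * _]mulrC.
exact/local_multC/local_mult_rootprod.
Qed.

(** Modulo the line the curve is Z^k V. Each factor Z meets the line once at the point at infinity,
    and V is a unit there. *)
Lemma local_mult_line w (a b c : CC) V B k e : at_infinity w ->
  (a != 0) || (b != 0) -> V \is e.-homog ->
  V.@[fun i : 'I_3 => nth 0 [:: - b; a; 0] i] != 0 ->
  'X_iZ ^+ k * V + linform a b c * B \is (k + e).-homog ->
  local_mult w (linform a b c) ('X_iZ ^+ k * V + linform a b c * B)
    (if w == pt (- b, a) then k else 0).
Proof.
move=> winf ab hV V0 hG; have wZ := at_infinityP winf.
have r0 : (- b, a) != 0 :> CC * CC by rewrite xpair_eqE oppr_eq0 negb_and orbC.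
have hl := linform_homog a b c.
case: (boolP (w == pt (- b, a))) => [weq|]; last first.
  rewrite eq_pt //= => ne; apply: local_mult_unit hl hG _.
  rewrite meval_linform wZ mulr0 addr0.
  by apply: contraNneq ne => E; rewrite mulNr opprK E.
have [d [d0 hX hY _]] := hcoord_pt r0; rewrite -(eqP weq) /= in hX hY.
apply: (@local_mult_eqr _ w (linform a b c) ('X_iZ ^+ k * V) _ B 1) => //.
- exact: oner_neq0.
- by rewrite mpolyC1; ring.
apply/local_multC; elim: k {hG} => [|k IH].
  rewrite expr0 mul1r; apply: (local_mult_unit hV hl).
  have /dhomogP hV' := hV; rewrite mevalE.
  (* V is homogeneous of degree e, so rescaling the coordinates of w by d only multiplies its value
     by d^e. *)
  suff -> : \sum_(m <- msupp V) V@_m * \prod_i hcoord w i ^+ m i =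
      d ^+ e * V.@[fun i : 'I_3 => nth 0 [:: - b; a; 0] i].
    by rewrite mulf_neq0 // expf_neq0.
  rewrite mevalE mulr_sumr big_seq [RHS]big_seq; apply: eq_bigr => m /hV' <-.
  rewrite mulrCA; congr (_ * _); rewrite /= mdegE -prodrXr -big_split /=.
  apply: eq_bigr => j _; rewrite -exprMn; congr (_ ^+ _).
  case: j => -[|[|[|//]]] Hj /=; rewrite -?hX -?hY ?mulr0 -?wZ;
    by congr (hcoord _ _); apply: val_inj.
rewrite exprS -mulrA {1}XiZE -[k.+1]add1n.
apply: local_mult_mul IH.
- exact: dhomogM (Xi_homog R k iZ) hV.
- exact: hl.
- by rewrite oner_neq0 !orbT.
- exact: XiZ_ndvd.
- apply/local_multC; rewrite -XiZE; have := local_mult_line_inf c winf ab.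
  by rewrite weq.
Qed.

End LineMultiplicities.

(** The field [c11] is the full coefficient of XY; the 2 in front of a11 and b11 is absorbed by
    [conicP] and [conicQ]. *)
Record conic (A : Type) := Conic
  { c20 : A; c11 : A; c02 : A; c10 : A; c01 : A; c00 : A }.

Definition cmap A B (f : A -> B) (G : conic A) : conic B :=
  Conic (f (c20 G)) (f (c11 G)) (f (c02 G)) (f (c10 G)) (f (c01 G)) (f (c00 G)).

Definition cval (A : comNzRingType) (G : conic A) (x y z : A) : A :=
  c20 G * x ^+ 2 + c11 G * x * y + c02 G * y ^+ 2
  + c10 G * x * z + c01 G * y * z + c00 G * z ^+ 2.

Definition cpoly (K : comNzRingType) (G : conic K) : {mpoly K[3]} :=
  cval (cmap (@mpolyC 3 K) G) 'X_iX 'X_iY 'X_iZ.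

Definition cpencil (A : comNzRingType) (a b : A) (F G : conic A) : conic A :=
  Conic (a * c20 F + b * c20 G) (a * c11 F + b * c11 G) (a * c02 F + b * c02 G)
    (a * c10 F + b * c10 G) (a * c01 F + b * c01 G) (a * c00 F + b * c00 G).

Lemma cpoly_homog (K : fieldType) (G : conic K) : cpoly G \is 2.-homog.
Proof.
rewrite /cpoly /cval /= -!(mulrA _%:MP) !mul_mpolyC.
have X i := mpolyX_homog K (i : 'I_3).
have XX (i j : 'I_3) : ('X_i * 'X_j : {mpoly K[3]}) \is 2.-homog := dhomogM (X i) (X j).
by rewrite !expr2; do 5?[apply: dhomogD]; apply/dhomogZ/XX.
Qed.

Lemma meval_cpoly (K : comNzRingType) (G : conic K) (v : 'I_3 -> K) :
  (cpoly G).@[v] = cval G (v iX) (v iY) (v iZ).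
Proof.
by rewrite /cpoly /cval /= !expr2 !(mevalD, mevalM, mevalC, mevalXU).
Qed.

Lemma cpoly_pencil (K : comNzRingType) (a b : K) (F G : conic K) :
  cpoly (cpencil a b F G) = a%:MP * cpoly F + b%:MP * cpoly G.
Proof. by rewrite /cpoly /cval /= !mpolyCD !mpolyCM; ring. Qed.

(* The line Lambda : aX + bY + cZ = 0 meets the line Z = t (xY - yX) in the
   point (-b - tcx : a - tcy : t (ax + by)). *)
Definition on_line (K : fieldType) (G : conic K) (a b c x y : K) : {poly K} :=
  cval (cmap polyC G) ((- b)%:P - 'X * (c * x)%:P) (a%:P - 'X * (c * y)%:P)
    ('X * (a * x + b * y)%:P).

Section ConicLine.
Variable R : realType.
Local Notation CC := R[i].
Local Notation poly3 := {mpoly CC[3]}.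

Lemma unit_combination (a b : CC) : (a != 0) || (b != 0) ->
  exists m1 m2, m2 * a - m1 * b = 1.
Proof.
have [-> /= b0|a0 _] := eqVneq a 0.
  by exists (- b^-1), 0; rewrite mulNr opprK mulVf // mul0r add0r.
by exists 0, a^-1; rewrite mulVf // mul0r subr0.
Qed.

(** In the coordinates u, Z on the line, with u = 1 at (-b : a : 0), the conic restricts to g0 u^2 +
    g1 u Z + g2 Z^2. The index of the first nonzero coefficient is the multiplicity at infinity, and
    also the order in t at the moving point of the line. If all three vanish, the line is a
    component. *)
Lemma conic_line (G : conic CC) (a b c : CC) : (a != 0) || (b != 0) ->
  (exists q, cpoly G = linform a b c * q) \/
  exists k g, [/\ (k <= 2)%N, g != 0,
    forall w, at_infinity w ->
      local_mult w (linform a b c) (cpoly G) (if w == pt (- b, a) then k else 0),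
    forall x y, exists E, on_line G a b c x y =
      'X ^+ k * ((g * (a * x + b * y) ^+ k)%:P + 'X * E)
    & (0 < k)%N = (cval G (- b) a 0 == 0)].
Proof.
move=> ab; have [m1 [m2 D1]] := unit_combination ab.
pose g0 := cval G (- b) a 0.
pose g1 := c20 G * b * m2 * c *+ 2 - c11 G * c * (b * m1 + a * m2)
  + c02 G * a * m1 * c *+ 2 - c10 G * b + c01 G * a.
pose g2 := cval G (- (m2 * c)) (m1 * c) 1.
have M1 : (m2%:MP * a%:MP - m1%:MP * b%:MP : poly3) = 1.
  by rewrite -!mpolyCM -mpolyCB D1.
have P1 : (m2%:P * a%:P - m1%:P * b%:P : {poly CC}) = 1.
  by rewrite -!polyCM -polyCB D1.
pose u : poly3 := m1%:MP * 'X_iX + m2%:MP * 'X_iY.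
(* On the line, X = - b u - m2 c Z and Y = a u + m1 c Z, because m2 a - m1 b = 1. *)
have [B GE] : exists B, cpoly G = g0%:MP * u ^+ 2 + g1%:MP * u * 'X_iZ
    + g2%:MP * 'X_iZ ^+ 2 + linform a b c * B.
  pose l := linform a b c; pose z : poly3 := 'X_iZ.
  pose X0 := - b%:MP * u - m2%:MP * c%:MP * z; pose Y0 := a%:MP * u + m1%:MP * c%:MP * z.
  have hX : 'X_iX = X0 + m2%:MP * l.
    by rewrite -[LHS]mul1r -M1 /X0 /l /linform /u /z; ring.
  have hY : 'X_iY = Y0 - m1%:MP * l.
    by rewrite -[LHS]mul1r -M1 /Y0 /l /linform /u /z; ring.
  exists ((c20 G)%:MP * m2%:MP * (X0 *+ 2 + m2%:MP * l)
    + (c11 G)%:MP * (m2%:MP * Y0 - m1%:MP * X0 - m1%:MP * m2%:MP * l)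
    - (c02 G)%:MP * m1%:MP * (Y0 *+ 2 - m1%:MP * l)
    + (c10 G)%:MP * m2%:MP * z - (c01 G)%:MP * m1%:MP * z).
  rewrite /cpoly /cval /= hX hY -/z -/l /X0 /Y0 /g0 /g1 /g2 /cval.
  rewrite !(mpolyCD, mpolyCM, mpolyCN, mpolyCB, mpolyCMn, rmorphXn, mpolyC0, mpolyC1) /=.
  by ring.
(* At the moving point, u takes the value 1 - t c (m1 x + m2 y) and Z the value t (a x + b y). *)
have LE x y : on_line G a b c x y =
    g0%:P * (1 - 'X * (c * (m1 * x + m2 * y))%:P) ^+ 2
    + g1%:P * (1 - 'X * (c * (m1 * x + m2 * y))%:P) * ('X * (a * x + b * y)%:P)
    + g2%:P * ('X * (a * x + b * y)%:P) ^+ 2.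
  pose v : {poly CC} := 1 - 'X * (c * (m1 * x + m2 * y))%:P.
  pose z : {poly CC} := 'X * (a * x + b * y)%:P.
  have hX : (- b)%:P - 'X * (c * x)%:P = - b%:P * v - m2%:P * c%:P * z.
    by rewrite -[_ * (c * x)%:P]mul1r -P1 /v /z; ring.
  have hY : a%:P - 'X * (c * y)%:P = a%:P * v + m1%:P * c%:P * z.
    by rewrite -[_ * (c * y)%:P]mul1r -P1 /v /z; ring.
  rewrite /on_line hX hY -/v -/z /g0 /g1 /g2 /cval /=.
  by move: v z {hX hY} => v z; ring.
have hu : u \is 1.-homog.
  by rewrite /u !mul_mpolyC; apply: dhomogD; apply/dhomogZ/mpolyX_homog.
have hZ : ('X_iZ : poly3) \is 1.-homog := mpolyX_homog CC iZ.
have hC (d : CC) : (d%:MP : poly3) \is 0.-homog := mpolyC_homog 3 d.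
have uE : u.@[fun i : 'I_3 => nth 0 [:: - b; a; 0] i] = 1.
  by rewrite mevalD !mevalM !mevalC !mevalXU /= -D1; ring.
have zE : ('X_iZ : poly3).@[fun i : 'I_3 => nth 0 [:: - b; a; 0] i] = 0.
  by rewrite mevalXU.
have hG := cpoly_homog G.
have [z0|n0] := eqVneq g0 0; last first.
  right; exists 0%N, g0; split => //.
  - move=> w winf.
    pose V := g0%:MP * u ^+ 2 + g1%:MP * u * 'X_iZ + g2%:MP * 'X_iZ ^+ 2.
    have GE' : cpoly G = 'X_iZ ^+ 0 * V + linform a b c * B by rewrite GE /V; ring.
    have hV : V \is 2.-homog.
      rewrite /V !expr2; do 2?[apply: dhomogD].
      * exact: (dhomogM (hC _) (dhomogM hu hu)).
      * exact: (dhomogM (dhomogM (hC _) hu) hZ).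
      * exact: (dhomogM (hC _) (dhomogM hZ hZ)).
    have V0 : V.@[fun i : 'I_3 => nth 0 [:: - b; a; 0] i] != 0.
      by rewrite /V !mevalD !expr2 !mevalM !mevalC zE uE !mulr0 !mulr1 !addr0.
    have := @local_mult_line _ w a b c V B 0 2 winf ab hV V0.
    by rewrite -GE' => /(_ hG).
  - move=> x y; exists (- g0%:P * (c * (m1 * x + m2 * y))%:P * (2 - 'X * (c * (m1 * x + m2 * y))%:P)
      + g1%:P * (1 - 'X * (c * (m1 * x + m2 * y))%:P) * (a * x + b * y)%:P
      + g2%:P * 'X * (a * x + b * y)%:P ^+ 2).
    by rewrite LE; ring.
have [z1|n1] := eqVneq g1 0; last first.
  right; exists 1%N, g1; split => //.
  - move=> w winf.
    pose V := g1%:MP * u + g2%:MP * 'X_iZ.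
    have GE' : cpoly G = 'X_iZ ^+ 1 * V + linform a b c * B by rewrite GE z0 mpolyC0 /V; ring.
    have hV : V \is 1.-homog.
      rewrite /V; apply: dhomogD.
      * exact: (dhomogM (hC _) hu).
      * exact: (dhomogM (hC _) hZ).
    have V0 : V.@[fun i : 'I_3 => nth 0 [:: - b; a; 0] i] != 0.
      by rewrite /V !mevalD !mevalM !mevalC zE uE !mulr0 !mulr1 !addr0.
    have := @local_mult_line _ w a b c V B 1 1 winf ab hV V0.
    by rewrite -GE' => /(_ hG).
  - move=> x y; exists (- g1%:P * (c * (m1 * x + m2 * y))%:P * (a * x + b * y)%:P
      + g2%:P * (a * x + b * y)%:P ^+ 2).
    by rewrite LE z0; ring.
have [z2|n2] := eqVneq g2 0; last first.
  right; exists 2%N, g2; split => //.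
  - move=> w winf.
    have GE' : cpoly G = 'X_iZ ^+ 2 * g2%:MP + linform a b c * B.
      by rewrite GE z0 z1 mpolyC0; ring.
    have V0 : (g2%:MP : poly3).@[fun i : 'I_3 => nth 0 [:: - b; a; 0] i] != 0.
      by rewrite mevalC.
    have := @local_mult_line _ w a b c g2%:MP B 2 0 winf ab (hC g2) V0.
    by rewrite -GE' => /(_ hG).
  - by move=> x y; exists 0; rewrite LE z0 z1; ring.
by left; exists B; rewrite GE z0 z1 z2 mpolyC0; ring.
Qed.

End ConicLine.

(** * The resultant on the lines through a point at infinity *)

Section Derivations.
Variables (A : comNzRingType) (n : nat) (L : {additive A -> A}).
Hypothesis LM : forall a b, L (a * b) = L a * b + a * L b.

Lemma map_mpoly_leibniz (U V : {mpoly A[n]}) :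
  map_mpoly L (U * V) = map_mpoly L U * V + U * map_mpoly L V.
Proof.
have LX c m : map_mpoly L (c *: 'X_[m] : {mpoly A[n]}) = L c *: 'X_[m].
  apply/mpolyP => k; rewrite mcoeff_map_mpoly !mcoeffZ mcoeffX.
  by case: eqP; rewrite ?mulr1 ?mulr0 ?raddf0.
elim/mpolyind: U => [|c m U _ _ IHU]; first by rewrite !mul0r raddf0 !mul0r addr0.
rewrite mulrDl !raddfD /= !mulrDl IHU addrACA; congr (_ + _).
elim/mpolyind: V {IHU} => [|d k V _ _ IHV]; first by rewrite !mulr0 raddf0 mulr0 addr0.
rewrite mulrDr !raddfD /= !mulrDr IHV addrACA; congr (_ + _).
rewrite -scalerAl -scalerAr scalerA -mpolyXD !LX LM scalerDl mpolyXD.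
by rewrite -!scalerAl -!scalerAr !scalerA mulrC.
Qed.

End Derivations.

Section Flow.
Variables (W : comNzRingType) (D : W -> W).
Hypothesis D0 : D 0 = 0.
Hypothesis DD : forall a b, D (a + b) = D a + D b.
Hypothesis DM : forall a b, D (a * b) = D a * b + a * D b.

(* [flow f] says that f(t) = exp(tD) f(0). *)
Definition flow (f : {poly W}) : Prop := forall i, D f`_i = f`_i.+1 *+ i.+1.

Lemma flowD f g : flow f -> flow g -> flow (f + g).
Proof. by move=> hf hg i; rewrite !coefD DD hf hg mulrnDl. Qed.

(** For a flow, applying D to the coefficients is formal differentiation in t, and both operations
    satisfy the Leibniz rule. *)
Lemma flowM f g : flow f -> flow g -> flow (f * g).
Proof.
move=> hf hg i.
have Dsum (I : Type) (s : seq I) (F : I -> W) : D (\sum_(j <- s) F j) = \sum_(j <- s) D (F j).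
  by elim/big_rec2: _ => // j x y _ <-; rewrite DD.
have -> : (f * g)`_i.+1 *+ i.+1 = ((f * g)^`())`_i by rewrite coef_deriv.
rewrite derivM coefD !coefM -big_split /= Dsum; apply: eq_bigr => j _.
by rewrite DM hf hg !coef_deriv.
Qed.

Lemma flowN f : flow f -> flow (- f).
Proof.
move=> hf i; rewrite !coefN mulNrn -hf; apply/eqP; rewrite -addr_eq0 -DD addNr.
by rewrite D0.
Qed.

Lemma flow_iter f i : flow f -> iter i D f`_0 = f`_i *+ i`!.
Proof.
have Dmn a k : D (a *+ k) = D a *+ k.
  by elim: k => [|k IH]; rewrite ?mulr0n // !mulrS DD IH.
move=> hf; elim: i => [|i IH]; first by rewrite mulr1n.
by rewrite iterS IH Dmn hf -mulrnA factS.
Qed.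

End Flow.

(** The Sylvester resultant of a x^2 + b x y + c y^2 and d x^2 + e x y + f y^2, written in the 2 x 2
    minors of their coefficients. *)
Definition res2 (A : comNzRingType) (a b c d e f : A) : A :=
  (a * f - c * d) ^+ 2 - (a * e - b * d) * (b * f - c * e).

(* Coefficients in X and Y of G(X, Y, t (xY - yX)). *)
Definition cut20 (A : comNzRingType) (G : conic A) (x y : A) : {poly A} :=
  (c20 G)%:P - (c10 G * y)%:P * 'X + (c00 G * y ^+ 2)%:P * 'X^2.
Definition cut11 (A : comNzRingType) (G : conic A) (x y : A) : {poly A} :=
  (c11 G)%:P + (c10 G * x - c01 G * y)%:P * 'X - (c00 G * x * y *+ 2)%:P * 'X^2.
Definition cut02 (A : comNzRingType) (G : conic A) (x y : A) : {poly A} :=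
  (c02 G)%:P + (c01 G * x)%:P * 'X + (c00 G * x ^+ 2)%:P * 'X^2.

Definition rho (A : comNzRingType) (F G : conic A) (x y : A) : {poly A} :=
  res2 (cut20 F x y) (cut11 F x y) (cut02 F x y)
       (cut20 G x y) (cut11 G x y) (cut02 G x y).

Lemma rho_pencil (A : comNzRingType) (a b c d : A) (F G : conic A) x y :
  rho (cpencil a b F G) (cpencil c d F G) x y =
  ((a * d - b * c) ^+ 2)%:P * rho F G x y.
Proof.
rewrite /rho.
have E20 a' b' : cut20 (cpencil a' b' F G) x y = a'%:P * cut20 F x y + b'%:P * cut20 G x y.
  by rewrite /cut20 /=; ring.
have E11 a' b' : cut11 (cpencil a' b' F G) x y = a'%:P * cut11 F x y + b'%:P * cut11 G x y.
  by rewrite /cut11 /=; ring.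
have E02 a' b' : cut02 (cpencil a' b' F G) x y = a'%:P * cut02 F x y + b'%:P * cut02 G x y.
  by rewrite /cut02 /=; ring.
by rewrite !E20 !E11 !E02 /res2; ring.
Qed.

Definition line_pair (A : comNzRingType) (a1 b1 d1 a2 b2 d2 : A) : conic A :=
  Conic (a1 * a2) (a1 * b2 + b1 * a2) (b1 * b2) (a1 * d2 + d1 * a2)
    (b1 * d2 + d1 * b2) (d1 * d2).

Lemma cpoly_line_pair (K : comNzRingType) (a1 b1 d1 a2 b2 d2 : K) :
  cpoly (line_pair a1 b1 d1 a2 b2 d2) = linform a1 b1 d1 * linform a2 b2 d2.
Proof. by rewrite /cpoly /cval /linform /=; ring. Qed.

(** On the moving line each factor becomes a linear form in X and Y with root ([X b d] : [Y a d]),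
    and the resultant of a product of two linear forms with G is the product of the values of G at
    the two roots. *)
Lemma rho_line_pair (K : fieldType) (a1 b1 d1 a2 b2 d2 : K) G x y :
  rho (line_pair a1 b1 d1 a2 b2 d2) G x y =
  on_line G a1 b1 d1 x y * on_line G a2 b2 d2 x y.
Proof.
pose X (b d : K) : {poly K} := (- b)%:P - 'X * (d * x)%:P.
pose Y (a d : K) : {poly K} := a%:P - 'X * (d * y)%:P.
have onE a b d : on_line G a b d x y = cut20 G x y * X b d ^+ 2
    + cut11 G x y * X b d * Y a d + cut02 G x y * Y a d ^+ 2.
  by rewrite /on_line /cval /cut20 /cut11 /cut02 /X /Y /=; ring.
rewrite !onE /rho.
have -> : cut20 (line_pair a1 b1 d1 a2 b2 d2) x y = Y a1 d1 * Y a2 d2.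
  by rewrite /cut20 /Y /=; ring.
have -> : cut11 (line_pair a1 b1 d1 a2 b2 d2) x y =
    - (X b1 d1 * Y a2 d2 + Y a1 d1 * X b2 d2).
  by rewrite /cut11 /X /Y /=; ring.
have -> : cut02 (line_pair a1 b1 d1 a2 b2 d2) x y = X b1 d1 * X b2 d2.
  by rewrite /cut02 /X /=; ring.
by rewrite /res2; ring.
Qed.

Lemma cut_map (A B : comNzRingType) (f : {rmorphism A -> B}) (G : conic A) x y :
  [/\ map_poly f (cut20 G x y) = cut20 (cmap f G) (f x) (f y),
      map_poly f (cut11 G x y) = cut11 (cmap f G) (f x) (f y)
    & map_poly f (cut02 G x y) = cut02 (cmap f G) (f x) (f y)].
Proof.
by split; rewrite /cut20 /cut11 /cut02 /=;
  rewrite !(rmorphD, rmorphN, rmorphM, rmorphXn, rmorphMn) /= !map_polyC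
    !map_polyX /=; ring.
Qed.

Lemma rho_map (A B : comNzRingType) (f : {rmorphism A -> B}) (F G : conic A) x y :
  map_poly f (rho F G x y) = rho (cmap f F) (cmap f G) (f x) (f y).
Proof.
have [hF1 hF2 hF3] := cut_map f F x y; have [hG1 hG2 hG3] := cut_map f G x y.
by rewrite /rho -hF1 -hF2 -hF3 -hG1 -hG2 -hG3 /res2 !(rmorphB, rmorphM, rmorphXn).
Qed.

Section FlowRho.
Variables (W : comNzRingType) (D : W -> W).
Hypothesis DD : forall a b, D (a + b) = D a + D b.
Hypothesis DM : forall a b, D (a * b) = D a * b + a * D b.

(** The hypotheses describe the infinitesimal translation on the coefficients of a conic. They make
    the three coefficients of the restriction flows, and [res2] is built from these by ring
    operations. *)
Lemma flow_rho (F G : conic W) (x y : W) : D x = 0 -> D y = 0 ->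
  (forall H, H = F \/ H = G ->
    [/\ D (c00 H) = 0, D (c10 H) = - (y * c00 H *+ 2), D (c01 H) = x * c00 H *+ 2
      & [/\ D (c20 H) = - (y * c10 H), D (c11 H) = x * c10 H - y * c01 H
        & D (c02 H) = x * c01 H]]) ->
  flow D (rho F G x y).
Proof.
move=> Dx Dy FG.
have D0 : D 0 = 0 by apply: (addrI (D 0)); rewrite -DD !addr0.
have DN a : D (- a) = - D a by apply/eqP; rewrite -addr_eq0 -DD addNr D0.
have coefE (p q r : W) i : (p%:P + q%:P * 'X + r%:P * 'X^2)`_i = nth 0 [:: p; q; r] i.
  rewrite !coefD coefC !coefCM coefX coefXn.
  by case: i => [|[|[|i]]] /=; rewrite ?mulr0 ?mulr1 ?addr0 ?add0r // nth_nil.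
have flow3 (p q r : W) : D p = q -> D q = r *+ 2 -> D r = 0 ->
    flow D (p%:P + q%:P * 'X + r%:P * 'X^2).
  move=> pq qr r0 i; rewrite !coefE; case: i => [|[|[|i]]] //=.
    by rewrite r0 mul0rn.
  by rewrite nth_nil D0 mul0rn.
have cuts H : H = F \/ H = G ->
    [/\ flow D (cut20 H x y), flow D (cut11 H x y) & flow D (cut02 H x y)].
  case/FG => h00 h10 h01 [h20 h11 h02]; split.
  - have -> : cut20 H x y = (c20 H)%:P + (- (y * c10 H))%:P * 'X
        + (c00 H * y ^+ 2)%:P * 'X^2 by rewrite /cut20; ring.
    apply: flow3 => //; first by rewrite DN DM Dy h10; ring.
    by rewrite expr2 !DM Dy h00; ring.
  - have -> : cut11 H x y = (c11 H)%:P + (x * c10 H - y * c01 H)%:P * 'X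
        + (- (c00 H * x * y *+ 2))%:P * 'X^2 by rewrite /cut11; ring.
    apply: flow3 => //; first by rewrite DD DN !DM Dx Dy h10 h01; ring.
    by rewrite DN mulr2n DD !DM Dx Dy h00; ring.
  - have -> : cut02 H x y = (c02 H)%:P + (x * c01 H)%:P * 'X
        + (c00 H * x ^+ 2)%:P * 'X^2 by rewrite /cut02; ring.
    apply: flow3 => //; first by rewrite DM Dx h01; ring.
    by rewrite expr2 !DM Dx h00; ring.
have [a b c] := cuts F (or_introl erefl); have [d e f] := cuts G (or_intror erefl).
have M := flowM D0 DD DM; have A := flowD DD; have N := flowN D0 DD.
by rewrite /rho /res2 expr2; repeat first [exact a | exact b | exact c
  | exact d | exact e | exact f | apply M | apply A | apply N].
Qed.

Lemma rho_coef0 (F G : conic W) (x y : W) :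
  (rho F G x y)`_0 = res2 (c20 F) (c11 F) (c02 F) (c20 G) (c11 G) (c02 G).
Proof.
have e20 H : (cut20 H x y)`_0 = c20 H.
  by rewrite /cut20 !coefD coefN coefC coefMX coefCM coefXn /= oppr0 mulr0 !addr0.
have e11 H : (cut11 H x y)`_0 = c11 H.
  by rewrite /cut11 !coefD coefN coefC coefMX coefCM coefXn /= mulr0 oppr0 !addr0.
have e02 H : (cut02 H x y)`_0 = c02 H.
  by rewrite /cut02 !coefD coefC coefMX coefCM coefXn /= mulr0 !addr0.
have res0 (a b c d e f : {poly W}) :
    (res2 a b c d e f)`_0 = res2 a`_0 b`_0 c`_0 d`_0 e`_0 f`_0.
  by rewrite /res2 !expr2 !(coefB, coef0M).
by rewrite /rho res0 !e20 !e11 !e02.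
Qed.

End FlowRho.

(** * Binary forms and the comitants in coordinates *)

Section BinaryForms.
Variable A : comNzRingType.
Local Notation vx := (vx A).
Local Notation vy := (vy A).

Definition blin (a b : A) : {mpoly A[2]} := a%:MP * vx + b%:MP * vy.
Definition bquad (a b c : A) : {mpoly A[2]} :=
  a%:MP * vx ^+ 2 + b%:MP * vx * vy + c%:MP * vy ^+ 2.
Definition bcubic (a b c d : A) : {mpoly A[2]} :=
  a%:MP * vx ^+ 3 + b%:MP * vx ^+ 2 * vy + c%:MP * vx * vy ^+ 2 + d%:MP * vy ^+ 3.

Lemma mnm2_eq (i j k l : nat) :
  ((U_(ix) *+ i + U_(iy) *+ j)%MM == (U_(ix) *+ k + U_(iy) *+ l)%MM) =
  (i == k) && (j == l).
Proof.
apply/eqP/andP => [/mnmP E|[/eqP-> /eqP->]//].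
have := E ix; have := E iy; rewrite !mnmDE !mulmnE !mnm1E /=.
by rewrite !(mul0n, mul1n, muln0, muln1, addn0, add0n) => -> ->.
Qed.

Lemma cf_mono (c : A) (i j k l : nat) :
  cf (c%:MP * vx ^+ i * vy ^+ j) k l = if (i == k) && (j == l) then c else 0.
Proof.
rewrite /cf /Defs.vx /Defs.vy -mulrA mcoeffCM !mpolyXn -mpolyXD mcoeffX mnm2_eq.
by case: ifP; rewrite ?mulr1 ?mulr0.
Qed.

Lemma cfD (f g : {mpoly A[2]}) k l : cf (f + g) k l = cf f k l + cf g k l.
Proof. exact: mcoeffD. Qed.

Lemma cf_bquad a b c :
  [/\ cf (bquad a b c) 2 0 = a, cf (bquad a b c) 1 1 = b & cf (bquad a b c) 0 2 = c].
Proof.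
have -> : bquad a b c = a%:MP * vx ^+ 2 * vy ^+ 0 + b%:MP * vx ^+ 1 * vy ^+ 1
    + c%:MP * vx ^+ 0 * vy ^+ 2 by rewrite /bquad; ring.
by rewrite !cfD !cf_mono /= !(addr0, add0r).
Qed.

Lemma cf_bcubic a b c d :
  [/\ cf (bcubic a b c d) 3 0 = a, cf (bcubic a b c d) 2 1 = b,
      cf (bcubic a b c d) 1 2 = c & cf (bcubic a b c d) 0 3 = d].
Proof.
have -> : bcubic a b c d = a%:MP * vx ^+ 3 * vy ^+ 0 + b%:MP * vx ^+ 2 * vy ^+ 1
    + c%:MP * vx ^+ 1 * vy ^+ 2 + d%:MP * vx ^+ 0 * vy ^+ 3 by rewrite /bcubic; ring.
by rewrite !cfD !cf_mono /= !(addr0, add0r).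
Qed.

Lemma bquad_eq0 a b c : (bquad a b c = 0) <-> [/\ a = 0, b = 0 & c = 0].
Proof.
split=> [E|[-> -> ->]]; last by rewrite /bquad mpolyC0; ring.
by have [] := cf_bquad a b c; rewrite E /cf !mcoeff0.
Qed.

Lemma bcubic_eq0 a b c d : (bcubic a b c d = 0) <-> [/\ a = 0, b = 0, c = 0 & d = 0].
Proof.
split=> [E|[-> -> -> ->]]; last by rewrite /bcubic mpolyC0; ring.
by have [] := cf_bcubic a b c d; rewrite E /cf !mcoeff0.
Qed.

Lemma mderiv_var (i j : 'I_2) : ('X_j : {mpoly A[2]})^`M(i) = (i == j)%:R.
Proof.
rewrite mderivX mnm1E eq_sym; case: eqP => [->|_]; last by rewrite scale0r.
rewrite scale1r (_ : (U_(j) - U_(j))%MM = 0%MM) ?mpolyX0 //.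
by apply/mnmP => k; rewrite mnmBE subnn mnm0E.
Qed.

Lemma mderiv_bcubic a b c d :
  (bcubic a b c d)^`M(ix) = bquad (a *+ 3) (b *+ 2) c /\
  (bcubic a b c d)^`M(iy) = bquad b (c *+ 2) (d *+ 3).
Proof.
rewrite /bcubic /bquad !exprS !expr0 !mulr1 !(mderivD, mderivM, mderivC).
by rewrite /Defs.vx /Defs.vy !mderiv_var /= !mpolyCMn; split; ring.
Qed.

Lemma mderiv_bquad a b c :
  (bquad a b c)^`M(ix) = blin (a *+ 2) b /\ (bquad a b c)^`M(iy) = blin b (c *+ 2).
Proof.
rewrite /blin /bquad !expr2 !(mderivD, mderivM, mderivC).
by rewrite /Defs.vx /Defs.vy !mderiv_var /= !mpolyCMn; split; ring.
Qed.

Lemma mderiv_blin a b : (blin a b)^`M(ix) = a%:MP /\ (blin a b)^`M(iy) = b%:MP.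
Proof.
rewrite /blin !(mderivD, mderivM, mderivC).
by rewrite /Defs.vx /Defs.vy !mderiv_var /=; split; ring.
Qed.

Lemma Hess_bcubic a b c d : Hess (bcubic a b c d) =
  bquad (a * c *+ 12 - b ^+ 2 *+ 4) (a * d *+ 36 - b * c *+ 4)
    (b * d *+ 12 - c ^+ 2 *+ 4).
Proof.
rewrite /Hess (mderiv_bcubic a b c d).1 (mderiv_bcubic a b c d).2.
rewrite !(mderiv_bquad _ _ _).1 !(mderiv_bquad _ _ _).2 /blin /bquad.
by rewrite !(mpolyCB, mpolyCMn, mpolyCM, rmorphXn) /=; ring.
Qed.

Lemma Jacob_bquad a b c d e f : Jacob (bquad a b c) (bquad d e f) =
  bquad ((a * e - b * d) *+ 2) ((a * f - c * d) *+ 4) ((b * f - c * e) *+ 2).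
Proof.
rewrite /Jacob !(mderiv_bquad _ _ _).1 !(mderiv_bquad _ _ _).2 /blin /bquad.
by rewrite !(mpolyCB, mpolyCMn, mpolyCM) /=; ring.
Qed.

Lemma transvectant2_bquad a b c d e f :
  transvectant2 (bquad a b c) (bquad d e f) =
  (a * f *+ 4 - b * e *+ 2 + c * d *+ 4)%:MP.
Proof.
rewrite /transvectant2 !(mderiv_bquad _ _ _).1 !(mderiv_bquad _ _ _).2.
rewrite !(mderiv_blin _ _).1 !(mderiv_blin _ _).2.
by rewrite !(mpolyCB, mpolyCD, mpolyCMn, mpolyCM) /=; ring.
Qed.

Lemma discrim2_bquad a b c : discrim2 (bquad a b c) = b ^+ 2 - a * c *+ 4.
Proof. by rewrite /discrim2; have [-> -> ->] := cf_bquad a b c. Qed.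

Lemma bquadD a b c a' b' c' :
  bquad a b c + bquad a' b' c' = bquad (a + a') (b + b') (c + c').
Proof. by rewrite /bquad !mpolyCD; ring. Qed.
Lemma bquadN a b c : - bquad a b c = bquad (- a) (- b) (- c).
Proof. by rewrite /bquad !mpolyCN; ring. Qed.
Lemma bquadMn a b c n : bquad a b c *+ n = bquad (a *+ n) (b *+ n) (c *+ n).
Proof. by rewrite /bquad !mpolyCMn !mulrnDl !mulrnAl. Qed.

End BinaryForms.

Section Comitants.
Variables (T : comNzRingType) (S : qsys T).
Local Notation "'A'" := (S a20).
Local Notation "'B'" := (S a11 *+ 2).
Local Notation "'C'" := (S a02).
Local Notation "'D'" := (S b20).
Local Notation "'E'" := (S b11 *+ 2).
Local Notation "'F'" := (S b02).

Lemma p2E : p2 S = bquad A B C.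
Proof. by rewrite /p2 /bquad -!mul_mpolyC mulrA. Qed.
Lemma q2E : q2 S = bquad D E F.
Proof. by rewrite /q2 /bquad -!mul_mpolyC mulrA. Qed.
Lemma p1E : p1 S = blin (S a10) (S a01).
Proof. by rewrite /p1 /blin -!mul_mpolyC. Qed.
Lemma q1E : q1 S = blin (S b10) (S b01).
Proof. by rewrite /q1 /blin -!mul_mpolyC. Qed.

Lemma C1E : C1 S = bquad (- S b10) (S a10 - S b01) (S a01).
Proof. by rewrite /C1 p1E q1E /blin /bquad mpolyCB mpolyCN; ring. Qed.

Lemma C2E : C2 S = bcubic (- D) (A - E) (B - F) C.
Proof. by rewrite /C2 p2E q2E /bquad /bcubic !mpolyCB mpolyCN; ring. Qed.

Lemma KformE : Kform S =
  bquad ((A * E - B * D) *+ 2) ((A * F - C * D) *+ 4) ((B * F - C * E) *+ 2).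
Proof. by rewrite /Kform p2E q2E Jacob_bquad. Qed.

Lemma HformE : Hform S = bquad
  (- (E ^+ 2 - D * F *+ 4)) ((B * E - A * F *+ 2 - C * D *+ 2) *+ 2)
  (- (B ^+ 2 - A * C *+ 4)).
Proof.
rewrite /Hform p2E q2E.
have map_bquad (a b c : T) :
    map_mpoly (@mpolyC 2 T) (bquad a b c) = bquad a%:MP b%:MP c%:MP.
  by rewrite /bquad !expr2 !rmorphD !rmorphM /= !map_mpolyC /vx /vy !map_mpolyX.
rewrite !map_bquad.
have -> : vy T *: bquad A%:MP B%:MP C%:MP + (- vx T) *: bquad D%:MP E%:MP F%:MP =
    bquad (vy T * A%:MP - vx T * D%:MP) (vy T * B%:MP - vx T * E%:MP)
      (vy T * C%:MP - vx T * F%:MP).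
  by rewrite -!mul_mpolyC /bquad !(mpolyCB, mpolyCM, mpolyCN); ring.
rewrite discrim2_bquad /bquad.
by rewrite !(mpolyCB, mpolyCD, mpolyCN, mpolyCMn, mpolyCM, rmorphXn) /=; ring.
Qed.

Lemma MformE : Mform S = bquad
  ((- D * (B - F) *+ 12 - (A - E) ^+ 2 *+ 4) *+ 2)
  ((- D * C *+ 36 - (A - E) * (B - F) *+ 4) *+ 2)
  (((A - E) * C *+ 12 - (B - F) ^+ 2 *+ 4) *+ 2).
Proof. by rewrite /Mform C2E Hess_bcubic bquadMn. Qed.

Lemma etaE : eta S = (A - E) ^+ 2 * (B - F) ^+ 2 - (- D * (B - F) ^+ 3) *+ 4
  - ((A - E) ^+ 3 * C) *+ 4 + (- D * (A - E) * (B - F) * C) *+ 18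
  - ((- D) ^+ 2 * C ^+ 2) *+ 27.
Proof. by rewrite /eta /discrim3 C2E; have [-> -> -> ->] := cf_bcubic (- D) (A - E) (B - F) C. Qed.

Lemma kappaE : kappa S =
  (let: (m0, m1, m2) := ((- D * (B - F) *+ 12 - (A - E) ^+ 2 *+ 4) *+ 2,
     (- D * C *+ 36 - (A - E) * (B - F) *+ 4) *+ 2,
     ((A - E) * C *+ 12 - (B - F) ^+ 2 *+ 4) *+ 2) in
   m0 * ((B * F - C * E) *+ 2) *+ 4 - m1 * ((A * F - C * D) *+ 4) *+ 2
   + m2 * ((A * E - B * D) *+ 2) *+ 4)%:MP.
Proof. by rewrite /kappa MformE KformE transvectant2_bquad. Qed.

Lemma kappa1E : kappa1 S =
  (let: (m0, m1, m2) := ((- D * (B - F) *+ 12 - (A - E) ^+ 2 *+ 4) *+ 2,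
     (- D * C *+ 36 - (A - E) * (B - F) *+ 4) *+ 2,
     ((A - E) * C *+ 12 - (B - F) ^+ 2 *+ 4) *+ 2) in
   m0 * S a01 *+ 4 - m1 * (S a10 - S b01) *+ 2 + m2 * (- S b10) *+ 4)%:MP.
Proof. by rewrite /kappa1 MformE C1E transvectant2_bquad. Qed.

Lemma K1formE : K1form S = bcubic (S a10 * D - A * S b10)
  (S a10 * E + S a01 * D - A * S b01 - B * S b10)
  (S a10 * F + S a01 * E - B * S b01 - C * S b10)
  (S a01 * F - C * S b01).
Proof.
rewrite /K1form p1E q1E p2E q2E /blin /bquad /bcubic.
by rewrite !(mpolyCB, mpolyCD, mpolyCM); ring.
Qed.

End Comitants.

Definition conicP (A : comNzRingType) (S : qsys A) : conic A :=
  Conic (S a20) (S a11 *+ 2) (S a02) (S a10) (S a01) (S a00).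
Definition conicQ (A : comNzRingType) (S : qsys A) : conic A :=
  Conic (S b20) (S b11 *+ 2) (S b02) (S b10) (S b01) (S b00).

Section Homogenization.
Variables (A : comNzRingType) (S : qsys A).

Lemma homogenize2_conic (a b c d e f : A) :
  homogenize2 f%:MP (d *: vx A + e *: vy A)
    (a *: vx A ^+ 2 + b *: (vx A * vy A) + c *: vy A ^+ 2) =
  cpoly (Conic a b c d e f).
Proof.
rewrite /homogenize2 /cpoly /cval /vx /vy /= !expr2 comp_mpolyC.
rewrite !comp_mpolyD !comp_mpolyZ !rmorphM /= !comp_mpolyXU /=.
by rewrite -!mul_mpolyC; ring.
Qed.

Lemma bigPE : bigP S = cpoly (conicP S).
Proof. exact: homogenize2_conic. Qed.

Lemma bigQE : bigQ S = cpoly (conicQ S).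
Proof. exact: homogenize2_conic. Qed.

End Homogenization.

Section Complexify.
Variable R : realType.
Implicit Types G : conic R.

Definition ccx G : conic R[i] := cmap (real_complex R) G.

Lemma complexify_cpoly G : complexify (cpoly G) = cpoly (ccx G).
Proof.
rewrite /complexify /cpoly /cval /= !expr2 !rmorphD !rmorphM /= !map_mpolyC /=.
by rewrite !map_mpolyX.
Qed.

End Complexify.

(** * The polynomials mu_i as coefficients of the resultant *)

Section MuResultant.
Variable R : realType.
Local Notation Ra := {mpoly R[12]}.
Local Notation W := {mpoly Ra[2]}.
Implicit Types (F G : Ra) (U V : W).

Lemma L1_zmod : zmod_morphism (@L1 R).
Proof.
move=> F G; rewrite /L1 !mderivB.
rewrite -!mul_mpolyC; ring.
Qed.

Lemma L2_zmod : zmod_morphism (@L2 R).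
Proof. by move=> F G; rewrite /L2 !mderivB -!mul_mpolyC; ring. Qed.

HB.instance Definition _ := GRing.isZmodMorphism.Build Ra Ra (@L1 R) L1_zmod.
HB.instance Definition _ := GRing.isZmodMorphism.Build Ra Ra (@L2 R) L2_zmod.

Lemma L1_leibniz F G : L1 (F * G) = L1 F * G + F * L1 G.
Proof. by rewrite /L1 !mderivM -!mul_mpolyC; ring. Qed.
Lemma L2_leibniz F G : L2 (F * G) = L2 F * G + F * L2 G.
Proof. by rewrite /L2 !mderivM -!mul_mpolyC; ring. Qed.

Let l1 : {additive Ra -> Ra} := @L1 R.
Let l2 : {additive Ra -> Ra} := @L2 R.

Lemma calLD U V : calL (U + V) = calL U + calL V.
Proof.
have h (l : {additive Ra -> Ra}) : map_mpoly l (U + V) = map_mpoly l U + map_mpoly l V.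
  exact: raddfD.
by rewrite /calL (h l1) (h l2) !mulrDr opprD addrACA.
Qed.

Lemma calL0 : calL 0 = 0 :> W.
Proof.
have h (l : {additive Ra -> Ra}) : map_mpoly l 0 = 0 :> W by exact: raddf0.
by rewrite /calL (h l1) (h l2) !mulr0 subrr.
Qed.

Lemma calLM U V : calL (U * V) = calL U * V + U * calL V.
Proof.
have gen (A : comNzRingType) (x y a b c d u v : A) : x * (a * v + u * b) - y * (c * v + u * d) =
    (x * a - y * c) * v + u * (x * b - y * d) by ring.
rewrite /calL (@map_mpoly_leibniz _ _ l1 L1_leibniz U V).
rewrite (@map_mpoly_leibniz _ _ l2 L2_leibniz U V).
exact: gen.
Qed.

Lemma calLC F : calL F%:MP = vx Ra * (L2 F)%:MP - vy Ra * (L1 F)%:MP.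
Proof. by rewrite /calL (@map_mpolyC _ _ _ l1) (@map_mpolyC _ _ _ l2). Qed.

Lemma mderivX12 (i j : 'I_12) : ('X_j : Ra)^`M(i) = (i == j)%:R.
Proof.
rewrite mderivX mnm1E eq_sym; case: eqP => [->|_]; last by rewrite scale0r.
rewrite scale1r (_ : (U_(j) - U_(j))%MM = 0%MM) ?mpolyX0 //.
by apply/mnmP => k; rewrite mnmBE subnn mnm0E.
Qed.

Lemma L1_var (j : 'I_12) : L1 ('X_j : Ra) =
  'X_a00 * (a10 == j)%:R *+ 2 + 'X_a10 * (a20 == j)%:R
  + (2%:R^-1 : R) *: ('X_a01 * (a11 == j)%:R)
  + 'X_b00 * (b10 == j)%:R *+ 2 + 'X_b10 * (b20 == j)%:R
  + (2%:R^-1 : R) *: ('X_b01 * (b11 == j)%:R).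
Proof. by rewrite /L1 !mderivX12. Qed.

Lemma L2_var (j : 'I_12) : L2 ('X_j : Ra) =
  'X_a00 * (a01 == j)%:R *+ 2 + 'X_a01 * (a02 == j)%:R
  + (2%:R^-1 : R) *: ('X_a10 * (a11 == j)%:R)
  + 'X_b00 * (b01 == j)%:R *+ 2 + 'X_b01 * (b02 == j)%:R
  + (2%:R^-1 : R) *: ('X_b10 * (b11 == j)%:R).
Proof. by rewrite /L2 !mderivX12. Qed.

Lemma calL_var (j : 'I_2) : calL 'X_j = 0 :> W.
Proof.
have L10 : L1 (1 : Ra) = 0.
  by rewrite /L1 -mpolyC1 !mderivC !mulr0 !mul0rn scaler0 !addr0.
have L20 : L2 (1 : Ra) = 0.
  by rewrite /L2 -mpolyC1 !mderivC !mulr0 !mul0rn scaler0 !addr0.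
have mapX (f : {additive Ra -> Ra}) : f 1 = 0 -> map_mpoly f 'X_j = 0 :> W.
  move=> f1; apply/mpolyP => m; rewrite mcoeff_map_mpoly mcoeffX mcoeff0.
  by case: eqP => _; rewrite ?f1 ?raddf0.
by rewrite /calL (mapX _ L10) (mapX _ L20) !mulr0 subrr.
Qed.

Lemma half2 (F : Ra) : (2%:R^-1 : R) *: F *+ 2 = F.
Proof. by rewrite -scaler_nat scalerA divff ?pnatr_eq0 // scale1r. Qed.

Definition gconic (G : conic Ra) : conic W := cmap (@mpolyC 2 _) G.

(** The halves in [L1] and [L2] are cancelled by the factor 2 in the coefficient [c11]. *)
Lemma calL_coef (G : conic Ra) (x := vx Ra) (y := vy Ra) :
  G = conicP (@generic R) \/ G = conicQ (@generic R) ->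
  [/\ calL (c00 G)%:MP = 0, calL (c10 G)%:MP = - (y * (c00 G)%:MP *+ 2),
      calL (c01 G)%:MP = x * (c00 G)%:MP *+ 2
    & [/\ calL (c20 G)%:MP = - (y * (c10 G)%:MP),
          calL (c11 G)%:MP = x * (c10 G)%:MP - y * (c01 G)%:MP
        & calL (c02 G)%:MP = x * (c01 G)%:MP]].
Proof.
have h1 (F : Ra) : L1 (F *+ 2) = L1 F *+ 2 := raddfMn l1 2 F.
have h2 (F : Ra) : L2 (F *+ 2) = L2 F *+ 2 := raddfMn l2 2 F.
by move=> HG; split; last split; case: HG => ->;
  rewrite /= calLC /generic ?h1 ?h2 L1_var L2_var /=;
  rewrite !(mulr0, mulr1, scaler0, mul0rn, addr0, add0r, mpolyC0, subr0, sub0r,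
            oppr0, mpolyCMn, mulrnAr) //; rewrite ?mulr1n -!mulrnAr -!mpolyCMn !half2.
Qed.

Definition grho : {poly W} :=
  rho (gconic (conicP (@generic R))) (gconic (conicQ (@generic R))) (vx Ra) (vy Ra).

Lemma flow_grho : flow (@calL R) grho.
Proof.
apply: (flow_rho calLD calLM (calL_var _) (calL_var _)) => H HG.
have [G GH HE] : exists2 G, G = conicP (@generic R) \/ G = conicQ (@generic R)
    & H = gconic G.
  by case: HG => ->; [exists (conicP (@generic R)) | exists (conicQ (@generic R))];
    by [left | right | ].
by rewrite HE; exact: calL_coef.
Qed.

(** K has coefficients 2 k0, 4 k1, 2 k2 in the minors of the quadratic parts, so its discriminant is
    16 (k1^2 - k0 k2), that is 16 times the resultant. *)
Lemma grho0 : grho`_0 = (mu0_gen R)%:MP.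
Proof.
rewrite /grho rho_coef0 /res2 expr2 /gconic /cmap /=.
rewrite -!mpolyCM -!mpolyCB -!mpolyCM -mpolyCB; congr _%:MP.
rewrite /mu0_gen KformE discrim2_bquad /generic.
apply: (scalerI (_ : 16%:R != 0 :> R)); first by rewrite pnatr_eq0.
rewrite scalerA divff ?pnatr_eq0 // scale1r scaler_nat /=; ring.
Qed.

Definition evalW (S : qsys R) (x y : R) (U : W) : R :=
  (map_mpoly (meval S) U).@[fun i : 'I_2 => nth 0 [:: x; y] i].

Lemma evalW_zmod S x y : zmod_morphism (evalW S x y).
Proof. by move=> U V; rewrite /evalW raddfB /= mevalB. Qed.
Lemma evalW_monoid S x y : monoid_morphism (evalW S x y).
Proof. by split=> [|U V]; rewrite /evalW ?rmorph1 ?meval1 // rmorphM /= mevalM. Qed.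
HB.instance Definition _ S x y :=
  GRing.isZmodMorphism.Build W R (evalW S x y) (evalW_zmod S x y).
HB.instance Definition _ S x y :=
  GRing.isMonoidMorphism.Build W R (evalW S x y) (evalW_monoid S x y).

(** The derivation acts on polynomials in the coefficients, so the flow is followed on the generic
    system and only its outcome is evaluated at S; the factorial of [mu_gen] cancels that of
    [flow_iter]. *)
Lemma mu_rho (S : qsys R) (x y : R) (i : nat) :
  (mu S i).@[fun j : 'I_2 => nth 0 [:: x; y] j] = (rho (conicP S) (conicQ S) x y)`_i.
Proof.
have evC F : evalW S x y F%:MP = F.@[S] by rewrite /evalW map_mpolyC mevalC.
have <- : map_poly (evalW S x y) grho = rho (conicP S) (conicQ S) x y.
  rewrite rho_map; congr (rho _ _ _ _).
  - by rewrite /gconic /cmap /= !evC /generic /= !mevalMn !mevalXU.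
  - by rewrite /gconic /cmap /= !evC /generic /= !mevalMn !mevalXU.
  - by rewrite /= /evalW /vx /vy map_mpolyX mevalXU.
  - by rewrite /= /evalW /vx /vy map_mpolyX mevalXU.
rewrite coef_map /= -[LHS]/(evalW S x y (mu_gen R i)) /mu_gen.
rewrite -grho0 (flow_iter _ calLD _ flow_grho).
  rewrite -mul_mpolyC rmorphM rmorphMn /= evC mevalC mulrnAr -mulrnAl -[_ *+ _]mulr_natl.
  by rewrite divff ?mul1r // pnatr_eq0 -lt0n fact_gt0.
exact: calL0.
Qed.

End MuResultant.

(** * Intersection numbers at infinity *)

Section Vanishing.

Lemma poly_nat_roots (D : idomainType) (p : {poly D}) :
  injective (fun n : nat => n%:R : D) -> (forall n : nat, p.[n%:R] = 0) -> p = 0.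
Proof.
move=> inj p0; apply/eqP; apply: contraT => pn0.
pose rs : seq D := [seq n%:R | n <- iota 0 (size p)].
have := max_poly_roots pn0 (_ : all (root p) rs) (_ : uniq rs).
rewrite size_map size_iota ltnn => -> //.
  by apply/allP => _ /mapP[n _ ->]; apply/rootP.
by rewrite map_inj_uniq ?iota_uniq.
Qed.

Lemma natr_inj (K : numDomainType) : injective (fun n : nat => n%:R : K).
Proof. by move=> m n /eqP; rewrite eqr_nat => /eqP. Qed.

Lemma polyC_natr_inj (K : numDomainType) : injective (fun n : nat => n%:R : {poly K}).
Proof. by move=> m n; rewrite -!polyC_natr => /polyC_inj/natr_inj. Qed.

(** The polynomial is read in K[y][x], and both variables are specialised to natural numbers. *)
Lemma mpoly2_eq0 (K : numDomainType) (p : {mpoly K[2]}) :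
  (forall x y, p.@[fun j : 'I_2 => nth 0 [:: x; y] j] = 0) -> p = 0.
Proof.
move=> p0.
pose phi (p : {mpoly K[2]}) : {poly {poly K}} :=
  \sum_(m <- msupp p) (p@_m *: 'X^(m iy)) *: 'X^(m ix).
have phi_ev x y : (phi p).[x%:P].[y] = 0.
  rewrite -(p0 x y) mevalE /phi !horner_sum; apply: eq_bigr => m _.
  rewrite !(hornerZ, hornerXn, hornerM, horner_exp, hornerC) big_ord_recl big_ord1 /=.
  rewrite -mulrA; congr (_ * _); rewrite mulrC; congr (_ ^+ m _ * _ ^+ m _); exact: val_inj.
have {}phi_ev : phi p = 0.
  apply: (poly_nat_roots (@polyC_natr_inj K)) => m.
  apply: (poly_nat_roots (@natr_inj K)) => n; rewrite -polyC_natr; exact: phi_ev.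
apply/mpolyP => m; rewrite mcoeff0.
have : (phi p)`_(m ix)`_(m iy) = p@_m; last by rewrite phi_ev !coef0.
have -> : p@_m = \sum_(k <- msupp p) p@_k * (k == m)%:R.
  by rewrite {1}[p]mpolyE raddf_sum /=; apply: eq_bigr => k _; rewrite mcoeffZ mcoeffX.
rewrite /phi coef_sum coef_sum; apply: eq_bigr => k _; rewrite coefZ coefXn.
have -> : (k == m) = (m ix == k ix) && (m iy == k iy).
  apply/eqP/andP => [->//|[/eqP hx /eqP hy]]; apply/mnmP => -[[|[|//]] Hi].
    by rewrite (_ : Ordinal Hi = ix) //; apply: val_inj.
  by rewrite (_ : Ordinal Hi = iy) //; apply: val_inj.
case: (m ix == k ix) => /=; last by rewrite mulr0 coef0 mulr0.
by rewrite mulr1 coefZ coefXn.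
Qed.

(** Leading coefficients of [rho] are products of linear forms in (x, y); a single point (1, n)
    shows that such a product is not identically zero. *)
Lemma linear_forms_nonzero (K : numFieldType) (fs : seq (K * K)) :
  all (fun f => f != 0) fs ->
  exists n : nat, all (fun f => f.1 + f.2 * n%:R != 0) fs.
Proof.
move=> fs0; pose q := \prod_(f <- fs) (f.1%:P + f.2%:P * 'X).
have q0 : q != 0.
  rewrite prodf_seq_neq0; apply: sub_all fs0 => -[a b] /=.
  apply: contraNneq => ab0.
  have h i : (a%:P + b%:P * 'X)`_i = 0 by rewrite ab0 coef0.
  move: (h 0%N) (h 1%N); rewrite !coefD !coefC !coefCM !coefX /=.
  by rewrite mulr0 mulr1 addr0 add0r => -> ->.
have [n qn] : exists n : nat, q.[n%:R] != 0.
  apply: contrapT => /forallNP h; case/negP: q0; apply/eqP.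
  apply: (poly_nat_roots (@natr_inj K)) => n.
  by apply/eqP; apply: contraT => hn; case: (h n).
exists n; move: qn; rewrite horner_prod prodf_seq_neq0.
by apply: sub_all => f /=; rewrite !hornerE.
Qed.

End Vanishing.

Section FirstMu.
Variable R : realType.
Local Notation CC := R[i].
Local Notation "x %:C" := (real_complex R x).
Implicit Types (S : qsys R).

Lemma mu_eq0 S i : (forall x y, (rho (conicP S) (conicQ S) x y)`_i = 0) -> mu S i = 0.
Proof. by move=> h; apply: mpoly2_eq0 => x y; rewrite mu_rho. Qed.

(** F = c2 P - c1 Q will be the degenerate member and G = c1 P + c2 Q its companion. The determinant
    c1^2 + c2^2 is nonzero for every nonzero real pair, so it does not matter which of c1, c2
    vanishes. *)
Definition pencilF S (c1 c2 : R) := cpencil c2 (- c1) (conicP S) (conicQ S).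
Definition pencilG S (c1 c2 : R) := cpencil c1 c2 (conicP S) (conicQ S).

Lemma pencil_det (c1 c2 : R) : (c1 != 0) || (c2 != 0) ->
  (c2 * c2 - - c1 * c1) != 0.
Proof.
rewrite mulNr opprK -!expr2 addrC paddr_eq0 ?sqr_ge0 // !sqrf_eq0.
by case/orP => h; rewrite negb_and h // orbT.
Qed.

(* The pencil of conics spanned by P and Q determines both the mu_i, up to a
   nonzero factor, and the intersection numbers. *)
Lemma mu_first_pencil S (c1 c2 : R) k (g : R -> R -> CC) :
  (c1 != 0) || (c2 != 0) ->
  (forall x y, exists E, rho (ccx (pencilF S c1 c2)) (ccx (pencilG S c1 c2)) x%:C y%:C =
     'X^k * ((g x y)%:P + 'X * E)) ->
  (exists n : nat, g 1 n%:R != 0) -> mu_first S k.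
Proof.
move=> c0 hrho [n gn].
have rhoE x y : map_poly (real_complex R)
    (rho (conicP S) (conicQ S) x y) * ((c2 * c2 - - c1 * c1) ^+ 2)%:C%:P =
    rho (ccx (pencilF S c1 c2)) (ccx (pencilG S c1 c2)) x%:C y%:C.
  rewrite /ccx -rho_map /pencilF /pencilG rho_pencil [RHS]rmorphM mulrC.
  by congr (_ * _); rewrite [RHS]map_polyC.
have d0 : ((c2 * c2 - - c1 * c1) ^+ 2)%:C != 0.
  by rewrite fmorph_eq0 expf_neq0 // pencil_det.
have coefE x y i : ((rho (conicP S) (conicQ S) x y)`_i == 0) =
    ((rho (ccx (pencilF S c1 c2)) (ccx (pencilG S c1 c2)) x%:C y%:C)`_i == 0).
  by rewrite -rhoE coefMC mulf_eq0 (negbTE d0) orbF coef_map fmorph_eq0.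
split=> [i ik|]; last first.
  apply: contra_neq gn => mu0; have := mu_rho S 1 n%:R k; rewrite mu0 meval0.
  move/esym/eqP; rewrite coefE; have [E ->] := hrho 1 n%:R.
  by rewrite coefXnM ltnn subnn coefD coefC coefXM /= addr0 => /eqP.
apply: mu_eq0 => x y; apply/eqP; rewrite coefE; have [E ->] := hrho x y.
by rewrite coefXnM ik.
Qed.

Lemma IPQ_pencil S (c1 c2 : R) w n : (c1 != 0) || (c2 != 0) ->
  local_mult w (cpoly (ccx (pencilF S c1 c2))) (cpoly (ccx (pencilG S c1 c2))) n ->
  IPQ S w = n.
Proof.
move=> c0 hn; rewrite /IPQ bigPE bigQE !complexify_cpoly.
apply: (intersection_multP (cpoly_homog _) (cpoly_homog _)).
have E (a b : R) F G : ccx (cpencil a b F G) = cpencil a%:C b%:C (ccx F) (ccx G).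
  by rewrite /ccx /cmap /cpencil /= !rmorphD !rmorphM.
move: hn; rewrite !E !cpoly_pencil; apply: local_mult_pencil.
by rewrite -!rmorphM -rmorphB fmorph_eq0 pencil_det.
Qed.

End FirstMu.

Section CommonLines.
Variable R : realType.
Local Notation CC := R[i].
Local Notation "x %:C" := (real_complex R x).
Local Notation poly3 := {mpoly CC[3]}.
Implicit Types (S : qsys R).

(** As D has real coefficients, the coefficientwise real part of q is again a cofactor. *)
Lemma real_factor (p D : {mpoly R[3]}) (q : poly3) :
  complexify p = complexify D * q -> exists q', p = D * q'.
Proof.
move=> pDq; exists (map_mpoly (@complex.Re R) q).
apply/mpolyP => m; have := congr1 (fun p => complex.Re p@_m) pDq.
rewrite /complexify mcoeff_map_mpoly /= => ->.
rewrite !mcoeffM raddf_sum /=; apply: eq_bigr => k _.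
by rewrite !mcoeff_map_mpoly /=; case: (q@_(k.2)) => u v /=; rewrite mul0r subr0.
Qed.

Lemma complexify_linform (a b d : R) :
  complexify (linform a b d) = linform a%:C b%:C d%:C.
Proof.
rewrite /complexify /linform !rmorphD !rmorphM /= !map_mpolyC /=.
by rewrite !map_mpolyX.
Qed.

Lemma coprime_no_common_line S (c1 c2 : R) (a b d : R) (A B : poly3) :
  coprime_PQ S -> (c1 != 0) || (c2 != 0) ->
  cpoly (ccx (pencilF S c1 c2)) = linform a%:C b%:C d%:C * A ->
  cpoly (ccx (pencilG S c1 c2)) = linform a%:C b%:C d%:C * B -> False.
Proof.
move=> cop c0; rewrite -!complexify_cpoly -!complexify_linform.
move=> /real_factor[A' FA] /real_factor[B' GB].
pose n := (c2 * c2 - - c1 * c1)^-1; have n0 := pencil_det c0.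
have nE : n * (c2 * c2 + c1 * c1) = 1 by rewrite /n mulNr opprK mulVf // -[c1 * c1]opprK -mulNr.
have [P Q] : bigP S = linform a b d * (n%:MP * (c2%:MP * A' + c1%:MP * B')) /\
    bigQ S = linform a b d * (n%:MP * (c2%:MP * B' - c1%:MP * A')).
  have nE' : n%:MP_[3] * (c2%:MP * c2%:MP + c1%:MP * c1%:MP) = 1.
    by rewrite -!mpolyCM -mpolyCD -mpolyCM nE.
  rewrite bigPE bigQE; split.
    rewrite -[LHS]mul1r -nE'.
    transitivity (n%:MP * (c2%:MP * cpoly (pencilF S c1 c2) + c1%:MP * cpoly (pencilG S c1 c2))).
      by rewrite !cpoly_pencil mpolyCN; ring.
    by rewrite FA GB; ring.
  rewrite -[LHS]mul1r -nE'.
  transitivity (n%:MP * (c2%:MP * cpoly (pencilG S c1 c2) - c1%:MP * cpoly (pencilF S c1 c2))).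
    by rewrite !cpoly_pencil mpolyCN; ring.
  by rewrite FA GB; ring.
have u := cop _ _ _ P Q.
have e x y z : (linform a b d).@[fun i : 'I_3 => nth 0 [:: x; y; z] i] =
    a * x + b * y + d * z := meval_linform _ _ _ _.
(* A linear form vanishes at the origin of affine 3-space, which no unit does. *)
have := rmorph_unit (meval (fun i : 'I_3 => nth 0 [:: 0; 0; 0 : R] i)) u.
by rewrite /= e !mulr0 !addr0 unitr0.
Qed.

(** If F were zero, P and Q would both be multiples of the quadratic form G, which vanishes at the
    origin and so is not a unit. *)
Lemma coprime_pencilF_neq0 S (c1 c2 : R) :
  coprime_PQ S -> (c1 != 0) || (c2 != 0) ->
  pencilF S c1 c2 <> Conic 0 0 0 0 0 0.
Proof.
move=> cop c0 F0.
pose n := (c2 * c2 - - c1 * c1)^-1; have n0 := pencil_det c0.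
have nE : n * (c2 * c2 + c1 * c1) = 1 by rewrite /n mulNr opprK mulVf // -[c1 * c1]opprK -mulNr.
have nE' : n%:MP_[3] * (c2%:MP * c2%:MP + c1%:MP * c1%:MP) = 1.
  by rewrite -!mpolyCM -mpolyCD -mpolyCM nE.
have FE : cpoly (pencilF S c1 c2) = 0.
  by rewrite F0 /cpoly /cval /= mpolyC0; ring.
have P : bigP S = cpoly (pencilG S c1 c2) * (n%:MP * c1%:MP).
  rewrite bigPE -[LHS]mul1r -nE'.
  transitivity (n%:MP * (c2%:MP * cpoly (pencilF S c1 c2) + c1%:MP * cpoly (pencilG S c1 c2))).
    by rewrite !cpoly_pencil mpolyCN; ring.
  by rewrite FE; ring.
have Q : bigQ S = cpoly (pencilG S c1 c2) * (n%:MP * c2%:MP).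
  rewrite bigQE -[LHS]mul1r -nE'.
  transitivity (n%:MP * (c2%:MP * cpoly (pencilG S c1 c2) - c1%:MP * cpoly (pencilF S c1 c2))).
    by rewrite !cpoly_pencil mpolyCN; ring.
  by rewrite FE; ring.
have u := cop _ _ _ P Q.
have := rmorph_unit (meval (fun i : 'I_3 => nth 0 [:: 0; 0; 0 : R] i)) u.
by rewrite /= meval_cpoly /cval /= !(mulr0, expr2, mul0r, addr0) unitr0.
Qed.

End CommonLines.

Section JetOfRho.
Variable A : comNzRingType.
Implicit Types F G : conic A.

Lemma rho_coef1 F G x y :
  let a := c20 F in let b := c11 F in let c := c02 F in
  let d := c20 G in let e := c11 G in let f := c02 G in
  let a' := - (c10 F * y) in let b' := c10 F * x - c01 F * y in let c' := c01 F * x in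
  let d' := - (c10 G * y) in let e' := c10 G * x - c01 G * y in let f' := c01 G * x in
  (rho F G x y)`_1 = (a * f - c * d) * (a' * f + a * f' - c' * d - c * d') *+ 2
    - (a' * e + a * e' - b' * d - b * d') * (b * f - c * e)
    - (a * e - b * d) * (b' * f + b * f' - c' * e - c * e').
Proof.
move=> a b c d e f a' b' c' d' e' f'.
have e20 H : (cut20 H x y)`_0 = c20 H.
  by rewrite /cut20 !coefD coefN coefC coefMX coefCM coefXn /= oppr0 mulr0 !addr0.
have e11 H : (cut11 H x y)`_0 = c11 H.
  by rewrite /cut11 !coefD coefN coefC coefMX coefCM coefXn /= mulr0 oppr0 !addr0.
have e02 H : (cut02 H x y)`_0 = c02 H.
  by rewrite /cut02 !coefD coefC coefMX coefCM coefXn /= mulr0 !addr0.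
have f20 H : (cut20 H x y)`_1 = - (c10 H * y).
  by rewrite /cut20 !coefD coefN coefC coefMX coefC coefCM coefXn /= mulr0 addr0 add0r.
have f11 H : (cut11 H x y)`_1 = c10 H * x - c01 H * y.
  by rewrite /cut11 !coefD coefN coefC coefMX coefC coefCM coefXn /= mulr0 oppr0 addr0 add0r.
have f02 H : (cut02 H x y)`_1 = c01 H * x.
  by rewrite /cut02 !coefD coefC coefMX coefC coefCM coefXn /= mulr0 addr0 add0r.
have coef1M (p q : {poly A}) : (p * q)`_1 = p`_0 * q`_1 + p`_1 * q`_0.
  by rewrite coefM big_ord_recl big_ord1.
have res1 (p q r s t u : {poly A}) : (res2 p q r s t u)`_1 =
    (p`_0 * u`_0 - r`_0 * s`_0) * (p`_1 * u`_0 + p`_0 * u`_1 - r`_1 * s`_0 - r`_0 * s`_1) *+ 2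
    - (p`_1 * t`_0 + p`_0 * t`_1 - q`_1 * s`_0 - q`_0 * s`_1) * (q`_0 * u`_0 - r`_0 * t`_0)
    - (p`_0 * t`_0 - q`_0 * s`_0) * (q`_1 * u`_0 + q`_0 * u`_1 - r`_1 * t`_0 - r`_0 * t`_1).
  by rewrite /res2 expr2 !(coefB, coef1M, coef0M); ring.
by rewrite /rho res1 !e20 !e11 !e02 !f20 !f11 !f02.
Qed.

Lemma poly_jet (p : {poly A}) c : p`_0 = 0 -> p`_1 = c ->
  exists E, p = 'X ^+ 1 * (c%:P + 'X * E).
Proof.
move=> h0 h1; exists (\poly_(i < size p) p`_i.+2); apply/polyP => -[|[|i]].
- by rewrite expr1 coefXM.
- by rewrite expr1 coefXM /= coefD coefC coefXM /= addr0.
rewrite expr1 coefXM /= coefD coefC coefXM /= add0r coef_poly.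
by case: ltnP => // le; rewrite nth_default // (leq_trans le) // -addn2 leq_addr.
Qed.

Lemma cval_inf F x y :
  cval F x y 0 = c20 F * x ^+ 2 + c11 F * x * y + c02 F * y ^+ 2.
Proof. by rewrite /cval; ring. Qed.

Lemma res2_map (B : comNzRingType) (h : {rmorphism A -> B}) a b c d e f :
  h (res2 a b c d e f) = res2 (h a) (h b) (h c) (h d) (h e) (h f).
Proof. by rewrite /res2 !(rmorphB, rmorphM, rmorphXn). Qed.

End JetOfRho.

Section IntersectionAtInfinity.
Variable R : realType.
Local Notation CC := R[i].
Local Notation "x %:C" := (real_complex R x).
Local Notation poly3 := {mpoly CC[3]}.
Implicit Types (S : qsys R) (r s : CC * CC).

(** The list repeats each common point at infinity as often as its multiplicity, so that divisors
    can be compared as lists up to permutation. *)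
Definition IPQ_roots S (ss : seq (CC * CC)) : Prop :=
  all (fun r => r != 0) ss /\
  forall w, at_infinity w -> IPQ S w = count (fun r => w == pt r) ss.

(** Eliminating y^2, respectively x^2, and dividing by x, respectively y, leaves two linear
    relations on (x, y) whose determinant is [res2]. The cases x = 0 and y = 0 are direct. *)
Lemma res2_common_root (K : idomainType) (a b c d e f x y : K) :
  a * x ^+ 2 + b * x * y + c * y ^+ 2 = 0 -> d * x ^+ 2 + e * x * y + f * y ^+ 2 = 0 ->
  (x != 0) || (y != 0) -> res2 a b c d e f = 0.
Proof.
move=> h1 h2 xy0.
have e1 : x * ((a * f - c * d) * x + (b * f - c * e) * y) = 0.
  by transitivity (f * (a * x ^+ 2 + b * x * y + c * y ^+ 2)
    - c * (d * x ^+ 2 + e * x * y + f * y ^+ 2)); [ring | rewrite h1 h2; ring].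
have e2 : y * ((a * e - b * d) * x + (a * f - c * d) * y) = 0.
  by transitivity (a * (d * x ^+ 2 + e * x * y + f * y ^+ 2)
    - d * (a * x ^+ 2 + b * x * y + c * y ^+ 2)); [ring | rewrite h1 h2; ring].
have e3 : (a * e - b * d) * x ^+ 2 = (b * f - c * e) * y ^+ 2.
  apply/eqP; rewrite -subr_eq0; apply/eqP.
  by transitivity (e * (a * x ^+ 2 + b * x * y + c * y ^+ 2)
    - b * (d * x ^+ 2 + e * x * y + f * y ^+ 2)); [ring | rewrite h1 h2; ring].
have [x0|x0] := eqVneq x 0.
  have y0 : y != 0 by move: xy0; rewrite x0 eqxx.
  have z t : t * y ^+ 2 = 0 -> t = 0.
    by move/eqP; rewrite mulf_eq0 expf_eq0 (negbTE y0) orbF => /eqP.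
  have c0 : c = 0 by apply: z; rewrite -h1 x0; ring.
  have f0 : f = 0 by apply: z; rewrite -h2 x0; ring.
  by rewrite /res2 c0 f0; ring.
have [y0|y0] := eqVneq y 0.
  have z t : t * x ^+ 2 = 0 -> t = 0.
    by move/eqP; rewrite mulf_eq0 expf_eq0 (negbTE x0) orbF => /eqP.
  have a0 : a = 0 by apply: z; rewrite -h1 y0; ring.
  have d0 : d = 0 by apply: z; rewrite -h2 y0; ring.
  by rewrite /res2 a0 d0; ring.
move/eqP: e1; rewrite mulf_eq0 (negbTE x0) /= => /eqP e1.
move/eqP: e2; rewrite mulf_eq0 (negbTE y0) /= => /eqP e2.
apply/eqP; suff : res2 a b c d e f * x == 0 by rewrite mulf_eq0 (negbTE x0) orbF.
apply/eqP; rewrite /res2.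
transitivity ((a * f - c * d) * ((a * f - c * d) * x + (b * f - c * e) * y)
  - (b * f - c * e) * ((a * e - b * d) * x + (a * f - c * d) * y)); first by ring.
by rewrite e1 e2 !mulr0 subrr.
Qed.

Lemma hcoord_inf_neq0 (w : P2 R) : at_infinity w ->
  (hcoord w iX != 0) || (hcoord w iY != 0).
Proof.
move=> winf; have [ii] := hcoord_neq0 w; have := at_infinityP winf.
case: ii => -[|[|[|//]]] Hi hZ hi.
- by rewrite (_ : iX = Ordinal Hi) ?hi //; apply: val_inj.
- by rewrite (_ : iY = Ordinal Hi) ?hi ?orbT //; apply: val_inj.
- by move: hi; rewrite (_ : Ordinal Hi = iZ) ?hZ ?eqxx //; apply: val_inj.
Qed.

Lemma intersection_no_common_root S :
  res2 (S a20) (S a11 *+ 2) (S a02) (S b20) (S b11 *+ 2) (S b02) != 0 ->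
  IPQ_roots S [::] /\ mu_first S 0.
Proof.
move=> res0; split; last first.
  split=> // ; apply: contra_neq res0 => mu0; have := mu_rho S 0 0 0.
  by rewrite mu0 meval0 rho_coef0 => <-.
split=> // w winf; rewrite /IPQ bigPE bigQE !complexify_cpoly /=.
apply: (intersection_multP (cpoly_homog _) (cpoly_homog _)).
have [P0|] := eqVneq ((cpoly (ccx (conicP S))).@[hcoord w]) 0; last first.
  exact/local_mult_unit/cpoly_homog/cpoly_homog.
have [Q0|] := eqVneq ((cpoly (ccx (conicQ S))).@[hcoord w]) 0; last first.
  by move=> Q0; apply/local_multC; apply: local_mult_unit Q0; apply: cpoly_homog.
case/eqP: res0; apply: (fmorph_inj (real_complex R)).
have zeroE G : (cpoly (ccx G)).@[hcoord w] = 0 -> c20 (ccx G) * hcoord w iX ^+ 2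
    + c11 (ccx G) * hcoord w iX * hcoord w iY + c02 (ccx G) * hcoord w iY ^+ 2 = 0.
  by rewrite (meval_cpoly (ccx G) (hcoord w)) (at_infinityP winf) (cval_inf (ccx G)).
rewrite res2_map rmorph0.
exact: res2_common_root (zeroE _ P0) (zeroE _ Q0) (hcoord_inf_neq0 winf).
Qed.

End IntersectionAtInfinity.

Lemma jet_mul (A : comNzRingType) (k l : nat) (u v : A) (E F : {poly A}) :
  ('X ^+ k * (u%:P + 'X * E)) * ('X ^+ l * (v%:P + 'X * F)) =
  'X ^+ (k + l) * ((u * v)%:P + 'X * (u%:P * F + v%:P * E + 'X * E * F)).
Proof. by rewrite exprD; ring. Qed.

(** * Degenerate members of the pencil *)

Section DegenerateMembers.
Variable R : realType.
Local Notation CC := R[i].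
Local Notation "x %:C" := (real_complex R x).
Local Notation poly3 := {mpoly CC[3]}.
Implicit Types (S : qsys R) (r s : CC * CC).

Lemma cpoly_ccx (G : conic R) : cpoly (ccx G) =
  (c20 G)%:C%:MP * 'X_iX ^+ 2 + (c11 G)%:C%:MP * 'X_iX * 'X_iY
  + (c02 G)%:C%:MP * 'X_iY ^+ 2 + (c10 G)%:C%:MP * 'X_iX * 'X_iZ
  + (c01 G)%:C%:MP * 'X_iY * 'X_iZ + (c00 G)%:C%:MP * 'X_iZ ^+ 2.
Proof. by []. Qed.

Lemma eq_ptC (a b : CC) r : (a != 0) || (b != 0) -> r != 0 -> r.1 * a + r.2 * b = 0 ->
  pt (- b, a) = pt r.
Proof.
move=> ab r0 h; have ab0 : (- b, a) != 0 :> CC * CC.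
  by rewrite xpair_eqE oppr_eq0 negb_and orbC.
apply/eqP; rewrite eq_pt_pt //= -subr_eq0; apply/eqP.
by transitivity (- (r.1 * a + r.2 * b)); [ring | rewrite h oppr0].
Qed.

(** The exponents k1 and k2 of [conic_line] occur both in the local multiplicities and in the order
    of [rho]; here Delta_S and the index of the first nonzero mu_i become the same number. *)
Lemma local_mult_two_lines (G : conic CC) (a1 b1 d1 a2 b2 d2 : CC) :
  (a1 != 0) || (b1 != 0) -> (a2 != 0) || (b2 != 0) ->
  (forall q, cpoly G <> linform a1 b1 d1 * q) ->
  (forall q, cpoly G <> linform a2 b2 d2 * q) ->
  exists k1 k2 g, [/\ (k1 <= 2)%N /\ (k2 <= 2)%N, g != 0,
    forall w, at_infinity w ->
      local_mult w (cpoly (line_pair a1 b1 d1 a2 b2 d2)) (cpoly G)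
        ((if w == pt (- b1, a1) then k1 else 0)
         + (if w == pt (- b2, a2) then k2 else 0)),
    forall x y, exists E, rho (line_pair a1 b1 d1 a2 b2 d2) G x y =
      'X ^+ (k1 + k2) *
      ((g * ((a1 * x + b1 * y) ^+ k1 * (a2 * x + b2 * y) ^+ k2))%:P + 'X * E)
    & (0 < k1)%N = (cval G (- b1) a1 0 == 0) /\ (0 < k2)%N = (cval G (- b2) a2 0 == 0)].
Proof.
move=> ab1 ab2 n1 n2.
have [[q /n1//]|[k1 [g1 [k1le g10 m1 r1 z1]]]] := conic_line G d1 ab1.
have [[q /n2//]|[k2 [g2 [k2le g20 m2 r2 z2]]]] := conic_line G d2 ab2.
exists k1, k2, (g1 * g2); split => //; first by rewrite mulf_neq0.
- move=> w winf; rewrite cpoly_line_pair.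
  apply: (local_mult_mul (linform_homog _ _ _) (cpoly_homog G) _ n1 (m1 w winf) (m2 w winf)).
  by rewrite orbA ab1.
- move=> x y; have [E1 h1] := r1 x y; have [E2 h2] := r2 x y.
  rewrite rho_line_pair h1 h2 jet_mul mulrACA.
  by exists ((g1 * (a1 * x + b1 * y) ^+ k1)%:P * E2 + (g2 * (a2 * x + b2 * y) ^+ k2)%:P * E1 + 'X * E1 * E2).
Qed.

(* P and Q have a single common point on Z = 0 and are transversal there. *)
Lemma intersection_transversal S (c1 c2 r1 r2 j n1 n2 : R)
    (F := pencilF S c1 c2) (G := pencilG S c1 c2) :
  (c1 != 0) || (c2 != 0) -> (r1 != 0) || (r2 != 0) -> j != 0 ->
  [/\ c20 F = j * r2 ^+ 2, c11 F = - (j * r1 * r2 *+ 2) & c02 F = j * r1 ^+ 2] ->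
  [/\ c20 G = r2 * n1, c11 G = r2 * n2 - r1 * n1 & c02 G = - (r1 * n2)] ->
  n1 * r1 + n2 * r2 != 0 -> c10 F * r1 + c01 F * r2 != 0 ->
  IPQ_roots S [:: (r1%:C, r2%:C)] /\ mu_first S 1.
Proof.
move=> c0 r0 j0 [F20 F11 F02] [G20 G11 G02] nr fr.
have rC0 : (r1%:C, r2%:C) != 0 :> CC * CC.
  by rewrite xpair_eqE negb_and !fmorph_eq0.
split; last first.
  (* The coefficient of t in [rho] is j n(r)^2 (c10 r1 + c01 r2) l(x, y): apart from l(x, y), a
     product of quantities assumed nonzero. *)
  apply: (@mu_first_pencil _ S c1 c2 1%N
    (fun x y => (j * (n1 * r1 + n2 * r2) ^+ 2 * (c10 F * r1 + c01 F * r2)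
      * (r2 * x - r1 * y))%:C) c0).
    move=> x y; rewrite -/F -/G; apply: poly_jet.
      rewrite rho_coef0 -(rmorph0 (real_complex R)) -res2_map; congr _%:C.
      by rewrite F20 F11 F02 G20 G11 G02 /res2; ring.
    rewrite -rho_map coef_map; congr _%:C.
    by rewrite rho_coef1 F20 F11 F02 G20 G11 G02; ring.
  have [|n] := @linear_forms_nonzero R [:: (r2, - r1)].
    by rewrite /= andbT xpair_eqE oppr_eq0 negb_and orbC.
  rewrite /= andbT mulNr => hn; exists n; rewrite fmorph_eq0 mulr1.
  by rewrite !mulf_neq0 ?expf_neq0.
split=> [|w winf]; first by rewrite /= rC0.
apply: (IPQ_pencil c0); rewrite -/F -/G /= addn0.
have hF := cpoly_homog (ccx F); have hG := cpoly_homog (ccx G).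
pose l : poly3 := linform r2%:C (- r1%:C) 0; pose n : poly3 := linform n1%:C n2%:C 0.
pose F1 : poly3 := linform (c10 F)%:C (c01 F)%:C (c00 F)%:C.
pose G1 : poly3 := linform (c10 G)%:C (c01 G)%:C (c00 G)%:C.
have FE : cpoly (ccx F) = j%:C%:MP * l ^+ 2 + 'X_iZ * F1.
  rewrite cpoly_ccx F20 F11 F02 /l /F1 /linform.
  by rewrite mpolyC0; ring.
have GE : cpoly (ccx G) = l * n + 'X_iZ * G1.
  rewrite cpoly_ccx G20 G11 G02 /l /n /G1 /linform.
  by rewrite mpolyC0; ring.
have evl : l.@[hcoord w] = r2%:C * hcoord w iX - r1%:C * hcoord w iY.
  by rewrite meval_linform mul0r addr0 mulNr.
case: (boolP (w == pt (r1%:C, r2%:C))) => [weq|]; last first.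
  rewrite eq_pt //= => ne; apply: (local_mult_unit hF hG).
  rewrite FE mevalD !mevalM mevalC mevalXU (at_infinityP winf) mul0r addr0.
  by rewrite !mulf_neq0 ?fmorph_eq0 // evl.
have [d [d0 hX hY hZ]] := hcoord_pt rC0; rewrite -(eqP weq) /= in hX hY hZ.
have l0 : l.@[hcoord w] = 0 by rewrite evl hX hY; ring.
have hl : l \is 1.-homog := linform_homog _ _ _.
have hn : n \is 1.-homog := linform_homog _ _ _.
have hF1 : F1 \is 1.-homog := linform_homog _ _ _.
have hG1 : G1 \is 1.-homog := linform_homog _ _ _.
have hj : (j%:C%:MP : poly3) \is 0.-homog := mpolyC_homog 3 _.
have n0 : n.@[hcoord w] != 0.
  rewrite meval_linform hX hY mul0r addr0.
  rewrite (_ : _ + _ = d * (n1 * r1 + n2 * r2)%:C); last by rewrite rmorphD !rmorphM /=; ring.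
  by rewrite mulf_neq0 ?fmorph_eq0.
have F10 : F1.@[hcoord w] != 0.
  rewrite meval_linform hX hY hZ mulr0 addr0.
  rewrite (_ : _ + _ = d * (c10 F * r1 + c01 F * r2)%:C); last by rewrite rmorphD !rmorphM /=; ring.
  by rewrite mulf_neq0 ?fmorph_eq0.
(* Write F = (j l) l + F1 Z and G = n l + G1 Z. Up to sign, u1 is the determinant of this system, so
   Cramer's rule puts u1 l and u1 Z in (F, G); the relations used are these multiplied by n. At w,
   where l = 0, both u1 and n are nonzero. *)
pose u1 := n * F1 - j%:C%:MP * l * G1.
have hu1 : u1 \is 2.-homog.
  by apply: dhomogD; [exact: (dhomogM hn hF1) | rewrite dhomogN; exact: (dhomogM (dhomogM hj hl) hG1)].
have u10 : u1.@[hcoord w] != 0.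
  by rewrite mevalB !mevalM l0 !(mulr0, mul0r) subr0 mulf_neq0.
apply: (local_mult_transversal hF hG (dhomogM hu1 hn) (mevalM_neq0 u10 n0)) => //.
- by rewrite FE mevalD !mevalM mevalXU hZ l0; ring.
- by rewrite GE mevalD !mevalM mevalXU hZ l0; ring.
- exists (- (d%:MP * (G1 * n))), (d%:MP * (u1 + j%:C%:MP * l * G1)).
  rewrite FE GE (_ : linform _ _ _ = d%:MP * l).
    by rewrite /u1; move: (j%:C%:MP) (l) (n) (F1) (G1) => J L N F' G'; ring.
  by rewrite /l hX hY /linform !(mpolyCN, mpolyCM) mpolyC0; ring.
- exists (n * n), (- (n * j%:C%:MP * l)).
  by rewrite FE GE /u1; move: (j%:C%:MP) (l) (n) (F1) (G1) => J L N F' G'; ring.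
Qed.

End DegenerateMembers.

Section LinePairs.
Variable R : realType.
Local Notation CC := R[i].
Local Notation "x %:C" := (real_complex R x).
Local Notation poly3 := {mpoly CC[3]}.
Implicit Types (S : qsys R) (r s : CC * CC).

Lemma cval_ccx (G : conic R) (x y z : CC) : cval (ccx G) x y z =
  (c20 G)%:C * x ^+ 2 + (c11 G)%:C * x * y + (c02 G)%:C * y ^+ 2
  + (c10 G)%:C * x * z + (c01 G)%:C * y * z + (c00 G)%:C * z ^+ 2.
Proof. by []. Qed.

(* A line through r = (r1 : r2 : 0) contained in the real conic
   G = (r2 X - r1 Y)(n1 X + n2 Y) + Z (...) is real. *)
Lemma line_in_conic_real (G : conic R) (r1 r2 n1 n2 : R) (T : CC) q :
  (r1 != 0) || (r2 != 0) ->
  [/\ c20 G = r2 * n1, c11 G = r2 * n2 - r1 * n1 & c02 G = - (r1 * n2)] ->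
  n1 * r1 + n2 * r2 != 0 ->
  cpoly (ccx G) = linform r2%:C (- r1%:C) (- T) * q -> exists t : R, T = t%:C.
Proof.
move=> r0 [G20 G11 G02] nr GE.
have N0 : r1 ^+ 2 + r2 ^+ 2 != 0.
  rewrite paddr_eq0 ?sqr_ge0 // !sqrf_eq0.
  by case/orP: r0 => h; rewrite negb_and h // orbT.
(* A vector e with r2 e1 - r1 e2 = 1: the points (u r + T e : 1) run through the affine part of the
   line. *)
pose e1 := r2 / (r1 ^+ 2 + r2 ^+ 2); pose e2 := - r1 / (r1 ^+ 2 + r2 ^+ 2).
have e12 : r2 * e1 - r1 * e2 = 1 by rewrite /e1 /e2; field.
have e12C : r2%:C * e1%:C - r1%:C * e2%:C = 1 by rewrite -!rmorphM -rmorphB e12 rmorph1.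
have ev (u : CC) : cval (ccx G) (u * r1%:C + T * e1%:C) (u * r2%:C + T * e2%:C) 1 = 0.
  have := congr1 (meval (fun k : 'I_3 => nth 0 [:: u * r1%:C + T * e1%:C; u * r2%:C + T * e2%:C; 1] k)) GE.
  rewrite (meval_cpoly (ccx G)) mevalM meval3_linform => ->.
  rewrite (_ : _ + _ + _ = T * (r2%:C * e1%:C - r1%:C * e2%:C) - T); last by ring.
  by rewrite e12C mulr1 subrr mul0r.
have cvalE (x y z : CC) : cval (ccx G) x y z = (r2%:C * x - r1%:C * y) * (n1%:C * x + n2%:C * y)
    + (c10 G)%:C * x * z + (c01 G)%:C * y * z + (c00 G)%:C * z ^+ 2.
  by rewrite cval_ccx G20 G11 G02; ring.
(* Since r is a root of the quadratic part, G is affine in u along the line; comparing u = 1 and u =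
   0 gives its slope, a real linear equation for T. *)
have key : T * (n1 * r1 + n2 * r2)%:C + (c10 G * r1 + c01 G * r2)%:C = 0.
  have E : T * (r2%:C * e1%:C - r1%:C * e2%:C) * (n1%:C * r1%:C + n2%:C * r2%:C)
      + ((c10 G)%:C * r1%:C + (c01 G)%:C * r2%:C) = 0.
    transitivity (cval (ccx G) (1 * r1%:C + T * e1%:C) (1 * r2%:C + T * e2%:C) 1
      - cval (ccx G) (0 * r1%:C + T * e1%:C) (0 * r2%:C + T * e2%:C) 1).
      by rewrite !cvalE; ring.
    by rewrite !ev subrr.
  by rewrite e12C mulr1 in E; rewrite -[RHS]E; ring.
exists (- (c10 G * r1 + c01 G * r2) / (n1 * r1 + n2 * r2)).
have nC : (n1 * r1 + n2 * r2)%:C != 0 by rewrite fmorph_eq0.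
apply: (mulIf nC); rewrite -rmorphM /= divfK // rmorphN; apply/eqP.
by rewrite -subr_eq0 opprK key.
Qed.

(** The linear part of F is f l, so F = j l^2 + f l Z + c00 Z^2 = j (l - T1 Z)(l - T2 Z), a pair of
    lines through r, possibly complex or equal. G passes through r, so each line contributes 1 or
    2. *)
Lemma intersection_line_pair S (c1 c2 r1 r2 j n1 n2 : R)
    (F := pencilF S c1 c2) (G := pencilG S c1 c2) : coprime_PQ S ->
  (c1 != 0) || (c2 != 0) -> (r1 != 0) || (r2 != 0) -> j != 0 ->
  [/\ c20 F = j * r2 ^+ 2, c11 F = - (j * r1 * r2 *+ 2) & c02 F = j * r1 ^+ 2] ->
  [/\ c20 G = r2 * n1, c11 G = r2 * n2 - r1 * n1 & c02 G = - (r1 * n2)] ->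
  n1 * r1 + n2 * r2 != 0 -> c10 F * r1 + c01 F * r2 = 0 ->
  exists m, [/\ (1 < m <= 4)%N, IPQ_roots S (nseq m (r1%:C, r2%:C)) & mu_first S m].
Proof.
move=> cop c0 r0 j0 [F20 F11 F02] hG nr fr; have [G20 G11 G02] := hG.
have N0 : r1 ^+ 2 + r2 ^+ 2 != 0.
  rewrite paddr_eq0 ?sqr_ge0 // !sqrf_eq0.
  by case/orP: r0 => h; rewrite negb_and h // orbT.
pose f := (c10 F * r2 - c01 F * r1) / (r1 ^+ 2 + r2 ^+ 2).
have F10 : c10 F = f * r2.
  apply: (mulIf N0); rewrite /f mulrAC divfK // -[LHS]subr0.
  by rewrite -[0 in LHS](mulr0 r1) -fr; ring.
have F01 : c01 F = - (f * r1).
  apply: (mulIf N0); rewrite /f mulNr mulrAC divfK // -[LHS]subr0.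
  by rewrite -[0 in LHS](mulr0 r2) -fr; ring.
have rC0 : (r1%:C, r2%:C) != 0 :> CC * CC by rewrite xpair_eqE negb_and !fmorph_eq0.
(* The square root is taken in the complex numbers, as the discriminant may be negative. *)
pose dl := sqrtC ((f ^+ 2 - j * c00 F *+ 4)%:C : CC).
have dl2 : dl ^+ 2 = (f ^+ 2 - j * c00 F *+ 4)%:C by rewrite sqrtCK.
have jC : j%:C != 0 by rewrite fmorph_eq0.
pose T1 := (- f%:C + dl) / (j%:C *+ 2); pose T2 := (- f%:C - dl) / (j%:C *+ 2).
have j2 : j%:C *+ 2 != 0 by rewrite mulrn_eq0 negb_or.
have TD : j%:C * (T1 + T2) = - f%:C.
  by rewrite /T1 /T2; field.
have TM : j%:C * (T1 * T2) = (c00 F)%:C.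
  have -> : j%:C * (T1 * T2) = (f%:C ^+ 2 - dl ^+ 2) / (j%:C *+ 4) by rewrite /T1 /T2; field.
  by rewrite dl2; field; exact: jC.
have FE : ccx F = line_pair (j%:C * r2%:C) (- (j%:C * r1%:C)) (- (j%:C * T1))
    r2%:C (- r1%:C) (- T2).
  rewrite /ccx /cmap F20 F11 F02 F10 F01 /line_pair -TM.
  have fM x : (f * x)%:C = - (j%:C * (T1 + T2)) * x%:C.
    by rewrite TD opprK; exact: rmorphM.
  rewrite (_ : (- (f * r1))%:C = - (f * r1)%:C); last exact: rmorphN.
  by rewrite !fM; congr Conic; ring.
have ab1 : (j%:C * r2%:C != 0) || (- (j%:C * r1%:C) != 0).
  by rewrite oppr_eq0 !mulf_eq0 (negbTE jC) /= !fmorph_eq0 orbC.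
have ab2 : (r2%:C != 0) || (- r1%:C != 0) by rewrite oppr_eq0 !fmorph_eq0 orbC.
(* A line common to F and G would be real by [line_in_conic_real], hence a common factor of P and
   Q. *)
have nodiv T T' : (exists c, cpoly (ccx F) = linform r2%:C (- r1%:C) (- T) * c) ->
    T' = T -> forall q, cpoly (ccx G) <> linform r2%:C (- r1%:C) (- T') * q.
  move=> [A FA] -> q GE; have [t Tt] := line_in_conic_real r0 hG nr GE.
  move: FA GE; rewrite Tt -!rmorphN => FA GE.
  exact: (coprime_no_common_line cop c0 FA GE).
have lin1 : linform (j%:C * r2%:C) (- (j%:C * r1%:C)) (- (j%:C * T1)) =
    j%:C%:MP * linform r2%:C (- r1%:C) (- T1) by rewrite /linform; ring.
have nd1 q : cpoly (ccx G) <> linform (j%:C * r2%:C) (- (j%:C * r1%:C)) (- (j%:C * T1)) * q.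
  rewrite lin1 -mulrA mulrCA => GE; apply: (nodiv T1 T1 _ erefl _ GE).
  by exists (j%:C%:MP * linform r2%:C (- r1%:C) (- T2)); rewrite FE cpoly_line_pair lin1; ring.
have nd2 q : cpoly (ccx G) <> linform r2%:C (- r1%:C) (- T2) * q.
  move=> GE; apply: (nodiv T2 T2 _ erefl _ GE).
  by exists (j%:C%:MP * linform r2%:C (- r1%:C) (- T1)); rewrite FE cpoly_line_pair lin1; ring.
have [k1 [k2 [g [[k1le k2le] g0 hm hr [z1 z2]]]]] := local_mult_two_lines ab1 ab2 nd1 nd2.
have G0 (u : CC) : cval (ccx G) (u * r1%:C) (u * r2%:C) 0 = 0.
  by rewrite cval_ccx G20 G11 G02; ring.
have k1p : (0 < k1)%N by rewrite z1 opprK G0.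
have k2p : (0 < k2)%N.
  by rewrite z2 opprK; have := G0 1; rewrite !mul1r => ->.
have pt1 : pt (- - (j%:C * r1%:C), j%:C * r2%:C) = pt (r1%:C, r2%:C).
  by apply: eq_ptC => //=; ring.
have pt2 : pt (- - r1%:C, r2%:C) = pt (r1%:C, r2%:C) by rewrite opprK.
exists (k1 + k2)%N; split.
- by rewrite (leq_add k1p k2p) (leq_add k1le k2le).
- split=> [|w winf]; first by rewrite all_nseq rC0 orbT.
  apply: (IPQ_pencil c0); rewrite -/F -/G count_nseq FE; have := hm w winf.
  by rewrite pt1 pt2; case: eqP => _; rewrite ?mul1n ?mul0n.
- apply: (@mu_first_pencil _ S c1 c2 (k1 + k2)%N (fun x y => g *
    ((j%:C * r2%:C * x%:C + - (j%:C * r1%:C) * y%:C) ^+ k1 * (r2%:C * x%:C + - r1%:C * y%:C) ^+ k2)) c0).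
    by move=> x y; rewrite -/F -/G FE; exact: hr.
  have [|n] := @linear_forms_nonzero CC [:: (r2%:C, - r1%:C)].
    by rewrite /= andbT xpair_eqE negb_and.
  rewrite /= andbT => hn; exists n; rewrite rmorph1 rmorph_nat mulr1 mulr1.
  have -> : j%:C * r2%:C + - (j%:C * r1%:C) * n%:R = j%:C * (r2%:C + - r1%:C * n%:R) by ring.
  by rewrite !mulf_neq0 ?expf_neq0 ?mulf_neq0.
Qed.

End LinePairs.

(** The line d Z = 0 meets the moving line in (x : y : 0), here represented by (- t d x : - t d y :
    0). The resulting t^2 accounts for the two intersections of G with Z = 0. *)
Lemma on_line_inf (K : fieldType) (G : conic K) (d x y : K) : on_line G 0 0 d x y =
  'X ^+ 2 * (d ^+ 2 * cval G x y 0)%:P.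
Proof. by rewrite /on_line /cval /=; ring. Qed.

Section InfinityInPencil.
Variable R : realType.
Local Notation CC := R[i].
Local Notation "x %:C" := (real_complex R x).
Local Notation poly3 := {mpoly CC[3]}.
Implicit Types (S : qsys R) (r s : CC * CC).

Lemma form_neq0 r : r != 0 -> (r.2, - r.1) != 0 :> CC * CC.
Proof. by case: r => a b; rewrite !xpair_eqE oppr_eq0 !negb_and orbC. Qed.

Section Setting.
Variables (S : qsys R) (c1 c2 : R) (e : CC) (s s' : CC * CC).
Let F := pencilF S c1 c2.
Let G := pencilG S c1 c2.
Hypothesis cop : coprime_PQ S.
Hypothesis c0 : (c1 != 0) || (c2 != 0).
Hypothesis HF : [/\ c20 F = 0, c11 F = 0 & c02 F = 0].
Hypothesis e0 : e != 0.
Hypothesis s0 : s != 0.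
Hypothesis s'0 : s' != 0.
Hypothesis HG : [/\ (c20 G)%:C = e * (s.2 * s'.2),
  (c11 G)%:C = - (e * (s.2 * s'.1 + s.1 * s'.2)) & (c02 G)%:C = e * (s.1 * s'.1)].

Lemma local_mult_inf_G (w : P2 R) : at_infinity w ->
  local_mult w 'X_iZ (cpoly (ccx G)) (count (fun r => w == pt r) [:: s; s']).
Proof.
move=> winf; have [G20 G11 G02] := HG.
have GE : cpoly (ccx G) = e%:MP * rootprod [:: s; s']
    + 'X_iZ * linform (c10 G)%:C (c01 G)%:C (c00 G)%:C.
  rewrite cpoly_ccx G20 G11 G02 /rootprod !big_cons big_nil /rootform /linform mpolyC0.
  by rewrite !mpolyCN; ring.
rewrite GE; apply/local_multC/local_mult_inf => //=.
by rewrite s0 s'0.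
Qed.

Lemma ndvd_inf_G q : cpoly (ccx G) <> linform 0 0 1 * q.
Proof.
move=> GE; have [G20 G11 G02] := HG.
have [|n] := @linear_forms_nonzero CC [:: (s.2, - s.1); (s'.2, - s'.1)].
  by rewrite /= !form_neq0.
rewrite /= andbT => /andP[hn hn'].
have := congr1 (meval (fun k : 'I_3 => nth 0 [:: 1; n%:R; 0] k)) GE.
rewrite (meval_cpoly (ccx G)) mevalM meval3_linform.
rewrite (_ : _ + _ + _ = 0 :> CC); last by ring.
rewrite mul0r cval_ccx G20 G11 G02 => /eqP.
rewrite (_ : _ + _ = e * ((s.2 + - s.1 * n%:R) * (s'.2 + - s'.1 * n%:R))).
  by rewrite !mulf_eq0 (negbTE e0) (negbTE hn) (negbTE hn').
by rewrite [nat_of_ord iX]/= [nat_of_ord iY]/= [nat_of_ord iZ]/= [nth _ _ _]/=; ring.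
Qed.

Lemma on_line_inf_G (x y : CC) : exists E, on_line (ccx G) 0 0 1 x y =
  'X ^+ 2 * ((e * ((s.2 * x - s.1 * y) * (s'.2 * x - s'.1 * y)))%:P + 'X * E).
Proof.
exists 0; have [G20 G11 G02] := HG.
rewrite on_line_inf mulr0 addr0; congr (_ * _%:P).
by rewrite cval_ccx G20 G11 G02; ring.
Qed.

(** F is Z times a line. The factor Z contributes the two roots of the quadratic part of G, and the
    other line contributes k at its point at infinity, where k > 0 exactly if that point is one of
    these roots. *)
Lemma intersection_inf_line : (c10 F != 0) || (c01 F != 0) ->
  exists k, [/\ (k <= 2)%N,
    IPQ_roots S (s :: s' :: nseq k (- (c01 F)%:C, (c10 F)%:C)), mu_first S (2 + k)
  & (0 < k)%N = (c20 G * c01 F ^+ 2 - c11 G * c01 F * c10 F + c02 G * c10 F ^+ 2 == 0)].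
Proof.
move=> ab; have [F20 F11 F02] := HF; have [G20 G11 G02] := HG.
set a := c10 F in ab *; set b := c01 F in ab *.
have abC : (a%:C != 0) || (b%:C != 0) by rewrite !fmorph_eq0.
have FE : ccx F = line_pair 0 0 1 a%:C b%:C (c00 F)%:C.
  rewrite /ccx /cmap F20 F11 F02 -/a -/b /line_pair rmorph0.
  by congr Conic; ring.
have FEp : cpoly (ccx F) = linform 0 0 1 * linform a%:C b%:C (c00 F)%:C.
  by rewrite FE cpoly_line_pair.
have nd q : cpoly (ccx G) <> linform a%:C b%:C (c00 F)%:C * q.
  move=> GE; apply: (coprime_no_common_line cop c0 _ GE).
  by rewrite -/F FEp mulrC.
have [[q /nd//]|[k [g [kle g0 hm hr hk]]]] := conic_line (ccx G) (c00 F)%:C abC.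
exists k; split => //.
- split=> [|w winf].
    rewrite /= s0 s'0 /= all_nseq; apply/orP; right.
    by rewrite xpair_eqE oppr_eq0 negb_and orbC.
  apply: (IPQ_pencil c0); rewrite -/F -/G FEp.
  rewrite -[s :: _]/([:: s; s'] ++ _) count_cat count_nseq.
  have mulb (b0 : bool) : (b0 * k = if b0 then k else 0)%N by case: b0; rewrite ?mul1n.
  rewrite mulb.
  apply: (local_mult_mul (linform_homog _ _ _) (cpoly_homog (ccx G)) _ ndvd_inf_G).
  + by rewrite oner_eq0 !orbT.
  + by have := local_mult_inf_G winf; rewrite {1}XiZE.
  + exact: hm.
- apply: (@mu_first_pencil _ S c1 c2 (2 + k)%N (fun x y =>
    e * ((s.2 * x%:C - s.1 * y%:C) * (s'.2 * x%:C - s'.1 * y%:C))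
    * (g * (a%:C * x%:C + b%:C * y%:C) ^+ k)) c0).
    move=> x y; rewrite -/F -/G FE rho_line_pair.
    have [E1 ->] := on_line_inf_G x%:C y%:C; have [E2 ->] := hr x%:C y%:C.
    by rewrite jet_mul; eexists; reflexivity.
  have [|n] := @linear_forms_nonzero CC [:: (s.2, - s.1); (s'.2, - s'.1); (a%:C, b%:C)].
    by rewrite /= !form_neq0 //= xpair_eqE negb_and abC.
  rewrite /= andbT => /and3P[h1 h2 h3]; exists n.
  rewrite rmorph1 rmorph_nat !mulr1 -!mulNr.
  by rewrite !mulf_neq0 ?expf_neq0.
- rewrite hk -(fmorph_eq0 (real_complex R)); congr (_ == 0).
  by rewrite cval_ccx; ring.
Qed.

(** F is now c00 Z^2, with c00 nonzero by coprimality, so each root of the quadratic part of G is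
    counted twice. *)
Lemma intersection_inf_double : c10 F = 0 -> c01 F = 0 ->
  IPQ_roots S [:: s; s'; s; s'] /\ mu_first S 4.
Proof.
move=> F10 F01; have [F20 F11 F02] := HF; have [G20 G11 G02] := HG.
have d0 : c00 F != 0.
  apply/eqP => F00; apply: (coprime_pencilF_neq0 cop c0).
  move: F20 F11 F02 F10 F01 F00; rewrite -/F; case: F => ? ? ? ? ? ? /=.
  by move=> -> -> -> -> -> ->.
have dC : (c00 F)%:C != 0 by rewrite fmorph_eq0.
have FE : ccx F = line_pair 0 0 1 0 0 (c00 F)%:C.
  rewrite /ccx /cmap F20 F11 F02 F10 F01 /line_pair rmorph0.
  by congr Conic; ring.
split.
  split=> [|w winf]; first by rewrite /= s0 s'0.
  apply: (IPQ_pencil c0); rewrite -/F -/G FE cpoly_line_pair.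
  rewrite -[[:: s; s'; s; s']]/([:: s; s'] ++ [:: s; s']) count_cat.
  apply: (local_mult_mul (linform_homog _ _ _) (cpoly_homog (ccx G)) _ ndvd_inf_G).
  + by rewrite oner_eq0 !orbT.
  + by have := local_mult_inf_G winf; rewrite {1}XiZE.
  + apply/local_multC; apply: (local_mult_eqr dC _ (local_multC (local_mult_inf_G winf))).
    by instantiate (1 := 0); rewrite /linform mpolyC0; ring.
apply: (@mu_first_pencil _ S c1 c2 4 (fun x y =>
    e * ((s.2 * x%:C - s.1 * y%:C) * (s'.2 * x%:C - s'.1 * y%:C))
    * ((c00 F)%:C ^+ 2 * (e * ((s.2 * x%:C - s.1 * y%:C) * (s'.2 * x%:C - s'.1 * y%:C))))) c0).
  move=> x y; rewrite -/F -/G FE rho_line_pair.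
  have [E1 h1] := on_line_inf_G x%:C y%:C; rewrite h1.
  have -> : on_line (ccx G) 0 0 (c00 F)%:C x%:C y%:C =
      (c00 F)%:C%:P ^+ 2 * on_line (ccx G) 0 0 1 x%:C y%:C.
    by rewrite !on_line_inf; ring.
  rewrite h1 (_ : (c00 F)%:C%:P ^+ 2 * _ = 'X ^+ 2 * (((c00 F)%:C ^+ 2 *
    (e * ((s.2 * x%:C - s.1 * y%:C) * (s'.2 * x%:C - s'.1 * y%:C))))%:P
    + 'X * ((c00 F)%:C%:P ^+ 2 * E1))); last by ring.
  by rewrite jet_mul; eexists; reflexivity.
have [|n] := @linear_forms_nonzero CC [:: (s.2, - s.1); (s'.2, - s'.1)].
  by rewrite /= !form_neq0.
rewrite /= andbT => /andP[h1 h2]; exists n.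
rewrite rmorph1 rmorph_nat !mulr1 -!mulNr.
by rewrite !mulf_neq0 ?expf_neq0.
Qed.

End Setting.
End InfinityInPencil.

(** * Normal forms of the quadratic parts *)

Section RealForms.
Variable R : realType.
Local Notation CC := R[i].
Local Notation "x %:C" := (real_complex R x).
Implicit Types (a b c d x y : R) (S : qsys R).

Lemma sum_sqr_neq0 (r1 r2 : R) : (r1 != 0) || (r2 != 0) -> r1 ^+ 2 + r2 ^+ 2 != 0.
Proof.
move=> r0; rewrite paddr_eq0 ?sqr_ge0 // !sqrf_eq0.
by case/orP: r0 => h; rewrite negb_and h // orbT.
Qed.

Lemma blin_root a b (r1 r2 : R) : (r1 != 0) || (r2 != 0) -> a * r1 + b * r2 = 0 ->
  exists e, a = e * r2 /\ b = - (e * r1).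
Proof.
move=> /sum_sqr_neq0 N h; exists ((a * r2 - b * r1) / (r1 ^+ 2 + r2 ^+ 2)).
split; apply: (mulIf N); rewrite ?mulNr mulrAC divfK //.
  by rewrite -[LHS]subr0 -[0 in LHS](mulr0 r1) -h; ring.
by rewrite -[LHS]subr0 -[0 in LHS](mulr0 r2) -h; ring.
Qed.

Lemma bquad_root a b c (r1 r2 : R) : (r1 != 0) || (r2 != 0) ->
  a * r1 ^+ 2 + b * r1 * r2 + c * r2 ^+ 2 = 0 ->
  exists u1 u2, [/\ a = r2 * u1, b = r2 * u2 - r1 * u1 & c = - (r1 * u2)].
Proof.
move=> r0 h; have N := sum_sqr_neq0 r0.
have [r20|r20] := eqVneq r2 0.
  have r10 : r1 != 0 by move: r0; rewrite r20 eqxx orbF.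
  have a0 : a = 0.
    apply: (mulIf (expf_neq0 2 r10)); rewrite mul0r -h r20; ring.
  by exists (- b / r1), (- c / r1); split; rewrite ?a0 ?r20; field.
exists (a / r2), ((b + r1 * (a / r2)) / r2); split; [by field | by field |].
apply: (mulIf (expf_neq0 2 r20)); apply/eqP; rewrite -subr_eq0 -h; apply/eqP.
by field.
Qed.

Lemma bcubic_root a b c d (r1 r2 : R) : (r1 != 0) || (r2 != 0) ->
  a * r1 ^+ 3 + b * r1 ^+ 2 * r2 + c * r1 * r2 ^+ 2 + d * r2 ^+ 3 = 0 ->
  exists h0 h1 h2, [/\ a = r2 * h0, b = r2 * h1 - r1 * h0, c = r2 * h2 - r1 * h1
    & d = - (r1 * h2)].
Proof.
move=> r0 h; have [r20|r20] := eqVneq r2 0.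
  have r10 : r1 != 0 by move: r0; rewrite r20 eqxx orbF.
  have a0 : a = 0.
    by apply: (mulIf (expf_neq0 3 r10)); rewrite mul0r -h r20; ring.
  by exists (- b / r1), (- c / r1), (- d / r1); split; rewrite ?a0 ?r20; field.
pose h0 := a / r2; pose h1 := (b + r1 * h0) / r2; pose h2 := (c + r1 * h1) / r2.
exists h0, h1, h2; split; rewrite /h2 /h1 /h0; [by field | by field | by field |].
apply: (mulIf (expf_neq0 3 r20)); apply/eqP; rewrite -subr_eq0 -h; apply/eqP.
by field.
Qed.

(** If a = 0, the point (1 : 0) is a root. Otherwise B is large enough for the cubic term to
    dominate at B and - B, and the intermediate value theorem applies. *)
Lemma real_cubic_root a b c d :
  exists r1 r2, ((r1 != 0) || (r2 != 0)) /\
    a * r1 ^+ 3 + b * r1 ^+ 2 * r2 + c * r1 * r2 ^+ 2 + d * r2 ^+ 3 = 0.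
Proof.
have [a0|a0] := eqVneq a 0; first by exists 1, 0; rewrite oner_eq0 a0; split=> //; ring.
pose p : {poly R} := 'X^3 + (b / a)%:P * 'X^2 + (c / a)%:P * 'X + (d / a)%:P.
pose B := 1 + `|b / a| + `|c / a| + `|d / a|.
have pE x : p.[x] = x ^+ 3 + b / a * x ^+ 2 + c / a * x + d / a.
  by rewrite /p !hornerE.
have bnd (t : R) : [/\ - `|t| <= t, t <= `|t| & 0 <= `|t|].
  by have /andP[h1 h2] : - `|t| <= t <= `|t| by rewrite -ler_norml.
have [h1 h2 h3] := bnd (b / a); have [h4 h5 h6] := bnd (c / a); have [h7 h8 h9] := bnd (d / a).
have B1 : 1 <= B by rewrite /B; lra.
have pB : 0 <= p.[B].
  rewrite pE; move: h1 h2 h3 h4 h5 h6 h7 h8 h9 B1; rewrite /B.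
  move: (b / a) (c / a) (d / a) => b' c' d'.
  move: `|b'| `|c'| `|d'| => ab ac ad h1 h2 h3 h4 h5 h6 h7 h8 h9 B1.
  set B' := 1 + ab + ac + ad in B1 *.
  have e1 : - ab * B' ^+ 2 <= b' * B' ^+ 2 by apply: ler_wpM2r => //; apply: sqr_ge0.
  have e2 : - ac * B' <= c' * B' by apply: ler_wpM2r => //; lra.
  have e3 : B' * 1 <= B' * B' by apply: ler_wpM2l => //; lra.
  have e4 : ac * B' <= ac * B' ^+ 2 by apply: ler_wpM2l => //; rewrite expr2; lra.
  have e5 : ad * 1 <= ad * B' ^+ 2 by apply: ler_wpM2l => //; rewrite expr2; lra.
  (* One factor of B'^3 is expanded by its definition, so each summand dominates one lower term of
     the polynomial. *)
  have e6 : B' ^+ 3 = B' ^+ 2 + ab * B' ^+ 2 + ac * B' ^+ 2 + ad * B' ^+ 2.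
    by rewrite [LHS]exprS {1}/B'; ring.
  have e7 := sqr_ge0 B'; lra.
have pNB : p.[- B] <= 0.
  rewrite pE; move: h1 h2 h3 h4 h5 h6 h7 h8 h9 B1; rewrite /B.
  move: (b / a) (c / a) (d / a) => b' c' d'.
  move: `|b'| `|c'| `|d'| => ab ac ad h1 h2 h3 h4 h5 h6 h7 h8 h9 B1.
  set B' := 1 + ab + ac + ad in B1 *.
  have e1 : b' * B' ^+ 2 <= ab * B' ^+ 2 by apply: ler_wpM2r => //; apply: sqr_ge0.
  have e2 : - ac * B' <= c' * B' by apply: ler_wpM2r => //; lra.
  have e3 : B' * 1 <= B' * B' by apply: ler_wpM2l => //; lra.
  have e4 : ac * B' <= ac * B' ^+ 2 by apply: ler_wpM2l => //; rewrite expr2; lra.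
  have e5 : ad * 1 <= ad * B' ^+ 2 by apply: ler_wpM2l => //; rewrite expr2; lra.
  have e6 : B' ^+ 3 = B' ^+ 2 + ab * B' ^+ 2 + ac * B' ^+ 2 + ad * B' ^+ 2.
    by rewrite [LHS]exprS {1}/B'; ring.
  have e7 := sqr_ge0 B'.
  have -> : (- B') ^+ 3 = - B' ^+ 3 by ring.
  have -> : (- B') ^+ 2 = B' ^+ 2 by ring.
  lra.
have [||x _ /rootP px] := @poly_ivt R p (- B) B; first by lra.
  by rewrite pNB pB.
exists x, 1; rewrite oner_eq0 orbT; split => //.
rewrite -[RHS](mulr0 a) -px pE; field; exact: a0.
Qed.

(* The binary quadratic form h0 x^2 + h1 xy + h2 y^2 factors over C as
   e (s_2 x - s_1 y)(s'_2 x - s'_1 y). *)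
Definition quad_roots (h0 h1 h2 : R) (e : CC) (s s' : CC * CC) : Prop :=
  [/\ h0%:C = e * (s.2 * s'.2), h1%:C = - (e * (s.2 * s'.1 + s.1 * s'.2))
    & h2%:C = e * (s.1 * s'.1)].

Definition rpair (s : R * R) : CC * CC := (s.1%:C, s.2%:C).

Lemma rpair_neq0 (s : R * R) : (rpair s != 0) = (s != 0).
Proof. by case: s => a b; rewrite !xpair_eqE !fmorph_eq0. Qed.

Lemma real_quad_roots (h0 h1 h2 : R) : [|| h0 != 0, h1 != 0 | h2 != 0] ->
  0 <= h1 ^+ 2 - h0 * h2 *+ 4 ->
  exists (e : R) (s s' : R * R), [/\ e != 0, s != 0, s' != 0 &
    [/\ h0 = e * (s.2 * s'.2), h1 = - (e * (s.2 * s'.1 + s.1 * s'.2))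
      & h2 = e * (s.1 * s'.1)]].
Proof.
move=> hn disc; have [z0|n0] := eqVneq h0 0.
  exists 1, (1, 0), (h2, - h1); rewrite !xpair_eqE !oner_eq0 /= oppr_eq0.
  split => //; first by move: hn; rewrite z0 eqxx /= negb_and orbC.
  by rewrite z0; split; ring.
pose d := Num.sqrt (h1 ^+ 2 - h0 * h2 *+ 4).
have d2 : d ^+ 2 = h1 ^+ 2 - h0 * h2 *+ 4 by rewrite sqr_sqrtr.
exists h0, ((- h1 + d) / (h0 *+ 2), 1), ((- h1 - d) / (h0 *+ 2), 1).
rewrite !xpair_eqE !oner_eq0 !andbF /=; split => //; split; first by ring.
  by field.
have -> : h0 * ((- h1 + d) / (h0 *+ 2) * ((- h1 - d) / (h0 *+ 2))) =
  (h1 ^+ 2 - d ^+ 2) / (h0 *+ 4) by field.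
by rewrite d2; field.
Qed.

Lemma complex_quad_roots (h0 h1 h2 : R) : h1 ^+ 2 - h0 * h2 *+ 4 < 0 ->
  exists (e z z' : CC), [/\ e != 0, complex.Im z != 0, complex.Im z' != 0, z != z'
    & quad_roots h0 h1 h2 e (z, 1) (z', 1)].
Proof.
move=> disc; have n0 : h0 != 0.
  by apply: contraTneq disc => ->; rewrite mul0r mul0rn subr0 -leNgt sqr_ge0.
pose d := Num.sqrt (h0 * h2 *+ 4 - h1 ^+ 2).
have d2 : d ^+ 2 = h0 * h2 *+ 4 - h1 ^+ 2 by rewrite sqr_sqrtr //; lra.
have d0 : d != 0.
  by apply: contraTneq disc => d0; move: d2; rewrite d0; move=> ?; rewrite -leNgt; lra.
exists h0%:C, (- h1 / (h0 *+ 2) +i* (d / (h0 *+ 2)))%C,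
  (- h1 / (h0 *+ 2) -i* (d / (h0 *+ 2)))%C.
have q0 : d / (h0 *+ 2) != 0 by rewrite mulf_neq0 ?invr_eq0 ?mulrn_eq0.
split; rewrite ?fmorph_eq0 ?oppr_eq0 //=.
  rewrite eq_complex /= negb_and; apply/orP; right.
  by rewrite -subr_eq0 opprK -mulr2n mulrn_eq0.
split; apply/eqP; rewrite eq_complex /=; apply/andP; split; apply/eqP.
- by ring.
- by ring.
- by field.
- by ring.
- have -> : h2 = (h1 ^+ 2 + d ^+ 2) / (h0 *+ 4) by rewrite d2; field.
  by field.
- by ring.
Qed.

End RealForms.

Section CubicForm.
Variable R : realType.
Local Notation CC := R[i].
Local Notation "x %:C" := (real_complex R x).
Local Notation poly3 := {mpoly CC[3]}.
Implicit Types (S : qsys R).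

Lemma LformE S : Lform S =
  (let: (A, B, C) := (S a20, S a11 *+ 2, S a02) in
   let: (D, E, F) := (S b20, S b11 *+ 2, S b02) in
   bquad ((A * E - B * D) *+ 2 *+ 4 + - (E ^+ 2 - D * F *+ 4) *+ 8
          - (- D * (B - F) *+ 12 - (A - E) ^+ 2 *+ 4) *+ 2)
     ((A * F - C * D) *+ 4 *+ 4 + (B * E - A * F *+ 2 - C * D *+ 2) *+ 2 *+ 8
          - (- D * C *+ 36 - (A - E) * (B - F) *+ 4) *+ 2)
     ((B * F - C * E) *+ 2 *+ 4 + - (B ^+ 2 - A * C *+ 4) *+ 8
          - ((A - E) * C *+ 12 - (B - F) ^+ 2 *+ 4) *+ 2)).
Proof. by rewrite /Lform KformE HformE MformE !bquadMn bquadN !bquadD. Qed.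

(* C_2 = (r2 x - r1 y)(h0 x^2 + h1 xy + h2 y^2) *)
Definition C2_split S (r1 r2 h0 h1 h2 : R) : Prop :=
  [/\ - S b20 = r2 * h0, S a20 - S b11 *+ 2 = r2 * h1 - r1 * h0,
      S a11 *+ 2 - S b02 = r2 * h2 - r1 * h1 & S a02 = - (r1 * h2)].

(** At the root r of C_2 this is the value of the cofactor h, which vanishes exactly when r is a
    multiple root. *)
Definition qval (h0 h1 h2 x y : R) := h0 * x ^+ 2 + h1 * x * y + h2 * y ^+ 2.

Lemma C2_split_exists S : exists r1 r2 h0 h1 h2,
  ((r1 != 0) || (r2 != 0)) /\ C2_split S r1 r2 h0 h1 h2.
Proof.
have [r1 [r2 [r0 h]]] := real_cubic_root (- S b20) (S a20 - S b11 *+ 2)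
  (S a11 *+ 2 - S b02) (S a02).
have [h0 [h1 [h2 [e0 e1 e2 e3]]]] := bcubic_root r0 h.
by exists r1, r2, h0, h1, h2.
Qed.

(** Multiplicativity of the discriminant: Disc(l h) = Disc(h) Res(l, h)^2, and Res(l, h) is h(r) up
    to sign. *)
Lemma eta_split S r1 r2 h0 h1 h2 : C2_split S r1 r2 h0 h1 h2 ->
  eta S = (h1 ^+ 2 - h0 * h2 *+ 4) * qval h0 h1 h2 r1 r2 ^+ 2.
Proof. by case=> e0 e1 e2 e3; rewrite etaE e0 e1 e2 e3 /qval; ring. Qed.

(** Here C_2 = l^2 m with m = v1 x + v2 y, and the identity reads M = - 8 m(r)^2 l^2. Thus M tells a
    double root from a triple one. *)
Lemma M_split_root S r1 r2 v1 v2 :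
  C2_split S r1 r2 (r2 * v1) (r2 * v2 - r1 * v1) (- (r1 * v2)) ->
  Mform S = bquad (- ((v1 * r1 + v2 * r2) ^+ 2 * r2 ^+ 2 *+ 8))
    ((v1 * r1 + v2 * r2) ^+ 2 * r1 * r2 *+ 16)
    (- ((v1 * r1 + v2 * r2) ^+ 2 * r1 ^+ 2 *+ 8)).
Proof.
case=> e0 e1 e2 e3; rewrite MformE e0 e1 e2 e3.
by congr bquad; ring.
Qed.

Lemma M_split_root_eq0 S r1 r2 v1 v2 : (r1 != 0) || (r2 != 0) ->
  C2_split S r1 r2 (r2 * v1) (r2 * v2 - r1 * v1) (- (r1 * v2)) ->
  (Mform S == 0) = (v1 * r1 + v2 * r2 == 0).
Proof.
move=> r0 /M_split_root ->; apply/eqP/eqP => [/bquad_eq0[m0 _ m2]|->]; last first.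
  by apply/bquad_eq0; split; ring.
have : (v1 * r1 + v2 * r2) ^+ 2 * (r1 ^+ 2 + r2 ^+ 2) = 0.
  by move: m0 m2; lra.
move/eqP; rewrite mulf_eq0 (negbTE (sum_sqr_neq0 r0)) orbF expf_eq0 /=.
by move/eqP.
Qed.

(** Evaluating M at r gives - 8 h(r)^2. *)
Lemma M_split_neq0 S r1 r2 h0 h1 h2 : C2_split S r1 r2 h0 h1 h2 ->
  qval h0 h1 h2 r1 r2 != 0 -> Mform S != 0.
Proof.
case=> e0 e1 e2 e3; apply: contra_neq => /eqP; rewrite MformE e0 e1 e2 e3 => /eqP.
case/bquad_eq0 => m0 m1 m2.
have : qval h0 h1 h2 r1 r2 ^+ 2 *+ 8 = 0.
  rewrite -[RHS]oppr0 -[0 in RHS](mulr0 (r2 ^+ 2)) -m2 -[X in - X]add0r.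
  rewrite -[0 in RHS](mulr0 (r1 * r2)) -m1 -[X in - (X + _)]add0r.
  by rewrite -[0 in RHS](mulr0 (r1 ^+ 2)) -m0 /qval; ring.
by move/eqP; rewrite mulrn_eq0 /= expf_eq0 /= => /eqP.
Qed.

Lemma ICZ_roots S r1 r2 h0 h1 h2 (e : CC) (s s' : CC * CC) :
  (r1 != 0) || (r2 != 0) -> C2_split S r1 r2 h0 h1 h2 ->
  quad_roots h0 h1 h2 e s s' -> e != 0 -> s != 0 -> s' != 0 ->
  forall w, at_infinity w ->
  ICZ S w = count (fun r => w == pt r) [:: rpair (r1, r2); s; s'].
Proof.
move=> r0 [e0 e1 e2 e3] [q0 q1 q2] en s0 s'0 w winf.
have bE : complexify (bigC S) =
    'X_iY * complexify (bigP S) - 'X_iX * complexify (bigQ S).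
  have cM (p q : {mpoly R[3]}) : complexify (p * q) = complexify p * complexify q.
    exact: (rmorphM (map_mpoly (real_complex R))).
  have cB (p q : {mpoly R[3]}) : complexify (p - q) = complexify p - complexify q.
    exact: (rmorphB (map_mpoly (real_complex R))).
  have cX (k : 'I_3) : complexify ('X_k : {mpoly R[3]}) = 'X_k.
    exact: (map_mpolyX (real_complex R)).
  by rewrite /bigC cB !cM !cX.
pose B := 'X_iY * linform (S a10)%:C (S a01)%:C (S a00)%:C
  - 'X_iX * linform (S b10)%:C (S b01)%:C (S b00)%:C.
have CE : complexify (bigC S) = e%:MP * rootprod [:: rpair (r1, r2); s; s'] + 'X_iZ * B.
  have PE : cpoly (ccx (conicP S)) = (S a20)%:C%:MP * 'X_iX ^+ 2
      + (S a11 *+ 2)%:C%:MP * 'X_iX * 'X_iY + (S a02)%:C%:MP * 'X_iY ^+ 2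
      + (S a10)%:C%:MP * 'X_iX * 'X_iZ + (S a01)%:C%:MP * 'X_iY * 'X_iZ
      + (S a00)%:C%:MP * 'X_iZ ^+ 2 by exact: cpoly_ccx.
  have QE : cpoly (ccx (conicQ S)) = (S b20)%:C%:MP * 'X_iX ^+ 2
      + (S b11 *+ 2)%:C%:MP * 'X_iX * 'X_iY + (S b02)%:C%:MP * 'X_iY ^+ 2
      + (S b10)%:C%:MP * 'X_iX * 'X_iZ + (S b01)%:C%:MP * 'X_iY * 'X_iZ
      + (S b00)%:C%:MP * 'X_iZ ^+ 2 by exact: cpoly_ccx.
  rewrite bE bigPE bigQE !complexify_cpoly PE QE.
  have A20 : (S a20)%:C = r2%:C * h1%:C - r1%:C * h0%:C + (S b11 *+ 2)%:C.
    by rewrite -!rmorphM -rmorphB -rmorphD -e1 subrK.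
  have A11 : (S a11 *+ 2)%:C = r2%:C * h2%:C - r1%:C * h1%:C + (S b02)%:C.
    by rewrite -!rmorphM -rmorphB -rmorphD -e2 subrK.
  have B20 : (S b20)%:C = - (r2%:C * h0%:C).
    by rewrite -rmorphM -rmorphN -e0 opprK.
  have A02 : (S a02)%:C = - (r1%:C * h2%:C) by rewrite -rmorphM -rmorphN -e3.
  rewrite A20 A11 B20 A02 q0 q1 q2 /B.
  rewrite /rootprod !big_cons big_nil /rootform /linform mpolyC0 !mpolyCN.
  have -> : (rpair (r1, r2)).1 = r1%:C by [].
  have -> : (rpair (r1, r2)).2 = r2%:C by [].
  by move: ((S b11 *+ 2)%:C) => b11'; ring.
rewrite /ICZ; apply: (@intersection_multP _ w _ _ 3 1).
- rewrite bE bigPE bigQE !complexify_cpoly; apply: dhomogD; last rewrite dhomogN.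
    exact: (dhomogM (mpolyX_homog CC iY) (cpoly_homog _)).
  exact: (dhomogM (mpolyX_homog CC iX) (cpoly_homog _)).
- exact: mpolyX_homog.
rewrite CE; apply: local_mult_inf => //.
by rewrite /= s0 s'0 rpair_neq0 xpair_eqE negb_and r0.
Qed.

Lemma C2_neq0 S : QSess S -> C2 S != 0.
Proof.
case=> _ _; apply: contra_notN => /eqP; rewrite C2E => /bcubic_eq0[h0 h1 h2 h3].
exists ('X_iY * linform (S a10) (S a01) (S a00) - 'X_iX * linform (S b10) (S b01) (S b00)).
rewrite /bigC bigPE bigQE /cpoly /cval /=.
move/eqP: h0; rewrite oppr_eq0 => /eqP ->; rewrite h3.
move/eqP: h1; rewrite subr_eq0 => /eqP ->; move/eqP: h2; rewrite subr_eq0 => /eqP ->.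
by rewrite mpolyC0 /linform; ring.
Qed.

Lemma C2_split_neq0 S r1 r2 h0 h1 h2 : C2 S != 0 -> C2_split S r1 r2 h0 h1 h2 ->
  [|| h0 != 0, h1 != 0 | h2 != 0].
Proof.
move=> + [e0 e1 e2 e3]; apply: contra_neqT; rewrite !negb_or !negbK.
case/and3P => /eqP z0 /eqP z1 /eqP z2; rewrite C2E e0 e1 e2 e3 z0 z1 z2.
by apply/bcubic_eq0; split; ring.
Qed.

End CubicForm.

(** * Quadratic parts with one common root, and proportional quadratic parts *)

Section Configurations.
Variable R : realType.
Local Notation CC := R[i].
Local Notation "x %:C" := (real_complex R x).
Implicit Types (S : qsys R).

Definition top_res S : R :=
  res2 (S a20) (S a11 *+ 2) (S a02) (S b20) (S b11 *+ 2) (S b02).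

(* p_2 = l p' and q_2 = l q' with l = r2 x - r1 y, p' = u1 x + u2 y and
   q' = v1 x + v2 y *)
Definition common_factor S (r1 r2 u1 u2 v1 v2 : R) : Prop :=
  [/\ S a20 = r2 * u1, S a11 *+ 2 = r2 * u2 - r1 * u1 & S a02 = - (r1 * u2)] /\
  [/\ S b20 = r2 * v1, S b11 *+ 2 = r2 * v2 - r1 * v1 & S b02 = - (r1 * v2)].

(* The double root of K = Jacob(p_2, q_2) is a common root of p_2 and q_2,
   because both forms are apolar to K. *)
Lemma common_factor_exists S : Kform S != 0 -> top_res S = 0 ->
  exists r1 r2 u1 u2 v1 v2, [/\ (r1 != 0) || (r2 != 0),
    common_factor S r1 r2 u1 u2 v1 v2 & u1 * v2 - u2 * v1 != 0].
Proof.
rewrite KformE /top_res /common_factor.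
move: (S a20) (S a11 *+ 2) (S a02) (S b20) (S b11 *+ 2) (S b02).
move=> A B C D E F Kn res0.
have Kn0 : ~ [/\ A * E - B * D = 0, A * F - C * D = 0 & B * F - C * E = 0].
  case=> k0 k1 k2; move/eqP: Kn; apply; apply/bquad_eq0.
  by rewrite k0 k1 k2 !mul0rn.
(* The resultant k1^2 - k0 k2 is zero, so K / 2 = k0 x^2 + 2 k1 x y + k2 y^2 is eps times the square
   of r2 x - r1 y. *)
have [r1 [r2 [eps [r0 en [k0 k1 k2]]]]] : exists r1 r2 eps : R,
    [/\ (r1 != 0) || (r2 != 0), eps != 0 & [/\ A * E - B * D = eps * r2 ^+ 2,
     A * F - C * D = - (eps * r1 * r2) & B * F - C * E = eps * r1 ^+ 2]].
  move: Kn0 res0; rewrite /res2.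
  move: (A * E - B * D) (A * F - C * D) (B * F - C * E) => k0 k1 k2 Kn0 res0.
  have [z0|n0] := eqVneq k0 0.
    have k10 : k1 = 0.
      by apply/eqP; rewrite -sqrf_eq0; apply/eqP; rewrite -res0 z0; ring.
    exists 1, 0, k2; rewrite oner_eq0; split => //.
      by apply/eqP => z2; apply: Kn0.
    by rewrite z0 k10; split; ring.
  exists (- k1), k0, k0^-1; rewrite n0 orbT invr_eq0 n0; split => //.
  have e2 : k1 ^+ 2 = k0 * k2 by apply/eqP; rewrite -subr_eq0 res0.
  split; [by field | by field |].
  by rewrite sqrrN e2; field.
(* Up to eps, this is the expansion of a determinant with the row (A, B, C) repeated. *)
have apP : A * r1 ^+ 2 + B * r1 * r2 + C * r2 ^+ 2 = 0.
  apply: (mulfI en); rewrite mulr0.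
  transitivity (A * (B * F - C * E) - B * (A * F - C * D) + C * (A * E - B * D)); last by ring.
  by rewrite k0 k1 k2; ring.
have apQ : D * r1 ^+ 2 + E * r1 * r2 + F * r2 ^+ 2 = 0.
  apply: (mulfI en); rewrite mulr0.
  transitivity (D * (B * F - C * E) - E * (A * F - C * D) + F * (A * E - B * D)); last by ring.
  by rewrite k0 k1 k2; ring.
have [u1 [u2 [uA uB uC]]] := bquad_root r0 apP.
have [v1 [v2 [vD vE vF]]] := bquad_root r0 apQ.
exists r1, r2, u1, u2, v1, v2; split => //.
apply/eqP => J0; apply: Kn0; rewrite uA uB uC vD vE vF; split.
- by transitivity (r2 ^+ 2 * (u1 * v2 - u2 * v1)); [ring | rewrite J0 mulr0].
- by transitivity (- (r1 * r2 * (u1 * v2 - u2 * v1))); [ring | rewrite J0 mulr0 oppr0].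
- by transitivity (r1 ^+ 2 * (u1 * v2 - u2 * v1)); [ring | rewrite J0 mulr0].
Qed.

Section CommonFactor.
Variables (S : qsys R) (r1 r2 u1 u2 v1 v2 : R).
Hypothesis r0 : (r1 != 0) || (r2 != 0).
Hypothesis HS : common_factor S r1 r2 u1 u2 v1 v2.
Hypothesis J0 : u1 * v2 - u2 * v1 != 0.
(** The values at r of the cofactors p' and q'. Then w2 p' - w1 q' vanishes at r and equals J l with
    J = u1 v2 - u2 v1, so the member w2 P - w1 Q has quadratic part J l^2. *)
Let w1 := u1 * r1 + u2 * r2.
Let w2 := v1 * r1 + v2 * r2.

Lemma common_factor_split : C2_split S r1 r2 (- v1) (u1 - v2) u2.
Proof.
have [[hA hB hC] [hD hE hF]] := HS.
by rewrite /C2_split hA hB hC hD hE hF; split; ring.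
Qed.

(** K = 2 J l^2, and the second transvectant with l^2 is 4 times evaluation at r, so kappa = 8 J
    M(r) = - 64 J h(r)^2. Hence kappa tests whether the common point is a multiple root of C_2. *)
Lemma common_factor_kappa :
  (kappa S == 0) = (qval (- v1) (u1 - v2) u2 r1 r2 == 0).
Proof.
have [[hA hB hC] [hD hE hF]] := HS.
have -> : kappa S = (- ((u1 * v2 - u2 * v1) * qval (- v1) (u1 - v2) u2 r1 r2 ^+ 2 *+ 64))%:MP.
  by rewrite kappaE hA hB hC hD hE hF /qval; congr _%:MP; ring.
by rewrite mpolyC_eq0 oppr_eq0 mulrn_eq0 /= mulf_eq0 (negbTE J0) expf_eq0.
Qed.

Lemma common_factor_pencil : (w1 != 0) || (w2 != 0).
Proof.
rewrite -negb_and; apply/andP => -[/eqP z1 /eqP z2].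
have e1 : r1 * (u1 * v2 - u2 * v1) = 0.
  by transitivity (v2 * w1 - u2 * w2); [rewrite /w1 /w2; ring | rewrite z1 z2; ring].
have e2 : r2 * (u1 * v2 - u2 * v1) = 0.
  by transitivity (u1 * w2 - v1 * w1); [rewrite /w1 /w2; ring | rewrite z1 z2; ring].
move/eqP: e1; move/eqP: e2; rewrite !mulf_eq0 (negbTE J0) !orbF => y0 x0.
by move: r0; rewrite x0 y0.
Qed.

(** h(r) = 0 makes (w1, w2) a multiple s of r, so p' = s x + e1 l and q' = s y + e2 l. With th = e1
    r2 - e2 r1 one finds J = s (s + th), M = - 8 th^2 l^2 and L = 8 (s + th) th l^2, and neither
    factor can vanish. *)
Lemma common_factor_L : qval (- v1) (u1 - v2) u2 r1 r2 = 0 -> Mform S != 0 ->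
  Lform S != 0.
Proof.
rewrite /qval => h0 M0.
have [s [hs1 hs2]] : exists s, w1 = s * r1 /\ w2 = s * r2.
  have [|e [he1 he2]] := @blin_root R (- w2) w1 r1 r2 r0.
    by rewrite -h0 /w1 /w2; ring.
  by exists (- e); rewrite he2 -[w2]opprK he1; split; ring.
have [e1 [hu1 hu2]] : exists e1, u1 - s = e1 * r2 /\ u2 = - (e1 * r1).
  apply: (blin_root r0).
  by transitivity (w1 - s * r1); [rewrite /w1; ring | rewrite hs1 subrr].
have [e2 [hv1 hv2]] : exists e2, v1 = e2 * r2 /\ v2 - s = - (e2 * r1).
  apply: (blin_root r0).
  by transitivity (w2 - s * r2); [rewrite /w2; ring | rewrite hs2 subrr].
have {}hu1 : u1 = s + e1 * r2 by rewrite -hu1; ring.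
have {}hv2 : v2 = s - e2 * r1 by rewrite -[RHS]/(s + - (e2 * r1)) -hv2; ring.
have [[hA hB hC] [hD hE hF]] := HS.
pose th := e1 * r2 - e2 * r1.
have LE : Lform S = bquad ((s + th) * th * r2 ^+ 2 *+ 8)
    (- ((s + th) * th * r1 * r2 *+ 16)) ((s + th) * th * r1 ^+ 2 *+ 8).
  by rewrite LformE hA hB hC hD hE hF hu1 hu2 hv1 hv2 /th; congr bquad; ring.
have ME : Mform S = bquad (- (th ^+ 2 * r2 ^+ 2 *+ 8)) (th ^+ 2 * r1 * r2 *+ 16)
    (- (th ^+ 2 * r1 ^+ 2 *+ 8)).
  by rewrite MformE hA hB hC hD hE hF hu1 hu2 hv1 hv2 /th; congr bquad; ring.
have th0 : th != 0.
  by apply: contra_neq M0 => z; rewrite ME z; apply/bquad_eq0; split; ring.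
have sth : s + th != 0.
  apply: contra_neq J0 => z.
  by transitivity (s * (s + th)); [rewrite hu1 hu2 hv1 hv2 /th; ring | rewrite z mulr0].
apply/eqP; rewrite LE => /bquad_eq0[l0 _ l2].
have : (s + th) * th * (r1 ^+ 2 + r2 ^+ 2) = 0 by move: l0 l2; lra.
by move/eqP; rewrite !mulf_eq0 (negbTE th0) (negbTE sth) (negbTE (sum_sqr_neq0 r0)).
Qed.

Lemma common_factor_divisor : coprime_PQ S ->
  exists m, [/\ (0 < m <= 4)%N, IPQ_roots S (nseq m (rpair (r1, r2))) & mu_first S m].
Proof.
move=> cop; have w0 := common_factor_pencil.
have [[hA hB hC] [hD hE hF]] := HS.
have hF' : [/\ c20 (pencilF S w1 w2) = (u1 * v2 - u2 * v1) * r2 ^+ 2,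
    c11 (pencilF S w1 w2) = - ((u1 * v2 - u2 * v1) * r1 * r2 *+ 2)
  & c02 (pencilF S w1 w2) = (u1 * v2 - u2 * v1) * r1 ^+ 2].
  by rewrite /= hA hB hC hD hE hF /w1 /w2; split; ring.
have hG' : [/\ c20 (pencilG S w1 w2) = r2 * (w1 * u1 + w2 * v1),
    c11 (pencilG S w1 w2) = r2 * (w1 * u2 + w2 * v2) - r1 * (w1 * u1 + w2 * v1)
  & c02 (pencilG S w1 w2) = - (r1 * (w1 * u2 + w2 * v2))].
  by rewrite /= hA hB hC hD hE hF; split; ring.
have nr : (w1 * u1 + w2 * v1) * r1 + (w1 * u2 + w2 * v2) * r2 != 0.
  rewrite (_ : _ + _ = w1 ^+ 2 + w2 ^+ 2) ?sum_sqr_neq0 //.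
  by transitivity (w1 * (u1 * r1 + u2 * r2) + w2 * (v1 * r1 + v2 * r2)); [ring | rewrite -/w1 -/w2 -!expr2].
have [z|nz] := eqVneq (c10 (pencilF S w1 w2) * r1 + c01 (pencilF S w1 w2) * r2) 0.
  have [m [/andP[m1 m4] hI hm]] := intersection_line_pair cop w0 r0 J0 hF' hG' nr z.
  by exists m; rewrite m4 (ltnW m1).
have [hI hm] := intersection_transversal w0 r0 J0 hF' hG' nr nz.
by exists 1%N.
Qed.

End CommonFactor.

(* p_2 = - c1 h and q_2 = - c2 h, so that C_2 = (c2 x - c1 y) h *)
Definition proportional S (c1 c2 h0 h1 h2 : R) : Prop :=
  [/\ S a20 = - (c1 * h0), S a11 *+ 2 = - (c1 * h1) & S a02 = - (c1 * h2)] /\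
  [/\ S b20 = - (c2 * h0), S b11 *+ 2 = - (c2 * h1) & S b02 = - (c2 * h2)].

Lemma proportional_exists S : Kform S = 0 -> C2 S != 0 ->
  exists c1 c2 h0 h1 h2, [/\ (c1 != 0) || (c2 != 0), [|| h0 != 0, h1 != 0 | h2 != 0]
    & proportional S c1 c2 h0 h1 h2].
Proof.
rewrite KformE C2E /proportional.
move: (S a20) (S a11 *+ 2) (S a02) (S b20) (S b11 *+ 2) (S b02) => A B C D E F.
move/bquad_eq0 => [/eqP k0 /eqP k1 /eqP k2] C2n.
move: k0 k1 k2; rewrite !mulrn_eq0 /= !subr_eq0 => /eqP k0 /eqP k1 /eqP k2.
have [nP|] := boolP [|| A != 0, B != 0 | C != 0].
  have [q [hD hE hF]] : exists q, [/\ D = q * A, E = q * B & F = q * C].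
    case/or3P: nP => n0; [exists (D / A) | exists (E / B) | exists (F / C)];
      split; apply: (mulIf n0); rewrite ?divfK // mulrAC divfK //.
    - by rewrite mulrC k0 mulrC.
    - by rewrite mulrC k1 mulrC.
    - by rewrite mulrC -k0 mulrC.
    - by rewrite mulrC k2 mulrC.
    - by rewrite mulrC -k1 mulrC.
    - by rewrite mulrC -k2 mulrC.
  exists (- 1), (- q), A, B, C; rewrite oppr_eq0 oner_eq0; split => //.
  by rewrite hD hE hF; split; split; ring.
rewrite !negb_or !negbK => /and3P[/eqP A0 /eqP B0 /eqP C0].
exists 0, (- 1), D, E, F; rewrite oppr_eq0 oner_eq0 orbT; split => //.
  apply: contraNT C2n; rewrite !negb_or !negbK => /and3P[/eqP D0 /eqP E0 /eqP F0].
  by apply/eqP/bcubic_eq0; rewrite A0 B0 C0 D0 E0 F0; split; ring.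
by rewrite A0 B0 C0; split; split; ring.
Qed.

Section Proportional.
Variables (S : qsys R) (c1 c2 h0 h1 h2 : R).
Hypothesis cn : (c1 != 0) || (c2 != 0).
Hypothesis hn : [|| h0 != 0, h1 != 0 | h2 != 0].
Hypothesis HS : proportional S c1 c2 h0 h1 h2.
(** The linear part f of c2 P - c1 Q; as the quadratic part cancels, this member is Z times the line
    f10 X + f01 Y + const Z. *)
Let f10 := c2 * S a10 - c1 * S b10.
Let f01 := c2 * S a01 - c1 * S b01.

Lemma proportional_split : C2_split S c1 c2 h0 h1 h2.
Proof.
have [[hA hB hC] [hD hE hF]] := HS.
by rewrite /C2_split hA hB hC hD hE hF; split; ring.
Qed.

Lemma proportional_kappa : kappa S = 0.
Proof.
have [[hA hB hC] [hD hE hF]] := HS.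
by rewrite kappaE hA hB hC hD hE hF -[RHS]mpolyC0; congr _%:MP; ring.
Qed.

(** K_1 = - h f with h nonzero, so K_1 decides whether the degenerate member is a multiple of
    Z^2. *)
Lemma proportional_K1 : (K1form S == 0) = (f10 == 0) && (f01 == 0).
Proof.
have [[hA hB hC] [hD hE hF]] := HS.
have KE : K1form S = bcubic (- (h0 * f10)) (- (h1 * f10 + h0 * f01))
    (- (h2 * f10 + h1 * f01)) (- (h2 * f01)).
  by rewrite K1formE hA hB hC hD hE hF /f10 /f01; congr bcubic; ring.
apply/eqP/andP => [|[/eqP z1 /eqP z2]]; last first.
  by rewrite KE z1 z2; apply/bcubic_eq0; split; ring.
rewrite KE => /bcubic_eq0[/eqP k0 /eqP k1 /eqP k2 /eqP k3].
move: k0 k1 k2 k3; rewrite !oppr_eq0.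
have [z0|n0] := eqVneq h0 0; last first.
  rewrite mulf_eq0 (negbTE n0) /= => /eqP ->.
  by rewrite mulr0 add0r mulf_eq0 (negbTE n0) /= => ->.
have [z1|n1] := eqVneq h1 0; last first.
  rewrite z0 !mul0r addr0 mulf_eq0 (negbTE n1) /= => _ /eqP ->.
  by rewrite mulr0 add0r mulf_eq0 (negbTE n1) /= => ->.
have n2 : h2 != 0 by move: hn; rewrite z0 z1 eqxx.
rewrite z0 z1 !mul0r !addr0 !mulf_eq0 (negbTE n2) /= => _ _.
by move=> -> ->.
Qed.

(** With K = 0, L = 8 H - M and H = - Disc(h) l^2 for l = c2 x - c1 y. If h = l m, then Disc(h) =
    m(c)^2 and M = - 8 m(c)^2 l^2, and the two terms cancel. *)
Lemma proportional_L_root v1 v2 : h0 = c2 * v1 -> h1 = c2 * v2 - c1 * v1 ->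
  h2 = - (c1 * v2) -> Lform S = 0.
Proof.
move=> e0 e1 e2; have [[hA hB hC] [hD hE hF]] := HS.
rewrite LformE hA hB hC hD hE hF e0 e1 e2.
by apply/bquad_eq0; split; ring.
Qed.

(** Here H = - Disc(h) l^2 = 0 and K = 0, which leaves L = - M. *)
Lemma proportional_L_double : h1 ^+ 2 - h0 * h2 *+ 4 = 0 -> Mform S != 0 ->
  Lform S != 0.
Proof.
move=> disc; have [[hA hB hC] [hD hE hF]] := HS.
suff -> : Lform S = - Mform S by rewrite oppr_eq0.
rewrite LformE MformE hA hB hC hD hE hF bquadN.
have disc' : h1 ^+ 2 = h0 * h2 *+ 4 by apply/eqP; rewrite -subr_eq0 disc.
congr bquad.
- transitivity (- (c2 ^+ 2 * (h1 ^+ 2 - h0 * h2 *+ 4)) *+ 8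
    + - ((c2 * h0 * (- (c1 * h1) + c2 * h2) *+ 12 - (- (c1 * h0) + c2 * h1) ^+ 2 *+ 4) *+ 2)).
    by ring.
  by rewrite disc; ring.
- transitivity (c1 * c2 * (h1 ^+ 2 - h0 * h2 *+ 4) *+ 16
    + - ((c2 * h0 * - (c1 * h2) *+ 36 - (- (c1 * h0) + c2 * h1) * (- (c1 * h1) + c2 * h2) *+ 4) *+ 2)).
    by ring.
  by rewrite disc; ring.
- transitivity (- (c1 ^+ 2 * (h1 ^+ 2 - h0 * h2 *+ 4)) *+ 8
    + - (((- (c1 * h0) + c2 * h1) * - (c1 * h2) *+ 12 - (- (c1 * h1) + c2 * h2) ^+ 2 *+ 4) *+ 2)).
    by ring.
  by rewrite disc; ring.
Qed.

(** As M = - 8 m(c)^2 l^2, transvection evaluates C_1 at c, where it equals f(c). So kappa_1 = - 32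
    m(c)^2 f(c) tests whether the second line of the degenerate member passes through the double
    root of C_2. *)
Lemma proportional_kappa1 v1 v2 : h0 = c2 * v1 -> h1 = c2 * v2 - c1 * v1 ->
  h2 = - (c1 * v2) -> Mform S != 0 -> (kappa1 S == 0) = (f10 * c1 + f01 * c2 == 0).
Proof.
move=> e0 e1 e2.
have sp : C2_split S c1 c2 (c2 * v1) (c2 * v2 - c1 * v1) (- (c1 * v2)).
  by rewrite -e0 -e1 -e2; exact: proportional_split.
rewrite (M_split_root_eq0 cn sp) => vr; have [[hA hB hC] [hD hE hF]] := HS.
have -> : kappa1 S = (- ((v1 * c1 + v2 * c2) ^+ 2 * (f10 * c1 + f01 * c2) *+ 32))%:MP.
  rewrite kappa1E hA hB hC hD hE hF e0 e1 e2 /f10 /f01; congr _%:MP; ring.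
by rewrite mpolyC_eq0 oppr_eq0 mulrn_eq0 /= mulf_eq0 expf_eq0 /= (negbTE vr).
Qed.

Lemma proportional_divisor e s s' : coprime_PQ S -> quad_roots h0 h1 h2 e s s' ->
  e != 0 -> s != 0 -> s' != 0 ->
  ((f10 != 0) || (f01 != 0) -> exists k, [/\ (k <= 2)%N,
     IPQ_roots S (s :: s' :: nseq k (rpair (- f01, f10))), mu_first S (2 + k)
     & (0 < k)%N = (qval h0 h1 h2 (- f01) f10 == 0)]) /\
  (f10 = 0 -> f01 = 0 -> IPQ_roots S [:: s; s'; s; s'] /\ mu_first S 4).
Proof.
move=> cop [q0 q1 q2] e0 s0 s'0.
have [[hA hB hC] [hD hE hF]] := HS.
have N0 : - (c1 ^+ 2 + c2 ^+ 2) != 0 by rewrite oppr_eq0 sum_sqr_neq0.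
have F0 : [/\ c20 (pencilF S c1 c2) = 0, c11 (pencilF S c1 c2) = 0
    & c02 (pencilF S c1 c2) = 0].
  by rewrite /= hA hB hC hD hE hF; split; ring.
have G0 : [/\ c20 (pencilG S c1 c2) = - (c1 ^+ 2 + c2 ^+ 2) * h0,
    c11 (pencilG S c1 c2) = - (c1 ^+ 2 + c2 ^+ 2) * h1
  & c02 (pencilG S c1 c2) = - (c1 ^+ 2 + c2 ^+ 2) * h2].
  by rewrite /= hA hB hC hD hE hF; split; ring.
have [G20 G11 G02] := G0.
have eN : (- (c1 ^+ 2 + c2 ^+ 2))%:C * e != 0 by rewrite mulf_neq0 // fmorph_eq0.
have GR : [/\ (c20 (pencilG S c1 c2))%:C = (- (c1 ^+ 2 + c2 ^+ 2))%:C * e * (s.2 * s'.2),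
  (c11 (pencilG S c1 c2))%:C = - ((- (c1 ^+ 2 + c2 ^+ 2))%:C * e * (s.2 * s'.1 + s.1 * s'.2))
  & (c02 (pencilG S c1 c2))%:C = (- (c1 ^+ 2 + c2 ^+ 2))%:C * e * (s.1 * s'.1)].
  have M x y : (x * y)%:C = x%:C * y%:C by exact: rmorphM.
  by rewrite G20 G11 G02 !M q0 q1 q2; split; ring.
have f10E : c10 (pencilF S c1 c2) = f10 by rewrite /= mulNr.
have f01E : c01 (pencilF S c1 c2) = f01 by rewrite /= mulNr.
split.
  rewrite -f10E -f01E => ab.
  have [k [kle hI hm hk]] := intersection_inf_line cop cn F0 eN s0 s'0 GR ab.
  exists k; split => //.
    suff -> : rpair (- c01 (pencilF S c1 c2), c10 (pencilF S c1 c2)) =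
        (- (c01 (pencilF S c1 c2))%:C, (c10 (pencilF S c1 c2))%:C) by [].
    by rewrite /rpair /= rmorphN.
  rewrite hk G20 G11 G02 f10E f01E.
  rewrite (_ : _ + _ = - (c1 ^+ 2 + c2 ^+ 2) * qval h0 h1 h2 (- f01) f10).
    by rewrite mulf_eq0 (negbTE N0).
  by rewrite /qval; ring.
rewrite -f10E -f01E => f0 f1.
exact: intersection_inf_double cop cn F0 eN s0 s'0 GR f0 f1.
Qed.

End Proportional.
End Configurations.

(** * Divisors *)

Section DivisorForms.
Variable R : realType.
Implicit Types (S : qsys R) (p q t w : P2 R) (form : seq dterm).

Lemma has_form_points S form : has_form S form ->
  exists ws : seq (P2 R), [/\ uniq ws, all (@at_infinity R) ws,
    [seq (dcoef d, dreal d) | d <- form] =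
      [seq (divisor_S S w, `[< real_point w >]) | w <- ws]
    & forall w, w \notin ws -> divisor_S S w = 0].
Proof.
move=> [f [inj finf freal fdiv]]; exists [seq f i | i <- enum 'I_(size form)].
have div_f i : divisor_S S (f i) = dcoef (tnth (in_tuple form) i).
  rewrite fdiv (bigD1 i) //= eqxx big1 ?addr0 // => k.
  by rewrite (inj_eq inj) eq_sym => /negbTE ->.
split.
- by rewrite map_inj_uniq ?enum_uniq.
- by apply/allP => w /mapP[i _ ->].
- transitivity [seq (dcoef d, dreal d) |
      d <- [seq tnth (in_tuple form) i | i <- enum 'I_(size form)]].
    by rewrite map_tnth_enum.
  rewrite -!map_comp; apply: eq_map => i /=.
  rewrite div_f; congr (_, _); apply/idP/asboolP; first by move/(freal i).
  by move/(freal i).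
- move=> w wn; rewrite fdiv big1 // => i _; case: eqP => // wi.
  by case/negP: wn; rewrite wi map_f ?mem_enum.
Qed.

Lemma divisor_S_inf S w : at_infinity w -> divisor_S S w = (IPQ S w, ICZ S w).
Proof. by rewrite /divisor_S => ->. Qed.

Lemma has_form_Delta S form : has_form S form ->
  Delta_S S = sumn [seq (dcoef d).1 | d <- form].
Proof.
case/has_form_points => ws [uws winf codes off].
have -> : [seq (dcoef d).1 | d <- form] = [seq IPQ S w | w <- ws].
  have -> : [seq (dcoef d).1 | d <- form] =
      [seq x.1.1 | x <- [seq (dcoef d, dreal d) | d <- form]] by rewrite -map_comp.
  rewrite codes -map_comp; apply/eq_in_map => w /(allP winf) wi /=.
  by rewrite divisor_S_inf.
rewrite /Delta_S (fsbigE ws) //.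
- rewrite sumnE big_map big_seq_cond [RHS]big_seq; apply: eq_bigl => w.
  by case: (boolP (w \in ws)) => //= /(allP winf) wi; apply/asboolP.
- by move=> w /= /(allP winf).
- by move=> w wi /off; rewrite divisor_S_inf // => -[].
Qed.

Lemma has_form_MC S form : has_form S form ->
  M_C S = foldr maxn 0%N [seq (dcoef d).2 | d <- form].
Proof.
case/has_form_points => ws [uws winf codes off].
have -> : [seq (dcoef d).2 | d <- form] = [seq ICZ S w | w <- ws].
  have -> : [seq (dcoef d).2 | d <- form] =
      [seq x.1.2 | x <- [seq (dcoef d, dreal d) | d <- form]] by rewrite -map_comp.
  rewrite codes -map_comp; apply/eq_in_map => w /(allP winf) wi /=.
  by rewrite divisor_S_inf.
rewrite /M_C (fsbigE ws) //.
- rewrite foldrE big_map big_seq_cond [RHS]big_seq; apply: eq_bigl => w.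
  by case: (boolP (w \in ws)) => //= /(allP winf) wi; apply/asboolP.
- by move=> w /= /(allP winf).
- by move=> w wi /off; rewrite divisor_S_inf // => -[].
Qed.

(** When all coefficients are nonzero, the points of a form are the support of the divisor, so two
    forms differ only in the order of their terms. *)
Lemma has_form_perm S form form' :
  all (fun d => dcoef d != 0) form -> all (fun d => dcoef d != 0) form' ->
  has_form S form -> has_form S form' ->
  perm_eq [seq (dcoef d, dreal d) | d <- form] [seq (dcoef d, dreal d) | d <- form'].
Proof.
move=> nz nz' /has_form_points[ws [u _ c off]] /has_form_points[ws' [u' _ c' off']].
have mem (f : seq dterm) (s : seq (P2 R)) : all (fun d => dcoef d != 0) f ->
    [seq (dcoef d, dreal d) | d <- f] = [seq (divisor_S S w, `[< real_point w >]) | w <- s] ->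
    (forall w, w \notin s -> divisor_S S w = 0) ->
    forall w, (w \in s) = (divisor_S S w != 0).
  move=> nzf cf offs w; apply/idP/idP => [ws0|]; last exact/contraNT/(fun h => introT eqP (offs w h)).
  have : (divisor_S S w, `[< real_point w >]) \in [seq (dcoef d, dreal d) | d <- f].
    by rewrite cf; apply: (map_f (fun w => (divisor_S S w, `[< real_point w >]))).
  have nz1 : all (fun x : nat * nat * bool => x.1 != 0) [seq (dcoef d, dreal d) | d <- f].
    by rewrite all_map.
  by move/(allP nz1).
rewrite c c'; apply: perm_map; apply: uniq_perm => // w.
by rewrite (mem _ _ nz c off) (mem _ _ nz' c' off').
Qed.

(** The divisor is given by two lists of points with repetition; any duplicate-free list [ps]
    containing them carries a form. [w0] is only the default value of [nth]. *)
Lemma has_form_lists w0 S (pss pcc ps : seq (P2 R)) (bs : seq bool) :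
  (forall w, at_infinity w -> IPQ S w = count_mem w pss /\ ICZ S w = count_mem w pcc) ->
  uniq ps -> all (@at_infinity R) ps -> size bs = size ps ->
  all (mem ps) pss -> all (mem ps) pcc ->
  (forall i, (i < size ps)%N -> real_point (nth w0 ps i) <-> nth false bs i) ->
  has_form S [seq DTerm (count_mem x.1 pss, count_mem x.1 pcc) x.2 | x <- zip ps bs].
Proof.
move=> hD ups psinf sz sss scc hreal; set form := map _ _.
have szf : size form = size ps by rewrite size_map size_zip sz minnn.
have nthf (i : 'I_(size form)) : tnth (in_tuple form) i =
    DTerm (count_mem (nth w0 ps i) pss, count_mem (nth w0 ps i) pcc) (nth false bs i).
  rewrite (tnth_nth (DTerm (0, 0)%N false)) /= (nth_map (w0, false)); last first.
    by rewrite size_zip sz minnn -szf.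
  by rewrite nth_zip.
exists (fun i => nth w0 ps i); split.
- move=> i k /eqP; rewrite nth_uniq -?szf // => /eqP; exact: val_inj.
- by move=> i; apply: (allP psinf); rewrite mem_nth // -szf.
- by move=> i; rewrite nthf /=; apply: hreal; rewrite -szf.
move=> w; under eq_bigr do rewrite nthf /=.
have -> : \sum_(i < size form) (if w == nth w0 ps i then
    (count_mem (nth w0 ps i) pss, count_mem (nth w0 ps i) pcc) else 0 : nat * nat) =
    \sum_(p <- ps) (if w == p then (count_mem p pss, count_mem p pcc) else 0).
  by rewrite (big_nth w0) big_mkord szf.
have [wps|wps] := boolP (w \in ps).
  rewrite (bigD1_seq w) //= eqxx big1 ?addr0 => [|p]; last first.
    by rewrite eq_sym => /negbTE ->.
  by have winf := allP psinf w wps; rewrite divisor_S_inf //; have [-> ->] := hD w winf.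
rewrite big_seq big1; last by move=> p pps; case: eqP => // wp; rewrite wp pps in wps.
rewrite /divisor_S; case: ifP => // winf; have [-> ->] := hD w winf.
rewrite !(count_memPn _) //.
  by apply: contra wps => wi; exact: (allP scc).
by apply: contra wps => wi; exact: (allP sss).
Qed.

End DivisorForms.

Section CountLists.
Variable T : eqType.
Implicit Types (p q t : T) (s : seq T).

Lemma uniq3I p q t : p != q -> p != t -> q != t -> uniq [:: p; q; t].
Proof. by rewrite /= !inE negb_or => -> -> ->. Qed.

Lemma count_nseq3 p q t (a b c : nat) s :
  perm_eq s (nseq a p ++ nseq b q ++ nseq c t) -> uniq [:: p; q; t] ->
  [/\ count_mem p s = a, count_mem q s = b, count_mem t s = c
    & all (mem [:: p; q; t]) s].
Proof.
move=> ps; rewrite !(permP ps) (perm_all _ ps) !count_cat !count_nseq !all_cat !all_nseq /=.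
rewrite !inE !eqxx negb_or !orbT [q == p]eq_sym [t == p]eq_sym [t == q]eq_sym.
case/and3P=> /andP[/negbTE -> /negbTE ->] /negbTE -> _.
by rewrite !mul1n !mul0n !addn0.
Qed.

Lemma count_nseq2 p q (a b : nat) s :
  perm_eq s (nseq a p ++ nseq b q) -> p != q ->
  [/\ count_mem p s = a, count_mem q s = b & all (mem [:: p; q]) s].
Proof.
move=> ps; rewrite !(permP ps) (perm_all _ ps) !count_cat !count_nseq !all_cat !all_nseq /=.
rewrite !inE !eqxx !orbT [q == p]eq_sym => /negbTE ->.
by rewrite !mul1n !mul0n !addn0.
Qed.

Lemma count_nseq1 p (a : nat) : count_mem p (nseq a p) = a /\ all (mem [:: p]) (nseq a p).
Proof. by rewrite count_nseq all_nseq /= eqxx mul1n !inE eqxx orbT. Qed.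

End CountLists.

Section Classification.
Variable R : realType.
Local Notation CC := R[i].
Local Notation "x %:C" := (real_complex R x).
Implicit Types (S : qsys R) (p q t w : P2 R).

Definition divisor_lists S (pss pcc : seq (P2 R)) : Prop :=
  forall w, at_infinity w -> IPQ S w = count_mem w pss /\ ICZ S w = count_mem w pcc.

Lemma divisor_listsI S (ss cc : seq (CC * CC)) : IPQ_roots S ss ->
  (forall w, at_infinity w -> ICZ S w = count (fun r => w == pt r) cc) ->
  divisor_lists S [seq pt s | s <- ss] [seq pt s | s <- cc].
Proof.
move=> [_ hP] hC w winf; rewrite hP // hC // !count_map.
by split; apply: eq_count => r; rewrite /= eq_sym.
Qed.

Lemma eq_form S form form' : form = form' -> has_form S form -> has_form S form'.
Proof. by move=> <-. Qed.

Lemma has_form3 S pss pcc p q t a b c (bp bq bt : bool) :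
  divisor_lists S pss pcc -> perm_eq pss (nseq a p ++ nseq b q ++ nseq c t) ->
  perm_eq pcc [:: p; q; t] -> uniq [:: p; q; t] ->
  [/\ at_infinity p, at_infinity q & at_infinity t] ->
  [/\ real_point p <-> bp, real_point q <-> bq & real_point t <-> bt] ->
  has_form S [:: DTerm (a, 1%N) bp; DTerm (b, 1%N) bq; DTerm (c, 1%N) bt].
Proof.
move=> hD pss' pcs u [ip iq it] [hp hq ht].
have pinf : all (@at_infinity R) [:: p; q; t] by rewrite /= ip iq it.
have hr i : (i < 3)%N -> real_point (nth p [:: p; q; t] i) <-> nth false [:: bp; bq; bt] i.
  by case: i => [|[|[|i]]].
have [cp cq ct sub] := count_nseq3 pss' u.
have [cp' cq' ct' sub'] := @count_nseq3 _ p q t 1 1 1 _ pcs u.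
have H : has_form S [:: DTerm (count_mem p pss, count_mem p pcc) bp;
    DTerm (count_mem q pss, count_mem q pcc) bq; DTerm (count_mem t pss, count_mem t pcc) bt].
  exact: (has_form_lists hD u pinf (erefl : size [:: bp; bq; bt] = 3) sub sub' hr).
apply: eq_form H; exact: (f_equal3 (fun x y z => [:: DTerm x bp; DTerm y bq; DTerm z bt])
  (f_equal2 pair cp cp') (f_equal2 pair cq cq') (f_equal2 pair ct ct')).
Qed.

Lemma has_form2 S pss pcc p q a b :
  divisor_lists S pss pcc -> perm_eq pss (nseq a p ++ nseq b q) ->
  perm_eq pcc [:: p; q; q] -> p != q ->
  at_infinity p /\ at_infinity q -> real_point p /\ real_point q ->
  has_form S [:: DTerm (a, 1%N) true; DTerm (b, 2%N) true].
Proof.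
move=> hD pss' pcs pq [ip iq] [hp hq].
have u : uniq [:: p; q] by rewrite /= inE pq.
have pinf : all (@at_infinity R) [:: p; q] by rewrite /= ip iq.
have hr i : (i < 2)%N -> real_point (nth p [:: p; q] i) <-> nth false [:: true; true] i.
  by case: i => [|[|i]].
have [cp cq sub] := count_nseq2 pss' pq.
have [cp' cq' sub'] := @count_nseq2 _ p q 1 2 _ pcs pq.
have H : has_form S [:: DTerm (count_mem p pss, count_mem p pcc) true;
    DTerm (count_mem q pss, count_mem q pcc) true].
  exact: (has_form_lists hD u pinf (erefl : size [:: true; true] = 2) sub sub' hr).
apply: eq_form H; exact: (f_equal2 (fun x y => [:: DTerm x true; DTerm y true])
  (f_equal2 pair cp cp') (f_equal2 pair cq cq')).
Qed.

Lemma has_form1 S p a : divisor_lists S (nseq a p) [:: p; p; p] -> at_infinity p ->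
  real_point p -> has_form S [:: DTerm (a, 3%N) true].
Proof.
move=> hD ip hp; have pinf : all (@at_infinity R) [:: p] by rewrite all_seq1.
have hr i : (i < 1)%N -> real_point (nth p [:: p] i) <-> nth false [:: true] i.
  by case: i.
have [cp sub] := count_nseq1 p a; have [cp' sub'] := count_nseq1 p 3.
have u : uniq [:: p] by [].
have H : has_form S [:: DTerm (count_mem p (nseq a p), count_mem p [:: p; p; p]) true].
  exact: (has_form_lists hD u pinf (erefl : size [:: true] = 1) sub sub' hr).
apply: eq_form H; exact: (f_equal (fun x => [:: DTerm x true]) (f_equal2 pair cp cp')).
Qed.

(* The roots s, s' of h relative to the root r of C_2 = (r_2 x - r_1 y) h: the double
   root of C_2 is s = s' in OtherDouble and s = r in SelfDouble. *)
Inductive cubic_type S (r : R * R) (h0 h1 h2 : R) : CC * CC -> CC * CC -> Prop :=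
| ThreeReal (a b : R * R) of a != 0 & b != 0 & I1 S & qval h0 h1 h2 r.1 r.2 != 0
    & uniq [:: pt (rpair r); pt (rpair a); pt (rpair b)] :
    cubic_type S r h0 h1 h2 (rpair a) (rpair b)
| OneReal (z z' : CC) of complex.Im z != 0 & complex.Im z' != 0 & I2 S
    & qval h0 h1 h2 r.1 r.2 != 0 & uniq [:: pt (rpair r); pt (z, 1); pt (z', 1)] :
    cubic_type S r h0 h1 h2 (z, 1) (z', 1)
| OtherDouble (a b : R * R) of a != 0 & b != 0 & I3 S & qval h0 h1 h2 r.1 r.2 != 0
    & h1 ^+ 2 - h0 * h2 *+ 4 = 0 & pt (rpair b) = pt (rpair a)
    & pt (rpair r) != pt (rpair a) :
    cubic_type S r h0 h1 h2 (rpair a) (rpair b)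
| SelfDouble (v1 v2 : R) of (- v2, v1) != 0 & I3 S & qval h0 h1 h2 r.1 r.2 = 0
    & h0 = r.2 * v1 & h1 = r.2 * v2 - r.1 * v1 & h2 = - (r.1 * v2)
    & pt (rpair (- v2, v1)) != pt (rpair r) :
    cubic_type S r h0 h1 h2 (rpair r) (rpair (- v2, v1))
| Triple (v : R * R) of v != 0 & I4 S & qval h0 h1 h2 r.1 r.2 = 0
    & pt (rpair v) = pt (rpair r) :
    cubic_type S r h0 h1 h2 (rpair r) (rpair v).

Lemma pt_rpair_eq (a b : R * R) : a != 0 -> b != 0 ->
  (pt (rpair a) == pt (rpair b)) = (a.1 * b.2 == a.2 * b.1).
Proof.
move=> a0 b0; rewrite eq_pt_pt ?rpair_neq0 // /rpair /=.
by rewrite -!(rmorphM (real_complex R)) (inj_eq (fmorph_inj _)).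
Qed.

Lemma quad_roots_eval h0 h1 h2 e s s' (x y : R) : quad_roots h0 h1 h2 e s s' ->
  (qval h0 h1 h2 x y)%:C = e * ((s.2 * x%:C - s.1 * y%:C) * (s'.2 * x%:C - s'.1 * y%:C)).
Proof.
case=> q0 q1 q2.
transitivity (h0%:C * x%:C ^+ 2 + h1%:C * x%:C * y%:C + h2%:C * y%:C ^+ 2).
  by rewrite /qval; ring.
by rewrite q0 q1 q2; ring.
Qed.

Lemma quad_roots_pt h0 h1 h2 e s s' (a : R * R) : quad_roots h0 h1 h2 e s s' ->
  e != 0 -> s != 0 -> s' != 0 -> a != 0 ->
  (qval h0 h1 h2 a.1 a.2 == 0) = (pt (rpair a) == pt s) || (pt (rpair a) == pt s').
Proof.
move=> q e0 s0 s'0 a0.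
transitivity ((qval h0 h1 h2 a.1 a.2)%:C == 0); first by rewrite fmorph_eq0.
rewrite (quad_roots_eval _ _ q) !mulf_eq0 (negbTE e0) /= !eq_pt_pt ?rpair_neq0 // /rpair /=.
by congr (_ || _); rewrite subr_eq0 eq_sym mulrC [_ * a.1%:C]mulrC.
Qed.

(** As eta = Disc(h) h(r)^2, the sign of Disc(h) sorts the cases with h(r) nonzero; if h(r) = 0, the
    vanishing of M separates a triple root from a double one. *)
Lemma cubic_sort S (r : R * R) h0 h1 h2 : r != 0 ->
  C2_split S r.1 r.2 h0 h1 h2 -> [|| h0 != 0, h1 != 0 | h2 != 0] ->
  exists e s s', [/\ e != 0, s != 0, s' != 0, quad_roots h0 h1 h2 e s s'
    & cubic_type S r h0 h1 h2 s s'].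
Proof.
move=> r0 hC hn; have etaS := eta_split hC.
have r0' : (r.1 != 0) || (r.2 != 0).
  by move: r0; case: (r) => a b; rewrite xpair_eqE negb_and.
have realroots (e : R) (a b : R * R) : h0 = e * (a.2 * b.2) ->
    h1 = - (e * (a.2 * b.1 + a.1 * b.2)) -> h2 = e * (a.1 * b.1) ->
    quad_roots h0 h1 h2 e%:C (rpair a) (rpair b).
  move=> -> -> ->; rewrite /rpair; split=> /=; ring.
have [q0|qn] := eqVneq (qval h0 h1 h2 r.1 r.2) 0.
  have [v1 [v2 [e0 e1 e2]]] := bquad_root r0' q0.
  have q : quad_roots h0 h1 h2 1%:C (rpair r) (rpair (- v2, v1)).
    by apply: realroots; rewrite ?e0 ?e1 ?e2 /=; ring.
  have v0 : (- v2, v1) != 0 :> R * R.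
    apply: contraTneq hn => -[/eqP]; rewrite oppr_eq0 => /eqP z2 z1.
    by rewrite e0 e1 e2 z1 z2 !mulr0 subr0 oppr0 eqxx.
  have hM : C2_split S r.1 r.2 (r.2 * v1) (r.2 * v2 - r.1 * v1) (- (r.1 * v2)).
    by rewrite -e0 -e1 -e2.
  have MS := M_split_root_eq0 r0' hM.
  exists 1%:C, (rpair r), (rpair (- v2, v1)); rewrite rmorph1 oner_neq0 !rpair_neq0 r0 v0.
  split => //; have ptE : (pt (rpair (- v2, v1)) == pt (rpair r)) = (Mform S == 0).
    by rewrite MS pt_rpair_eq //= eq_sym mulNr -subr_eq0 opprK.
  have [M0|M0] := eqVneq (Mform S) 0; last first.
    by apply: SelfDouble; rewrite ?ptE //; split; rewrite // etaS q0 expr0n mulr0.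
  by apply: Triple; rewrite //; apply/eqP; rewrite ptE M0 eqxx.
have Mn := M_split_neq0 hC qn.
have q2 : 0 < qval h0 h1 h2 r.1 r.2 ^+ 2 by rewrite exprn_even_gt0.
have off e s s' : quad_roots h0 h1 h2 e s s' -> e != 0 -> s != 0 -> s' != 0 ->
    (pt (rpair r) != pt s) && (pt (rpair r) != pt s').
  move=> q e0 s0 s'0; rewrite -negb_or -(quad_roots_pt q e0 s0 s'0 r0).
  exact: qn.
have [disc|disc] := ltP (h1 ^+ 2 - h0 * h2 *+ 4) 0.
  have [e [z [z' [e0 iz iz' zz' q]]]] := complex_quad_roots disc.
  have z0 (u : CC) : (u, 1) != 0 :> CC * CC by rewrite xpair_eqE oner_eq0 andbF.
  exists e, (z, 1), (z', 1); split => //; have /andP[n1 n2] := off _ _ _ q e0 (z0 z) (z0 z').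
  apply: OneReal => //; first by rewrite /I2 etaS nmulr_rlt0.
  have n3 : pt (z, 1) != pt (z', 1) by rewrite eq_pt_pt //= mulr1 mul1r.
  exact: uniq3I n1 n2 n3.
have [e [a [b [e0 a0 b0 [q0' q1' q2']]]]] := real_quad_roots hn disc.
have q := realroots _ _ _ q0' q1' q2'.
have eC : e%:C != 0 by rewrite fmorph_eq0.
have aC : rpair a != 0 by rewrite rpair_neq0.
have bC : rpair b != 0 by rewrite rpair_neq0.
exists e%:C, (rpair a), (rpair b); split => //.
have /andP[n1 n2] := off _ _ _ q eC aC bC.
have discE : h1 ^+ 2 - h0 * h2 *+ 4 = e ^+ 2 * (a.1 * b.2 - a.2 * b.1) ^+ 2.
  by rewrite q0' q1' q2'; ring.
have [d0|dn] := eqVneq (h1 ^+ 2 - h0 * h2 *+ 4) 0.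
  apply: OtherDouble => //; first by split; rewrite // etaS d0 mul0r.
  apply/eqP; rewrite pt_rpair_eq //.
  move/eqP: d0; rewrite discE mulf_eq0 !expf_eq0 /= (negbTE e0) /= subr_eq0 => /eqP E.
  by apply/eqP; rewrite mulrC -E mulrC.
apply: ThreeReal => //; first by rewrite /I1 etaS mulr_gt0 // lt_neqAle eq_sym dn.
apply: (uniq3I n1 n2); rewrite pt_rpair_eq //.
by apply: contraNneq dn => E; rewrite discE E subrr expr0n mulr0.
Qed.

End Classification.

(** * Classification *)

Section PermLists.
Variable T : eqType.
Implicit Types p q t f : T.

Lemma perm_extra_l k p q t f : ((0 < k)%N -> f = p) ->
  perm_eq (p :: q :: nseq k f) (nseq k.+1 p ++ nseq 1 q ++ nseq 0 t).
Proof.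
case: k => [|k] fp; first exact: perm_refl.
by rewrite fp //; apply/permP => g; rewrite /= count_cat !count_nseq /=; lia.
Qed.

Lemma perm_extra_r k p q t f : ((0 < k)%N -> f = q) ->
  perm_eq (p :: q :: nseq k f) (nseq k.+1 q ++ nseq 1 p ++ nseq 0 t).
Proof.
move=> fq; apply: perm_trans (perm_extra_l p t fq).
by apply/permP => g /=; rewrite !addnA [(g p + _)%N]addnC.
Qed.

Lemma perm_extra_lr k p q f : ((0 < k)%N -> f = p) ->
  perm_eq (p :: q :: nseq k f) (nseq 1 q ++ nseq k.+1 p).
Proof.
move=> fp; apply: perm_trans (perm_extra_l q p fp) _.
by rewrite cats0 perm_catC.
Qed.

Lemma perm_pair_pair p q t : perm_eq [:: p; q; p; q] (nseq 2 p ++ nseq 2 q ++ nseq 0 t).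
Proof. by apply/permP => g /=; lia. Qed.

Lemma perm_pair_swap p q : perm_eq [:: p; q; p; q] (nseq 2 q ++ nseq 2 p).
Proof. by apply/permP => g /=; lia. Qed.

Lemma perm_swap3 p q t : perm_eq [:: t; p; q] [:: p; q; t].
Proof. by apply/permP => g /=; lia. Qed.

Lemma perm_rev3 p q t : perm_eq [:: t; p; q] [:: q; p; t].
Proof. by apply/permP => g /=; lia. Qed.

Lemma nseq_extra k p f : ((0 < k)%N -> f = p) -> p :: p :: nseq k f = nseq k.+2 p.
Proof. by case: k => [|k] // ->. Qed.

Lemma uniq3_rot p q t : uniq [:: t; p; q] -> uniq [:: p; q; t].
Proof. by rewrite (perm_uniq (perm_swap3 p q t)). Qed.

Lemma uniq3_rev p q t : uniq [:: t; p; q] -> uniq [:: q; p; t].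
Proof. by rewrite (perm_uniq (perm_rev3 p q t)). Qed.

End PermLists.

Section Cases.
Variable R : realType.
Local Notation CC := R[i].
Local Notation "x %:C" := (real_complex R x).
Implicit Types (S : qsys R) (p q t w : P2 R).

Definition classified S := exists j : 'I_36,
  row_cond (tnth (Sigma R) j) S /\ has_form S (row_form (tnth (Sigma R) j)).

Lemma classifiedI S (j : 'I_36) : row_cond (tnth (Sigma R) j) S ->
  has_form S (row_form (tnth (Sigma R) j)) -> classified S.
Proof. by exists j. Qed.

Lemma real_rpair (a : R * R) : a != 0 -> real_point (pt (rpair a)) <-> true.
Proof. by move=> a0; split=> // _; apply: real_pt; rewrite -/(rpair a) rpair_neq0. Qed.

Lemma inf_rpair (a : R * R) : a != 0 -> at_infinity (pt (rpair a)).
Proof. by move=> a0; apply: at_infinity_pt; rewrite rpair_neq0. Qed.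

Lemma nonreal_affine (z : CC) : complex.Im z != 0 -> real_point (pt (z, 1)) <-> false.
Proof. by move=> z0; split=> // /(nonreal_pt z0). Qed.

Lemma inf_affine (z : CC) : at_infinity (pt (z, 1)).
Proof. by apply: at_infinity_pt; rewrite xpair_eqE oner_eq0 andbF. Qed.

Lemma pair_neq0 (a b : R) : (a != 0) || (b != 0) -> (a, b) != 0 :> R * R.
Proof. by rewrite xpair_eqE negb_and. Qed.

(** Rows are numbered from 0, so index j stands for Sigma_(j+1). *)
Local Notation "j %:row" := (@Ordinal 36 j isT) (at level 2).

Local Ltac solve_points :=
  by split; rewrite ?inf_rpair ?inf_affine ?real_rpair ?nonreal_affine.

Section Cubic.
Variables (S : qsys R) (r : R * R) (h0 h1 h2 : R) (s s' : CC * CC).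
Hypotheses (r0 : r != 0) (ct : cubic_type S r h0 h1 h2 s s').

(** For systems whose only possible common point at infinity is the chosen real root r of C_2; m = 0
    covers the absence of common points. *)
Lemma classify_nseq m : divisor_lists S (nseq m (pt (rpair r))) [:: pt (rpair r); pt s; pt s'] ->
  let z := qval h0 h1 h2 r.1 r.2 in
  [\/ I1 S /\ z != 0 /\
        has_form S [:: DTerm (m, 1%N) true; DTerm (0, 1)%N true; DTerm (0, 1)%N true],
      I2 S /\ z != 0 /\
        has_form S [:: DTerm (m, 1%N) true; DTerm (0, 1)%N false; DTerm (0, 1)%N false],
      I3 S /\ z != 0 /\ has_form S [:: DTerm (m, 1%N) true; DTerm (0, 2)%N true]
    | z = 0 /\ (I3 S /\ has_form S [:: DTerm (0, 1)%N true; DTerm (m, 2%N) true] \/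
                I4 S /\ has_form S [:: DTerm (m, 3%N) true])].
Proof.
have rr := real_rpair r0; have ri := inf_rpair r0.
case: ct => [a b a0 b0 hI z0 u|z z' zi zi' hI z0 u|a b a0 b0 hI z0 d0 e n|v1 v2 v0 hI z0 e0 e1 e2 n|v v0 hI z0 e] hD.
- apply: Or41; split=> //; split=> //; apply: (has_form3 hD) u _ _ => //.
  + by rewrite cats0.
  + solve_points.
  + solve_points.
- apply: Or42; split=> //; split=> //; apply: (has_form3 hD) u _ _ => //.
  + by rewrite cats0.
  + solve_points.
  + solve_points.
- apply: Or43; split=> //; split=> //; rewrite e in hD; apply: (has_form2 hD) n _ _ => //.
  + by rewrite cats0.
  + solve_points.
  + solve_points.
- apply: Or44; split=> //; left; split=> //; apply: (has_form2 hD) n _ _ => //.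
  + exact: perm_rev3.
  + solve_points.
  + solve_points.
- apply: Or44; split=> //; right; split=> //; rewrite e in hD; apply: (has_form1 hD) => //.
  by rewrite rr.
Qed.

Lemma classify_pairs :
  divisor_lists S [:: pt s; pt s'; pt s; pt s'] [:: pt (rpair r); pt s; pt s'] ->
  (I1 S /\ has_form S [:: DTerm (2, 1)%N true; DTerm (2, 1)%N true; DTerm (0, 1)%N true] \/
   I2 S /\ has_form S [:: DTerm (0, 1)%N true; DTerm (2, 1)%N false; DTerm (2, 1)%N false]) \/
  [\/ [/\ I3 S, h1 ^+ 2 - h0 * h2 *+ 4 = 0
        & has_form S [:: DTerm (0, 1)%N true; DTerm (4, 2)%N true]],
      I3 S /\ exists v1 v2, [/\ h0 = r.2 * v1, h1 = r.2 * v2 - r.1 * v1, h2 = - (r.1 * v2)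
        & has_form S [:: DTerm (2, 1)%N true; DTerm (2, 2)%N true]]
    | I4 S /\ has_form S [:: DTerm (4, 3)%N true]].
Proof.
have rr := real_rpair r0; have ri := inf_rpair r0.
case: ct => [a b a0 b0 hI z0 u|z z' zi zi' hI z0 u|a b a0 b0 hI z0 d0 e n|v1 v2 v0 hI z0 e0 e1 e2 n|v v0 hI z0 e] hD.
- left; left; split=> //; apply: (has_form3 hD) (uniq3_rot u) _ _.
  + exact: perm_pair_pair.
  + exact: perm_swap3.
  + solve_points.
  + solve_points.
- left; right; split=> //; apply: (has_form3 hD) u _ _ => //.
  + exact: (perm_pair_pair _ _ (pt (rpair r))).
  + solve_points.
  + solve_points.
- right; apply: Or31; split=> //; rewrite e in hD; apply: (has_form2 hD) n _ _ => //.
  + solve_points.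
  + solve_points.
- right; apply: Or32; split=> //; exists v1, v2; split=> //; apply: (has_form2 hD) n _ _ => //.
  + exact: perm_pair_swap.
  + exact: perm_rev3.
  + solve_points.
  + solve_points.
- right; apply: Or33; split=> //; rewrite e in hD; apply: (has_form1 (a := 4) hD) => //.
  by rewrite rr.
Qed.

(** For a degenerate member Z times a line, whose real point at infinity f adds k to one of the
    roots of h. Non-real roots leave no place for f, so k = 0. When r is a double root of C_2, the
    row depends on whether f is r. *)
Lemma classify_extra k (f : R * R) : f != 0 ->
  divisor_lists S (pt s :: pt s' :: nseq k (pt (rpair f))) [:: pt (rpair r); pt s; pt s'] ->
  ((0 < k)%N -> pt (rpair f) = pt s \/ pt (rpair f) = pt s') ->
  (I1 S /\ has_form S [:: DTerm (k.+1, 1%N) true; DTerm (1, 1)%N true; DTerm (0, 1)%N true] \/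
   [/\ I2 S, k = 0%N
     & has_form S [:: DTerm (0, 1)%N true; DTerm (1, 1)%N false; DTerm (1, 1)%N false]]) \/
  [\/ [/\ I3 S, h1 ^+ 2 - h0 * h2 *+ 4 = 0
        & has_form S [:: DTerm (0, 1)%N true; DTerm (k.+2, 2%N) true]],
      I3 S /\ exists v1 v2, [/\ h0 = r.2 * v1, h1 = r.2 * v2 - r.1 * v1, h2 = - (r.1 * v2)
        & ((0 < k)%N -> pt (rpair f) = pt (rpair r)) /\
            has_form S [:: DTerm (1, 1)%N true; DTerm (k.+1, 2%N) true] \/
          ((0 < k)%N -> pt (rpair f) != pt (rpair r)) /\
            has_form S [:: DTerm (k.+1, 1%N) true; DTerm (1, 2)%N true]]
    | I4 S /\ has_form S [:: DTerm (k.+2, 3%N) true]].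
Proof.
have rr := real_rpair r0; have ri := inf_rpair r0 => f0.
have split_or (A B : Prop) : ((0 < k)%N -> A \/ B) -> ((0 < k)%N -> A) \/ ((0 < k)%N -> B).
  by case: (k) => [|n] H; [left | case: (H isT) => h; [left|right]].
case: ct => [a b a0 b0 hI z0 u|z z' zi zi' hI z0 u|a b a0 b0 hI z0 d0 e n|v1 v2 v0 hI z0 e0 e1 e2 n|v v0 hI z0 e] hD hf.
- left; left; split=> //; have [fa|fb] := split_or _ _ hf.
  + apply: (has_form3 hD) (uniq3_rot u) _ _.
    * exact: perm_extra_l.
    * exact: perm_swap3.
    * solve_points.
    * solve_points.
  + apply: (has_form3 hD) (uniq3_rev u) _ _.
    * exact: perm_extra_r.
    * exact: perm_rev3.
    * solve_points.
    * solve_points.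
- have k0 : k = 0%N.
    case: k hf {hD split_or} => // n [] // E.
      by case: (nonreal_pt zi); rewrite -E real_rpair.
    by case: (nonreal_pt zi'); rewrite -E real_rpair.
  left; right; split=> //; rewrite k0 in hD; apply: (has_form3 hD) u _ _ => //.
  + solve_points.
  + solve_points.
- right; apply: Or31; split=> //; rewrite e in hD hf; apply: (has_form2 hD) n _ _ => //.
  + by rewrite nseq_extra // => /hf[].
  + solve_points.
  + solve_points.
- right; apply: Or32; split=> //; exists v1, v2; split=> //.
  have [fr|fn] := eqVneq (pt (rpair f)) (pt (rpair r)).
    left; split=> //; apply: (has_form2 hD) n _ _ => //.
    + by apply: perm_extra_lr => _.
    + exact: perm_rev3.
    + solve_points.
    + solve_points.
  right; split=> //; apply: (has_form2 hD) n _ _ => //.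
  + by apply: (perm_extra_r _ (pt (rpair r))) => /hf[] // E; rewrite E eqxx in fn.
  + exact: perm_rev3.
  + solve_points.
  + solve_points.
- right; apply: Or33; split=> //; rewrite e in hD hf.
  rewrite nseq_extra in hD; last by move=> /hf[].
  by apply: (has_form1 hD); rewrite ?rr.
Qed.

End Cubic.
Lemma classify_no_common_root S : QSess S -> top_res S != 0 -> classified S.
Proof.
move=> hS /intersection_no_common_root[hP hmu].
have [r1 [r2 [h0 [h1 [h2 [r0 hC]]]]]] := C2_split_exists S.
have hn := C2_split_neq0 (C2_neq0 hS) hC; have r0' := pair_neq0 r0.
have [e [s [s' [e0 s0 s'0 q ct]]]] := @cubic_sort _ S (r1, r2) _ _ _ r0' hC hn.
have hD := divisor_listsI hP (ICZ_roots r0 hC q e0 s0 s'0).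
have [[hI [_ H]]|[hI [_ H]]|[hI [_ H]]|[_ [[hI H]|[hI H]]]] := classify_nseq r0' ct (m := 0) hD.
- exact: (@classifiedI S 0%:row (conj hmu hI) H).
- exact: (@classifiedI S 1%:row (conj hmu hI) H).
- exact: (@classifiedI S 2%:row (conj hmu hI) H).
(* Now r is the double root rather than the simple one, but with m = 0 the form is the same. *)
- exact: (@classifiedI S 2%:row (conj hmu hI) H).
- exact: (@classifiedI S 3%:row (conj hmu hI) H).
Qed.

(** The common point is a root of C_2, simple exactly if kappa is nonzero. At a double root
    [common_factor_L] gives L nonzero, so the rows with L = 0 are left to proportional quadratic
    parts. *)
Lemma classify_common_factor S : QSess S -> Kform S != 0 -> top_res S = 0 -> classified S.
Proof.
move=> hS hK /(common_factor_exists hK)[r1 [r2 [u1 [u2 [v1 [v2 [r0 HS J0]]]]]]].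
have hC := common_factor_split HS.
have hn := C2_split_neq0 (C2_neq0 hS) hC; have r0' := pair_neq0 r0.
have [e [s [s' [e0 s0 s'0 q ct]]]] := @cubic_sort _ S (r1, r2) _ _ _ r0' hC hn.
have [_ cop _] := hS; have [m [hm hP hmu]] := common_factor_divisor r0 HS J0 cop.
have hD := divisor_listsI hP (ICZ_roots r0 hC q e0 s0 s'0).
rewrite map_nseq in hD; have hk := common_factor_kappa HS J0.
have [[hI [z H]]|[hI [z H]]|[hI [z H]]|[/eqP z [[hI H]|[hI H]]]] := classify_nseq r0' ct hD.
- have k0 : kappa S != 0 by rewrite hk.
  case: m hm hmu {hP hD} H => [|[|[|[|[|//]]]]] // _ hmu H.
  + exact: (@classifiedI S 4%:row (conj hmu hI) H).
  + exact: (@classifiedI S 9%:row (And3 hmu k0 hI) H).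
  + exact: (@classifiedI S 17%:row (And3 hmu k0 hI) H).
  + exact: (@classifiedI S 25%:row (And3 hmu k0 hI) H).
- have k0 : kappa S != 0 by rewrite hk.
  case: m hm hmu {hP hD} H => [|[|[|[|[|//]]]]] // _ hmu H.
  + exact: (@classifiedI S 5%:row (conj hmu hI) H).
  + exact: (@classifiedI S 11%:row (And3 hmu k0 hI) H).
  + exact: (@classifiedI S 19%:row (conj hmu hI) H).
  + exact: (@classifiedI S 28%:row (And3 hmu k0 hI) H).
- have k0 : kappa S != 0 by rewrite hk.
  case: m hm hmu {hP hD} H => [|[|[|[|[|//]]]]] // _ hmu H.
  + exact: (@classifiedI S 6%:row (And3 hmu k0 hI) H).
  + exact: (@classifiedI S 13%:row (And3 hmu k0 hI) H).
  + exact: (@classifiedI S 20%:row (And3 hmu k0 hI) H).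
  + exact: (@classifiedI S 30%:row (And3 hmu k0 hI) H).
- have k0 : kappa S = 0 by apply/eqP; rewrite hk.
  have L0 : Lform S != 0 by apply: (common_factor_L r0 HS J0 (eqP z)); case: hI.
  case: m hm hmu {hP hD} H => [|[|[|[|[|//]]]]] // _ hmu H.
  + exact: (@classifiedI S 7%:row (And3 hmu k0 hI) H).
  + exact: (@classifiedI S 15%:row (And4 hmu k0 L0 hI) H).
  + exact: (@classifiedI S 23%:row (And4 hmu k0 L0 hI) H).
  + exact: (@classifiedI S 34%:row (And4 hmu k0 L0 hI) H).
- case: m hm hmu {hP hD} H => [|[|[|[|[|//]]]]] // _ hmu H.
  + exact: (@classifiedI S 8%:row (conj hmu hI) H).
  + exact: (@classifiedI S 16%:row (conj hmu hI) H).
  + exact: (@classifiedI S 24%:row (conj hmu hI) H).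
  + exact: (@classifiedI S 35%:row (conj hmu hI) H).
Qed.

Lemma classify_proportional S : QSess S -> Kform S = 0 -> classified S.
Proof.
move=> hS hK; have C20 := C2_neq0 hS.
have [c1 [c2 [h0 [h1 [h2 [c0 hn HS]]]]]] := proportional_exists hK C20.
have hC := proportional_split HS; have c0' := pair_neq0 c0.
have [e [s [s' [e0 s0 s'0 q ct]]]] := @cubic_sort _ S (c1, c2) _ _ _ c0' hC hn.
have [_ cop _] := hS; have [] := proportional_divisor c0 HS cop q e0 s0 s'0.
have hICZ := ICZ_roots c0 hC q e0 s0 s'0.
have k0 := proportional_kappa HS; have hK1 := proportional_K1 hn HS.
have hk1 := proportional_kappa1 c0 HS; have hL := proportional_L_root HS.
have hLd := proportional_L_double HS.
move: hK1 hk1; set f10 := _ - _; set f01 := c2 * S a01 - _ => hK1 hk1 hf1 hf0.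
have [f0|fn] := boolP ((f10 == 0) && (f01 == 0)).
  have [/eqP z1 /eqP z2] := andP f0; have [hP hmu] := hf0 z1 z2.
  have K10 : K1form S = 0 by apply/eqP; rewrite hK1.
  have hD := divisor_listsI hP hICZ.
  case: (classify_pairs c0' ct hD) => [[[hI H]|[hI H]]|[[hI d0 H]|[hI [v1 [v2 [e'0 e'1 e'2 H]]]]|[hI H]]].
  - exact: (@classifiedI S 27%:row (And4 hmu k0 K10 hI) H).
  - exact: (@classifiedI S 29%:row (And3 hmu k0 hI) H).
  - have L0 : Lform S != 0 by apply: (hLd d0); case: hI.
    exact: (@classifiedI S 34%:row (And4 hmu k0 L0 hI) H).
  - have L0 : Lform S = 0 := hL _ _ e'0 e'1 e'2.
    have k10 : kappa1 S = 0.
      apply/eqP; rewrite (hk1 _ _ e'0 e'1 e'2); last by case: hI.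
      by rewrite z1 z2 !mul0r addr0.
    exact: (@classifiedI S 32%:row (And5 (conj hmu k0) L0 k10 K10 hI) H).
  - exact: (@classifiedI S 35%:row (conj hmu hI) H).
have K10 : K1form S != 0 by rewrite hK1.
have f0 : (- f01, f10) != 0 :> R * R.
  by apply: pair_neq0; rewrite oppr_eq0 orbC -negb_and.
have [|k [hk hP hmu hkq]] := hf1; first by rewrite -negb_and.
have hD := divisor_listsI hP hICZ; rewrite /= map_nseq in hD.
have hf : (0 < k)%N -> pt (rpair (- f01, f10)) = pt s \/ pt (rpair (- f01, f10)) = pt s'.
  by rewrite hkq (quad_roots_pt q e0 s0 s'0 f0) => /orP[/eqP|/eqP]; [left|right].
have k1P v1 v2 : h0 = c2 * v1 -> h1 = c2 * v2 - c1 * v1 -> h2 = - (c1 * v2) -> I3 S ->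
    (kappa1 S == 0) = (pt (rpair (- f01, f10)) == pt (rpair (c1, c2))).
  move=> e'0 e'1 e'2 [_ M0]; rewrite (hk1 _ _ e'0 e'1 e'2 M0) pt_rpair_eq //=.
  by rewrite mulNr addr_eq0 [RHS]eq_sym.
case: (classify_extra c0' ct f0 hD hf) =>
  [[[hI H]|[hI kz H]]|[[hI d0 H]|[hI [v1 [v2 [e'0 e'1 e'2 H]]]]|[hI H]]].
- case: k hk hmu {hP hkq hD hf} H => [|[|[|//]]] _ hmu H.
  + exact: (@classifiedI S 10%:row (And3 hmu k0 hI) H).
  + exact: (@classifiedI S 18%:row (And3 hmu k0 hI) H).
  + exact: (@classifiedI S 26%:row (And4 hmu k0 K10 hI) H).
- rewrite kz in hmu; exact: (@classifiedI S 12%:row (And3 hmu k0 hI) H).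
- have L0 : Lform S != 0 by apply: (hLd d0); case: hI.
  case: k hk hmu {hP hkq hD hf} H => [|[|[|//]]] _ hmu H.
  + exact: (@classifiedI S 15%:row (And4 hmu k0 L0 hI) H).
  + exact: (@classifiedI S 23%:row (And4 hmu k0 L0 hI) H).
  + exact: (@classifiedI S 34%:row (And4 hmu k0 L0 hI) H).
- have L0 : Lform S = 0 := hL _ _ e'0 e'1 e'2; have hk1' := k1P _ _ e'0 e'1 e'2 hI.
  case: H => -[hfr H].
  + case: k hk hmu {hP hkq hD hf} hfr H => [|[|[|//]]] _ hmu hfr H.
    * exact: (@classifiedI S 14%:row (And4 hmu k0 L0 hI) H).
    * have k10 : kappa1 S = 0 by apply/eqP; rewrite hk1' hfr ?eqxx.
      exact: (@classifiedI S 22%:row (And5 hmu k0 L0 k10 hI) H).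
    * have k10 : kappa1 S = 0 by apply/eqP; rewrite hk1' hfr ?eqxx.
      exact: (@classifiedI S 33%:row (And5 (conj hmu k0) L0 k10 K10 hI) H).
  + case: k hk hmu {hP hkq hD hf} hfr H => [|[|[|//]]] _ hmu hfr H.
    (* With k = 0 the point f does not occur in the divisor, so both positions of f lead to
       Sigma_15. *)
    * exact: (@classifiedI S 14%:row (And4 hmu k0 L0 hI) H).
    * have k10 : kappa1 S != 0 by rewrite hk1' hfr.
      exact: (@classifiedI S 21%:row (And5 hmu k0 L0 k10 hI) H).
    * have k10 : kappa1 S != 0 by rewrite hk1' hfr.
      exact: (@classifiedI S 31%:row (And5 hmu k0 L0 k10 hI) H).
- case: k hk hmu {hP hkq hD hf} H => [|[|[|//]]] _ hmu H.
  + exact: (@classifiedI S 16%:row (conj hmu hI) H).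
  + exact: (@classifiedI S 24%:row (conj hmu hI) H).
  + exact: (@classifiedI S 35%:row (conj hmu hI) H).
Qed.

Lemma classification S : QSess S -> classified S.
Proof.
move=> hS; have [hK|hK] := eqVneq (Kform S) 0; first exact: classify_proportional.
have [hr|hr] := eqVneq (top_res S) 0; first exact: classify_common_factor.
exact: classify_no_common_root.
Qed.

End Cases.

(** * Mutual exclusion of the rows *)

Section Exclusive.
Variable R : realType.
Implicit Types (S : qsys R) (l : Defs.row R).

Definition form_code (form : seq dterm) := [seq (dcoef d, dreal d) | d <- form].

Lemma Sigma_consistent (j : 'I_36) : let l := tnth (Sigma R) j in
  [/\ row_Delta l = sumn [seq (dcoef d).1 | d <- row_form l],
      row_MC l = foldr maxn 0%N [seq (dcoef d).2 | d <- row_form l]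
    & all (fun d => dcoef d != 0) (row_form l)].
Proof.
pose ok l := [&& row_Delta l == sumn [seq (dcoef d).1 | d <- row_form l],
  row_MC l == foldr maxn 0%N [seq (dcoef d).2 | d <- row_form l]
  & all (fun d => dcoef d != 0) (row_form l)].
have /all_tnthP/(_ j)/and3P[/eqP e1 /eqP e2 e3] : all ok (Sigma R) by [].
exact: And3 e1 e2 e3.
Qed.

Lemma Sigma_form_inj (j j' : 'I_36) :
  perm_eq (form_code (row_form (tnth (Sigma R) j))) (form_code (row_form (tnth (Sigma R) j'))) ->
  j = j'.
Proof.
pose r l l' := ~~ perm_eq (form_code (row_form l)) (form_code (row_form l')).
have pw : pairwise r (Sigma R) by vm_compute.
have lt (i k : 'I_36) : (i < k)%N -> r (tnth (Sigma R) i) (tnth (Sigma R) k).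
  move=> ik; have x0 := tnth (Sigma R) i.
  by rewrite !(tnth_nth x0); apply: (pairwiseP x0 pw) ik; rewrite inE size_tuple ltn_ord.
move=> H; apply/val_inj; case: (ltngtP j j') => // /lt; rewrite /r ?H //.
by rewrite perm_sym H.
Qed.

Lemma has_rowP S (j : 'I_36) :
  has_row S (tnth (Sigma R) j) <-> has_form S (row_form (tnth (Sigma R) j)).
Proof.
have [dE mE _] := Sigma_consistent j; split=> [[]|H] //.
by split=> //; rewrite ?dE ?mE; [exact: has_form_Delta | exact: has_form_MC].
Qed.

Lemma mu_first_inj S m n : mu_first S m -> mu_first S n -> m = n.
Proof.
move=> [m0 m1] [n0 n1]; case: (ltngtP m n) => // [/n0 E|/m0 E]; [move: m1|move: n1];
by rewrite E eqxx.
Qed.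

(** The discriminant of the Hessian of a cubic is proportional to that of the cubic: m1^2 - 4 m0 m2
    = - 192 eta. *)
Lemma Mform_eta S : Mform S = 0 -> eta S = 0.
Proof.
rewrite MformE => /bquad_eq0[]; set m0 := _ *+ 2; set m1 := _ *+ 2; set m2 := _ *+ 2.
move=> z0 z1 z2; have : eta S *+ 192 = m0 * m2 *+ 4 - m1 ^+ 2.
  by rewrite etaE /m0 /m1 /m2; ring.
by rewrite z0 z1 z2 mul0r mul0rn expr0n subr0 => /eqP; rewrite mulrn_eq0 => /eqP.
Qed.

Definition cubic_class S (i : nat) : Prop :=
  match i with 0 => I1 S | 1 => I2 S | 2 => I3 S | _ => I4 S end.

Lemma cubic_class_inj S i k : (i < 4)%N -> (k < 4)%N ->
  cubic_class S i -> cubic_class S k -> i = k.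
Proof.
rewrite /cubic_class /I1 /I2 /I3 /I4; have M0 := @Mform_eta S.
case: i => [|[|[|[|//]]]] _; case: k => [|[|[|[|//]]]] _ //.
- by move=> /lt_trans h /h; rewrite ltxx.
- by move=> h [e _]; rewrite e ltxx in h.
- by move=> h /M0 e; rewrite e ltxx in h.
- by move=> /lt_trans h /h; rewrite ltxx.
- by move=> h [e _]; rewrite e ltxx in h.
- by move=> h /M0 e; rewrite e ltxx in h.
- by move=> [e _]; rewrite e ltxx.
- by move=> [e _]; rewrite e ltxx.
- by move=> [_ /eqP].
- by move=> /M0 e; rewrite e ltxx.
- by move=> /M0 e; rewrite e ltxx.
- by move=> e [_ /eqP].
Qed.

(* A pattern (m, i, c) stands for mu_first m, the condition I_(i+1), and the vanishing
   (true) or not (false) of kappa, L, kappa1 and K1; None means no condition. *)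
Definition vanishing S : seq bool := [:: kappa S == 0; Lform S == 0; kappa1 S == 0; K1form S == 0].

Definition satisfies S (x : nat * nat * seq (option bool)) : Prop :=
  [/\ mu_first S x.1.1, cubic_class S x.1.2
    & forall n b, nth None x.2 n = Some b -> nth false (vanishing S) n = b].

Definition patterns : seq (nat * nat * seq (option bool)) :=
  let T := Some true in let F := Some false in
  [:: (0, 0, [::]); (0, 1, [::]); (0, 2, [::]); (0, 3, [::]);
    (1, 0, [::]); (1, 1, [::]); (1, 2, [:: F]); (1, 2, [:: T]); (1, 3, [::]);
    (2, 0, [:: F]); (2, 0, [:: T]); (2, 1, [:: F]); (2, 1, [:: T]); (2, 2, [:: F]);
    (2, 2, [:: T; T]); (2, 2, [:: T; F]); (2, 3, [::]);
    (3, 0, [:: F]); (3, 0, [:: T]); (3, 1, [::]); (3, 2, [:: F]); (3, 2, [:: T; T; F]);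
    (3, 2, [:: T; T; T]); (3, 2, [:: T; F]); (3, 3, [::]);
    (4, 0, [:: F]); (4, 0, [:: T; None; None; F]); (4, 0, [:: T; None; None; T]);
    (4, 1, [:: F]); (4, 1, [:: T]); (4, 2, [:: F]); (4, 2, [:: T; T; F]);
    (4, 2, [:: T; T; T; T]); (4, 2, [:: T; T; T; F]); (4, 2, [:: T; F]); (4, 3, [::])]%N.

Definition compatible (x y : nat * nat * seq (option bool)) : bool :=
  (x.1 == y.1) && all (fun n =>
    if (nth None x.2 n, nth None y.2 n) is (Some b, Some c) then b == c else true) (iota 0 4).

Lemma satisfies_compatible S x y : (x.1.2 < 4)%N -> (y.1.2 < 4)%N ->
  satisfies S x -> satisfies S y -> compatible x y.
Proof.
case: x y => [[m i] s] [[n k] t] /= i4 k4 [/= hm hi hs] [/= hn hk ht].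
rewrite /compatible (mu_first_inj hm hn) (cubic_class_inj i4 k4 hi hk) eqxx.
apply/allP => r _ /=; case E: (nth None s r) => [b|//]; case E': (nth None t r) => [c|//].
by rewrite -(hs _ _ E) -(ht _ _ E').
Qed.

Lemma row_cond_pattern S (j : 'I_36) :
  row_cond (tnth (Sigma R) j) S -> satisfies S (nth (0, 0, [::])%N patterns j).
Proof.
rewrite (tnth_nth (Row 0 0 [::] (fun=> False))); case: j => j /= _.
do 36?[case: j => [|j] /=]; last by rewrite nth_nil.
all: rewrite /satisfies /= /cubic_class.
all: repeat match goal with
  | |- _ /\ _ -> _ => case
  | |- and3 _ _ _ -> _ => case
  | |- and4 _ _ _ _ -> _ => case
  | |- and5 _ _ _ _ _ -> _ => case
  | |- _ -> _ => move=> ?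
  end.
all: split=> //= -[|[|[|[|n]]]] b //=; try by rewrite nth_nil.
all: case=> <-; first [by apply/eqP | exact: negbTE].
Qed.

Lemma row_cond_inj S (j j' : 'I_36) : row_cond (tnth (Sigma R) j) S ->
  row_cond (tnth (Sigma R) j') S -> j = j'.
Proof.
pose x0 : nat * nat * seq (option bool) := (0, 0, [::])%N.
have pw : pairwise (fun x y => ~~ compatible x y) patterns by vm_compute.
have c4 (i : 'I_36) : ((nth x0 patterns i).1.2 < 4)%N.
  by apply: (all_nthP x0 (a := fun x => (x.1.2 < 4)%N)); rewrite ?ltn_ord.
have lt (i k : 'I_36) : (i < k)%N -> row_cond (tnth (Sigma R) i) S ->
    row_cond (tnth (Sigma R) k) S -> False.
  move=> ik /row_cond_pattern hi /row_cond_pattern hk.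
  have /negP[] : ~~ compatible (nth x0 patterns i) (nth x0 patterns k).
    by apply: (pairwiseP x0 pw) ik; rewrite inE ltn_ord.
  by apply: satisfies_compatible hi hk; exact: c4.
by move=> h h'; apply/val_inj; case: (ltngtP j j') => // /lt; [case/(_ h h') | case/(_ h' h)].
Qed.

Lemma has_row_cond S (j : 'I_36) : QSess S ->
  has_row S (tnth (Sigma R) j) <-> row_cond (tnth (Sigma R) j) S.
Proof.
move=> hS; rewrite has_rowP; have [k [hc hf]] := classification hS.
split=> [H|H]; last by rewrite (row_cond_inj H hc).
suff -> : j = k by [].
have [[_ _ nj] [_ _ nk]] := (Sigma_consistent j, Sigma_consistent k).
by apply: Sigma_form_inj; exact: (has_form_perm nj nk H hf).
Qed.

End Exclusive.

(** * A system for each row *)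

Section HomogeneousFactors.
Variables (K : fieldType) (n : nat).
Implicit Types p q : {mpoly K[n]}.

Lemma pihomog_oversize k p : (msize p <= k)%N -> pihomog mdeg k p = 0.
Proof.
move=> hk; rewrite pihomogE big_seq_cond big_pred0 // => m.
apply/andP => -[/msize_mdeg_lt h /eqP e]; by rewrite e ltnNge hk in h.
Qed.

(** The component of degree k of a product is the product of the top components, so a factor of a
    form may be replaced by its top component. This makes an arbitrary common factor of P and Q
    homogeneous. *)
Lemma homog_top_factor d k p q : (p * q) \is k.-homog -> msize p = d.+1 ->
  exists r, p * q = pihomog mdeg d p * r.
Proof.
move=> hpq hd; have [->|q0] := eqVneq q 0; first by exists 0; rewrite !mulr0.
have p0 : p != 0 by apply: contra_eq_neq hd => ->; rewrite msize0.
have [a ha] : exists a, msize q = a.+1.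
  by exists (msize q).-1; rewrite prednK // lt0n msize_poly_eq0.
have pq0 : p * q != 0 by rewrite mulf_neq0.
have kE : k = (d + a)%N.
  rewrite (dhomog_uniq pq0 hpq (dhomog_msize hpq)).
  by rewrite (msizeM p0 q0) hd ha addSn addnS.
exists (pihomog mdeg a q); rewrite -[LHS](pihomog_dE hpq).
have -> : p * q = \sum_(i < a.+1) p * pihomog mdeg i q.
  by rewrite -mulr_sumr -pihomog_partitionE // ha.
rewrite raddf_sum big_ord_recr /= big1 ?add0r => [|i _].
  by rewrite kE (pihomogM_homog _ _ (pihomogP _ _ _)) leq_addl addnK.
rewrite (pihomogM_homog _ _ (pihomogP _ _ _)) pihomog_oversize ?mul0r ?if_same //.
by rewrite hd kE -addnBA ?(ltnW (ltn_ord i)) // -(addn1 d) leq_add2l subn_gt0 ltn_ord.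
Qed.

End HomogeneousFactors.

Section BinaryZero.
Variables (K : closedFieldType) (inj : injective (fun n : nat => n%:R : K)).

(** f and h are the two dehomogenizations of g. If f has no root it is a constant c, and then h = c
    y^d by homogeneity, so h(0) = 0 after all. *)
Lemma binary_form_zero (g : K -> K -> K) (f h : {poly K}) d :
  (forall x, f.[x] = g x 1) -> (forall y, h.[y] = g 1 y) ->
  (forall c x y, g (c * x) (c * y) = c ^+ d * g x y) -> (0 < d)%N ->
  exists x y, (x != 0) || (y != 0) /\ g x y = 0.
Proof.
move=> hf hh hg d0; have [h0|hn] := eqVneq h.[0] 0.
  by exists 1, 0; rewrite oner_neq0 -hh.
have [fs|] := boolP (size f == 1%N); last first.
  case/closed_rootP => x /rootP fx.
  by exists x, 1; rewrite oner_neq0 orbT -hf.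
have [c fE] : exists c, f = c%:P by case/size_poly1P: fs => c _ ->; exists c.
(* The extra factor X covers n = 0, where the homogeneity relation cannot be used. *)
have e0 : 'X * (h - c *: 'X^d) = 0.
  apply: poly_nat_roots => // n; rewrite !hornerE hh.
  have [->|n0] := eqVneq (n%:R : K) 0; first by rewrite mul0r.
  have -> : g 1 n%:R = n%:R ^+ d * g (n%:R^-1) 1 by rewrite -hg mulfV // mulr1.
  by rewrite -hf fE hornerC mulrC [c * _]mulrC subrr mul0r.
move/eqP: e0; rewrite mulf_eq0 polyX_eq0 /= subr_eq0 => /eqP hE.
by move: hn; rewrite hE !hornerE expr0n eqn0Ngt d0 mulr0 eqxx.
Qed.

End BinaryZero.

Lemma dhomog_meval_scale (K : comNzRingType) n d (p : {mpoly K[n]}) (c : K) v :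
  p \is d.-homog -> p.@[fun i => c * v i] = c ^+ d * p.@[v].
Proof.
move=> hp; rewrite !mevalE mulr_sumr; apply: eq_big_seq => m /(dhomog_mf hp) hm.
have {}hm : mdeg m = d := hm.
rewrite mulrCA; congr (_ * _); rewrite -hm mdegE -prodrXr -big_split /=.
by apply: eq_bigr => i _; rewrite exprMn.
Qed.

Lemma horner_mmap_polyC (K : comNzRingType) n (p : {mpoly K[n]}) (h : 'I_n -> {poly K}) x :
  (mmap polyC h p).[x] = p.@[fun i => (h i).[x]].
Proof.
rewrite mevalE /mmap horner_sum; apply: eq_bigr => m _.
rewrite hornerM hornerC /mmap1 horner_prod; congr (_ * _).
by apply: eq_bigr => i _; rewrite horner_exp.
Qed.

(** * Certifying membership in [QSess] *)

Section EssentialSystems.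
Variable R : realType.
Local Notation CC := R[i].
Local Notation "x %:C" := (real_complex R x).
Implicit Types S : qsys R.

Lemma cut_cval (A : comNzRingType) (G : conic A) (x y t X Y : A) :
  (cut20 G x y).[t] * X ^+ 2 + (cut11 G x y).[t] * X * Y + (cut02 G x y).[t] * Y ^+ 2 =
  cval G X Y (t * (x * Y - y * X)).
Proof.
rewrite /cut20 /cut11 /cut02 /cval.
by rewrite !(hornerD, hornerN, hornerM, hornerC, hornerX, hornerXn); ring.
Qed.

(** A homogeneous common factor of positive degree has a zero on every line Z = t (xY - yX). It is a
    common root of the two restrictions, so the resultant vanishes for every natural number t. *)
Lemma rho_common_factor (F G : conic R) (D A B : {mpoly R[3]}) x y :
  cpoly F = D * A -> cpoly G = D * B -> (1 < msize D)%N -> rho F G x y = 0.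
Proof.
move=> hF hG; case hd: (msize D) => [|[|d]] // _.
have [A' hA] : exists r, D * A = pihomog mdeg d.+1 D * r.
  by apply: (homog_top_factor (k := 2) _ hd); rewrite -hF; exact: cpoly_homog.
have [B' hB] : exists r, D * B = pihomog mdeg d.+1 D * r.
  by apply: (homog_top_factor (k := 2) _ hd); rewrite -hG; exact: cpoly_homog.
have inj : injective (fun n : nat => n%:R : CC) by apply: mulrIn; exact: oner_neq0.
apply/eqP; rewrite -(map_poly_eq0 (real_complex R)) rho_map; apply/eqP.
apply: (poly_nat_roots inj) => n; set t : CC := n%:R.
pose E : {mpoly CC[3]} := complexify (pihomog mdeg d.+1 D).
have Eh : E \is d.+1.-homog.
  apply/dhomogP => m; rewrite mcoeff_msupp mcoeff_map_mpoly fmorph_eq0 -mcoeff_msupp.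
  exact: (dhomog_mf (pihomogP _ _ _)).
pose v X Y (i : 'I_3) : CC := nth 0 [:: X; Y; t * (x%:C * Y - y%:C * X)] i.
have [X [Y [XY0 EXY]]] : exists X Y, (X != 0) || (Y != 0) /\ E.@[v X Y] = 0.
  pose f := mmap polyC (fun i : 'I_3 => nth 0 [:: 'X; 1%:P; t%:P * (x%:C%:P - y%:C%:P * 'X)] i) E.
  pose h := mmap polyC (fun i : 'I_3 => nth 0 [:: 1%:P; 'X; t%:P * (x%:C%:P * 'X - y%:C%:P)] i) E.
  apply: (binary_form_zero inj (f := f) (h := h) (d := d.+1)) => //.
  - move=> X; rewrite /f horner_mmap_polyC; apply: meval_eq => -[[|[|[|k]]] hk] //;
    by rewrite /v /= !(hornerX, hornerM, hornerD, hornerN, hornerC, mulr1).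
  - move=> X; rewrite /h horner_mmap_polyC; apply: meval_eq => -[[|[|[|k]]] hk] //;
    by rewrite /v /= !(hornerX, hornerM, hornerD, hornerN, hornerC, mulr1).
  - move=> c X Y; rewrite -(dhomog_meval_scale _ _ Eh); apply: meval_eq.
    by move=> -[[|[|[|k]]] hk] //; rewrite /v /=; ring.
have root0 (H : conic R) q : cpoly H = pihomog mdeg d.+1 D * q ->
    cval (ccx H) X Y (t * (x%:C * Y - y%:C * X)) = 0.
  move=> hH; transitivity (cpoly (ccx H)).@[v X Y]; first by rewrite meval_cpoly.
  rewrite -complexify_cpoly hH /complexify rmorphM mevalM.
  exact: (etrans (congr1 (fun z => z * _) EXY) (mul0r _)).
apply: (etrans (res2_map (horner_eval t) _ _ _ _ _ _)).
apply: (res2_common_root _ _ XY0).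
- by apply: (etrans (cut_cval _ _ _ _ _ _)); apply: (root0 F A'); rewrite hF.
- by apply: (etrans (cut_cval _ _ _ _ _ _)); apply: (root0 G B'); rewrite hG.
Qed.

Lemma bigC_meval S x y :
  (bigC S).@[fun i : 'I_3 => nth 0 [:: x; y; 0] i] = (C2 S).@[fun j : 'I_2 => nth 0 [:: x; y] j].
Proof.
rewrite /bigC mevalB !mevalM !mevalXU bigPE bigQE !meval_cpoly C2E /bcubic /cval.
by rewrite !exprS !expr0 !mulr1 !(mevalD, mevalM, mevalC, mevalXU) /=; ring.
Qed.

(** A nonconstant common factor would make [rho], and with it every mu_i, vanish identically; one
    nonzero value thus certifies coprimality. The factor D = 0 is excluded by C_2. *)
Lemma mu_neq0_coprime S i : C2 S != 0 -> mu S i != 0 -> coprime_PQ S.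
Proof.
move=> C20 mun D A B hP hQ.
have D0 : D != 0.
  apply: contra_neq C20 => D0; apply: mpoly2_eq0 => x y.
  rewrite D0 !mul0r in hP hQ; rewrite -bigC_meval /bigC hP hQ.
  by rewrite !mulr0 subrr meval0.
have [D1|D1] := leqP (msize D) 1; last first.
  case/eqP: mun; apply: mu_eq0 => x y; rewrite bigPE in hP; rewrite bigQE in hQ.
  by rewrite (rho_common_factor x y hP hQ D1) coef0.
have DE := msize1_polyC D1; apply/unitrP; exists (D@_0)^-1%:MP.
have c0 : D@_0 != 0 by apply: contra_neq D0 => c0; rewrite DE c0.
by rewrite DE mcoeffC eqxx mulr1 -!mpolyCM mulVf // mulfV.
Qed.

Lemma msize_graded_sum (f0 f1 f2 : {mpoly R[2]}) : f0 \is 0.-homog -> f1 \is 1.-homog ->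
  f2 \is 2.-homog -> (msize (f0 + f1 + f2) <= 3)%N /\ (f2 != 0 -> msize (f0 + f1 + f2) = 3).
Proof.
move=> h0 h1 h2; have coef m : (f0 + f1 + f2)@_m = f0@_m + f1@_m + f2@_m by rewrite !mcoeffD.
have le3 : (msize (f0 + f1 + f2) <= 3)%N.
  rewrite msizeE; apply/bigmax_leqP_seq => m; rewrite mcoeff_msupp coef => + _.
  apply: contraR; rewrite -ltnNge ltnS => hm; have ne k : (k < 3)%N -> mdeg m != k.
    by move=> hk; rewrite neq_ltn (leq_trans hk hm) orbT.
  by rewrite (dhomog_nemf_coeff h0) ?(dhomog_nemf_coeff h1) ?(dhomog_nemf_coeff h2) ?addr0 //;
     exact: ne.
split=> // f2n; apply/eqP; rewrite eqn_leq le3 /=.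
have hm : mdeg (mlead f2) = 2 := dhomog_mf h2 (mlead_supp f2n).
suff /msize_mdeg_lt : mlead f2 \in msupp (f0 + f1 + f2) by rewrite hm.
have ne0 : mdeg (mlead f2) != 0 by rewrite hm.
have ne1 : mdeg (mlead f2) != 1 by rewrite hm.
rewrite mcoeff_msupp coef (dhomog_nemf_coeff h0 ne0) (dhomog_nemf_coeff h1 ne1) !add0r.
by rewrite -mcoeff_msupp mlead_supp.
Qed.

Lemma QSess_intro S i : C2 S != 0 -> mu S i != 0 -> QSess S.
Proof.
move=> C20 mun; split; last 2 first.
- exact: (mu_neq0_coprime C20 mun).
- case=> A hA; case/eqP: C20; apply: mpoly2_eq0 => x y.
  by rewrite -bigC_meval hA mevalM mevalXU mul0r.
have X (j : 'I_2) : ('X_j : {mpoly R[2]}) \is 1.-homog := mpolyX_homog R j.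
have XX (j k : 'I_2) : ('X_j * 'X_k : {mpoly R[2]}) \is 2.-homog := dhomogM (X j) (X k).
have lin a b : a *: vx R + b *: vy R \is 1.-homog by rewrite rpredD ?rpredZ ?X.
have quad a b c : a *: vx R ^+ 2 + b *: (vx R * vy R) + c *: vy R ^+ 2 \is 2.-homog.
  by rewrite !expr2 !rpredD ?rpredZ ?XX.
have [lep eqp] := msize_graded_sum (mpolyC_homog 2 (S a00)) (lin (S a10) (S a01))
  (quad (S a20) (S a11 *+ 2) (S a02)).
have [leq eqq] := msize_graded_sum (mpolyC_homog 2 (S b00)) (lin (S b10) (S b01))
  (quad (S b20) (S b11 *+ 2) (S b02)).
rewrite /quadratic; have [p20|p20] := eqVneq (p2 S) 0; last first.
  by rewrite (eqp p20) (maxn_idPl _).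
have q20 : q2 S != 0 by apply: contra_neq C20 => q20; rewrite /C2 p20 q20 !mulr0 subrr.
by rewrite (eqq q20) (maxn_idPr _).
Qed.

End EssentialSystems.

Section RhoCoefficients.
Variable A : comNzRingType.
Implicit Types (f g : nat -> A) (G : conic A).

(** Written recursively so that simplification at a numeral k yields a closed expression for [ring]
    and [lra]. *)
Fixpoint conv f g (k : nat) : A :=
  if k is k'.+1 then f 0%N * g k + conv (fun i => f i.+1) g k' else f 0%N * g 0%N.

Lemma convE f g k : conv f g k = \sum_(j < k.+1) f j * g (k - j)%N.
Proof.
elim: k f => [|k IH] f; first by rewrite big_ord_recl big_ord0 addr0.
by rewrite big_ord_recl /= IH.
Qed.

Lemma coefM_conv (p q : {poly A}) k : (p * q)`_k = conv (fun i => p`_i) (fun i => q`_i) k.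
Proof. by rewrite coefM convE. Qed.

Lemma eq_conv f f' g g' : f =1 f' -> g =1 g' -> conv f g =1 conv f' g'.
Proof. by move=> ff gg k; rewrite !convE; apply: eq_bigr => j _; rewrite ff gg. Qed.

Definition cutl20 G (x y : A) (k : nat) : A := nth 0 [:: c20 G; - (c10 G * y); c00 G * y ^+ 2] k.
Definition cutl11 G (x y : A) (k : nat) : A :=
  nth 0 [:: c11 G; c10 G * x - c01 G * y; - (c00 G * x * y *+ 2)] k.
Definition cutl02 G (x y : A) (k : nat) : A := nth 0 [:: c02 G; c01 G * x; c00 G * x ^+ 2] k.

Definition rho_coefs (F G : conic A) (x y : A) : nat -> A :=
  let minor a f c d k := conv a f k - conv c d k in
  let: (a, b, c) := (cutl20 F x y, cutl11 F x y, cutl02 F x y) in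
  let: (d, e, f) := (cutl20 G x y, cutl11 G x y, cutl02 G x y) in
  fun k => conv (minor a f c d) (minor a f c d) k - conv (minor a e b d) (minor b f c e) k.

Lemma coef_quadratic (a b c : A) k :
  (a%:P + b%:P * 'X + c%:P * 'X^2)`_k = nth 0 [:: a; b; c] k.
Proof.
rewrite !coefD !coefCM coefC coefX coefXn.
by case: k => [|[|[|k]]] /=; rewrite ?(mulr1, mulr0, addr0, add0r) ?nth_nil.
Qed.

Lemma coef_rho (F G : conic A) x y k : (rho F G x y)`_k = rho_coefs F G x y k.
Proof.
have h20 H i : (cut20 H x y)`_i = cutl20 H x y i.
  by rewrite /cut20 -mulNr -polyCN coef_quadratic.
have h11 H i : (cut11 H x y)`_i = cutl11 H x y i.
  by rewrite /cut11 -[- (_ * 'X^2)]mulNr -polyCN coef_quadratic.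
have h02 H i : (cut02 H x y)`_i = cutl02 H x y i by rewrite /cut02 coef_quadratic.
rewrite /rho /res2 expr2 coefB !coefM_conv /rho_coefs.
congr (_ - _); apply: eq_conv => i; rewrite coefB !coefM_conv;
by congr (_ - _); apply: eq_conv => j.
Qed.

End RhoCoefficients.

Section Examples.
Variable R : realType.
Implicit Types S : qsys R.

Lemma mu_first_intro S m (x y : R) :
  (forall i, (i < m)%N -> forall x y, rho_coefs (conicP S) (conicQ S) x y i = 0) ->
  rho_coefs (conicP S) (conicQ S) x y m <> 0 -> mu_first S m.
Proof.
move=> h0 h1; split=> [i im|]; first by apply: mu_eq0 => ? ?; rewrite coef_rho h0.
by apply: contra_notN h1 => /eqP h; rewrite -coef_rho -mu_rho h meval0.
Qed.

(** The order is a00, a10, a01, a20, a11, a02 and then likewise for b; an entry 1 at a11 or b11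
    stands for the term 2xy. *)
Definition system (l : seq R) : qsys R := fun i => nth 0 l i.

Lemma example_intro S m (j : 'I_36) : C2 S != 0 -> mu_first S m ->
  row_cond (tnth (Sigma R) j) S ->
  exists2 S, QSess S & has_row S (tnth (Sigma R) j).
Proof.
move=> C20 hmu hj; have hS := QSess_intro C20 (proj2 hmu).
by exists S => //; apply/has_row_cond.
Qed.

End Examples.

Ltac compute_system :=
  rewrite /rho_coefs /cutl20 /cutl11 /cutl02 /conicP /conicQ /system /=.

Ltac check_condition :=
  lazymatch goal with
  | H : mu_first _ _ |- mu_first _ _ => exact: H
  | |- I1 _ => rewrite /I1 etaE; compute_system; lra
  | |- I2 _ => rewrite /I2 etaE; compute_system; lra
  | |- eta _ = 0 => rewrite etaE; compute_system; ring
  | |- I4 _ => rewrite /I4 MformE; apply/bquad_eq0; split; compute_system; ring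
  | |- is_true (Mform _ != 0) => apply/eqP; rewrite MformE => /bquad_eq0[]; compute_system; lra
  | |- kappa _ = 0 => apply/eqP; rewrite kappaE mpolyC_eq0; apply/eqP; compute_system; ring
  | |- is_true (kappa _ != 0) =>
      rewrite kappaE mpolyC_eq0; apply/eqP; compute_system; lra
  | |- kappa1 _ = 0 => apply/eqP; rewrite kappa1E mpolyC_eq0; apply/eqP; compute_system; ring
  | |- is_true (kappa1 _ != 0) =>
      rewrite kappa1E mpolyC_eq0; apply/eqP; compute_system; lra
  | |- Lform _ = 0 => rewrite LformE; apply/bquad_eq0; split; compute_system; ring
  | |- is_true (Lform _ != 0) => apply/eqP; rewrite LformE => /bquad_eq0[]; compute_system; lra
  | |- K1form _ = 0 => rewrite K1formE; apply/bcubic_eq0; split; compute_system; ring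
  | |- is_true (K1form _ != 0) =>
      apply/eqP; rewrite K1formE => /bcubic_eq0[]; compute_system; lra
  end.

(* m is the order of vanishing of mu, and mu_m does not vanish at (x, y). *)
Ltac example m l x y :=
  let hmu := fresh in
  have hmu : mu_first (system l) m;
  [ apply: (@mu_first_intro _ _ m x y);
    [ case=> [|[|[|[|//]]]] // _ ? ?; compute_system; ring | compute_system; lra ]
  | apply: (example_intro _ hmu);
    [ apply/eqP; rewrite C2E => /bcubic_eq0[]; compute_system; lra
    | rewrite (tnth_nth (Row 0 0 [::] (fun=> False))) /= ?/I3;
      repeat match goal with
      | |- _ /\ _ => split
      | |- and3 _ _ _ => split
      | |- and4 _ _ _ _ => split
      | |- and5 _ _ _ _ _ => split
      end; check_condition ] ].

Lemma row_inhabited (R : realType) (j : 'I_36) :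
  exists2 S : qsys R, QSess S & has_row S (tnth (Sigma R) j).
Proof.
case: j => j; do 36?[case: j => [|j]] => // hj.
(* Here p = x^2 and q = y^2, so that C_2 = x y (x - y). *)
- example 0%N ([:: 0; 0; 0; 1; 0; 0; 0; 0; 0; 0; 0; 1] : seq R) (1 : R) (0 : R).
- example 0%N ([:: 0; 0; 0; 0; 0; 1; 0; 0; 0; 1; 0; 0] : seq R) (1 : R) (0 : R).
- example 0%N ([:: 0; 0; 0; 1; 1; -1; 0; 0; 0; 0; 1; 0] : seq R) (1 : R) (0 : R).
- example 0%N ([:: 0; 0; 0; 0; 1; 0; 0; 0; 0; -1; 0; 2] : seq R) (1 : R) (0 : R).
- example 1%N ([:: 0; 1; 0; 0; 0; 1; 0; 0; 0; 0; 1; 0] : seq R) (0 : R) (1 : R).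
- example 1%N ([:: 0; 1; 0; 0; 0; 1; 0; 0; 0; 0; -1; 0] : seq R) (0 : R) (1 : R).
- example 1%N ([:: 0; 0; 0; 0; 1; 0; 0; 1; 0; 0; 1; 2] : seq R) (0 : R) (1 : R).
- example 1%N ([:: 0; 0; 1; 1; 0; 0; 0; 0; 0; 0; 1; 0] : seq R) (1 : R) (0 : R).
- example 1%N ([:: 0; 0; 1; 2; 0; 0; 0; 0; 0; -1; 1; 0] : seq R) (1 : R) (0 : R).
- example 2%N ([:: 1; 0; 0; 0; 0; 1; 0; 0; 0; 0; 1; 0] : seq R) (0 : R) (1 : R).
- example 2%N ([:: 0; 1; 0; 0; 0; 0; 0; 0; 0; 1; 0; -1] : seq R) (1 : R) (0 : R).
- example 2%N ([:: 1; 0; 0; 0; 0; 1; 0; 0; 0; 0; -1; 0] : seq R) (0 : R) (1 : R).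
- example 2%N ([:: 0; 1; 0; 0; 0; 0; 0; 0; 0; 1; 0; 1] : seq R) (1 : R) (0 : R).
- example 2%N ([:: 0; 0; 0; 0; 1; 0; 1; 0; 0; 0; 1; 2] : seq R) (0 : R) (1 : R).
- example 2%N ([:: 0; 1; 1; 0; 0; 0; 0; 0; 0; 0; 1; 0] : seq R) (1 : R) (1 : R).
- example 2%N ([:: 0; 1; 0; 0; 0; 0; 0; 0; 0; 0; 0; 1] : seq R) (0 : R) (1 : R).
- example 2%N ([:: 0; 0; 1; 0; 0; 0; 0; 0; 0; 1; 0; 0] : seq R) (1 : R) (0 : R).
- example 3%N ([:: 1; 0; 0; 0; 1; 0; 0; 1; 0; 1; 0; 0] : seq R) (1 : R) (0 : R).
- example 3%N ([:: 1; 1; 0; 0; 1; 0; 0; 0; 0; 0; 1; 0] : seq R) (1 : R) (1 : R).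
- example 3%N ([:: 1; 0; 0; 0; 1; 0; 0; 1; 0; -1; 0; 0] : seq R) (1 : R) (0 : R).
- example 3%N ([:: 0; 1; -1; 0; 1; 0; 0; 1; 0; 0; 1; 2] : seq R) (0 : R) (1 : R).
- example 3%N ([:: 1; 0; 1; 0; 0; 0; 0; 0; 0; 0; 1; 0] : seq R) (1 : R) (1 : R).
- example 3%N ([:: 1; 1; 0; 0; 0; 0; 0; 0; 0; 0; 1; 0] : seq R) (1 : R) (1 : R).
- example 3%N ([:: 0; 0; 1; 1; 0; 0; 0; 1; 0; 0; 0; 0] : seq R) (1 : R) (0 : R).
- example 3%N ([:: 0; 1; 0; 0; 0; 1; 0; 0; 1; 0; 0; 0] : seq R) (0 : R) (1 : R).
- example 4%N ([:: 1; 0; 0; 0; 1; 0; 0; 0; 0; 1; 0; 0] : seq R) (1 : R) (0 : R).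
- example 4%N ([:: 1; 0; 0; 1; 1; 0; 0; 1; 0; 0; 0; 0] : seq R) (1 : R) (0 : R).
- example 4%N ([:: 1; 0; 0; 0; 1; 0; 0; 0; 0; 0; 1; 0] : seq R) (1 : R) (1 : R).
- example 4%N ([:: 1; 0; 0; 0; 1; 0; 0; 0; 0; -1; 0; 0] : seq R) (1 : R) (0 : R).
- example 4%N ([:: 1; 0; 0; 0; 0; 0; 0; 0; 0; 1; 0; 1] : seq R) (1 : R) (0 : R).
- example 4%N ([:: 1; 0; 0; 0; 1; 0; 1; 0; 0; 0; 1; 2] : seq R) (0 : R) (1 : R).
- example 4%N ([:: 1; 0; 0; 0; 1; 0; 0; 1; 0; 0; 0; 0] : seq R) (1 : R) (1 : R).
- example 4%N ([:: 1; 0; 0; 0; 0; 0; 0; 0; 0; 0; 1; 0] : seq R) (1 : R) (1 : R).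
- example 4%N ([:: 1; 0; 0; 0; 1; 0; 0; 0; 1; 0; 0; 0] : seq R) (1 : R) (1 : R).
- example 4%N ([:: 1; 0; 0; 0; 0; 0; 0; 0; 0; 0; 0; 1] : seq R) (0 : R) (1 : R).
- example 4%N ([:: 1; 0; 0; 0; 0; 0; 0; 0; 0; 1; 0; 0] : seq R) (1 : R) (0 : R).
Qed.

Theorem theorem5p1 (R : realType) :
  [/\ forall S : qsys R, QSess S -> exists j : 'I_36, has_row S (tnth (Sigma R) j),
      forall j : 'I_36, exists2 S : qsys R, QSess S & has_row S (tnth (Sigma R) j)
    & forall (S : qsys R) (j : 'I_36), QSess S ->
        (has_row S (tnth (Sigma R) j) <-> row_cond (tnth (Sigma R) j) S)].
Proof.
split; [|exact: row_inhabited | by move=> S j; exact: has_row_cond].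
move=> S hS; have [j [_ H]] := classification hS.
by exists j; apply/has_rowP.
Qed.
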